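(* Consider a beam with cracks, with the axial force disregarded ($U_a=0$). (a) The bending potential energy $U_b$ is a convex, lower-semicontinuous function on $V$. The operator $\mathcal{A}:V\to V'$ is linear, symmetric and coercive on $V$, $U_b(u)=\frac12\langle\mathcal{A}u,u\rangle_V$ and $\partial U_b(u)=\mathcal{A}u$ for any $u\in V$. (b) The abstract equation of motion for the beam with cracks, i.e. the equation satisfied by a motion $y$ at which the action $I$ has a stationary value, $\nabla I(y)=0$ in $W'$, is $$\ddot y+\mathcal{A}y+c_d\,\dot y=p,$$ which is satisfied in $V'$, a.e. for $t\in[0,T]$. (c) If $u\in D(\mathcal{A})$, then $u$ satisfies the boundary conditions $$u(0)=u(\pi)=0,\qquad u''(0)=u''(\pi)=0,$$ and the joint conditions, for $i=1,\dots,m$, $$J[u](x_i)=0,\quad J[u''](x_i)=0,\quad J[u'''](x_i)=0,\quad J[u'](x_i)=\theta_i u''(x_i^+),$$ as well as $\mathcal{A}u=u''''$ a.e. on every interval $l_i$, $i=1,\dots,m+1$. With this regularity ($y(\cdot,t)\in D(\mathcal{A})$), the equation in (b) can be written as $$\ddot y+y''''+c_d\,\dot y=p .$$ This looks the same as the classical Euler–Bernoulli equation for a beam with no cracks, but its abstract formulation uses the operator $\mathcal{A}$ containing the crack terms; in particular, $y(\cdot,t)\in V$ for a.e. $t\in[0,T]$.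
   Context: A beam on $[0,\pi]$ (nondimensional variables) with transverse deflection $y=y(x,t)$ has $m$ cracks at $0=x_0<x_1<\dots<x_m<x_{m+1}=\pi$ with flexibilities $\theta_i>0$. Let $T>0$ be the final time, $c_d\ge0$ the damping coefficient and $p=p(x,t)$ the transverse load. Put $l_i=(x_{i-1},x_i)$, $i=1,\dots,m+1$, and $J[u](x)=u(x^+)-u(x^-)$. Spaces: $H=\bigoplus_{i=1}^{m+1}L^2(l_i)$ with $(u,v)_H=\sum_{i=1}^{m+1}(u,v)_i$, where $(\cdot,\cdot)_i$ is the $L^2(l_i)$ inner product, and $|u|_H^2=(u,u)_H$; $$V=\Big\{u\in\bigoplus_{i=1}^{m+1}H^2(l_i): u(0)=u(\pi)=0,\ J[u](x_i)=0,\ i=1,\dots,m\Big\},$$ a Hilbert space with inner product $\sum_{i=1}^{m+1}(u'',v'')_i+\sum_{i=1}^m J[u'](x_i)J[v'](x_i)$ and norm $\|\cdot\|_V$ (derivatives of order 2 and higher are taken on each $l_i$). $V\subset H\subset V'$ with continuous dense embeddings; the pairing $\langle\cdot,\cdot\rangle_V$ between $V'$ and $V$ extends $(\cdot,\cdot)_H$. Further, $$W=\{y: y\in L^2(0,T;V),\ \dot y\in L^2(0,T;H),\ \ddot y\in L^2(0,T;V')\},$$ with dots denoting time derivatives in the sense of distributions; $W$ is a Hilbert space with the standard inner product. Operator: $\langle\mathcal{A}u,v\rangle_V=\sum_{i=1}^{m+1}(u'',v'')_i+\sum_{i=1}^m\frac1{\theta_i}J[u'](x_i)J[v'](x_i)$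 for any $u,v\in V$, and $D(\mathcal{A})=\{v\in V:\mathcal{A}v\in H\}$. Symmetric means $\langle\mathcal{A}u,v\rangle_V=\langle\mathcal{A}v,u\rangle_V$; coercive means $\langle\mathcal{A}u,u\rangle_V\ge c\|u\|_V^2$ for some $c>0$ and all $u\in V$. Subdifferential: for a proper, convex, lower-semicontinuous $\phi$ on $V$, $\partial\phi(u)=\{u^*\in V':\phi(w)\ge\phi(u)+\langle u^*,w-u\rangle_V\ \text{for any } w\in V\}$; $\partial\phi(u)=u^*$ means that this set is the singleton $\{u^*\}$. Energies and work: kinetic energy $T_k(y)=\frac12|\dot y|_H^2$; bending potential energy $U_b(y)=\frac12\big(|y''|_H^2+\sum_{i=1}^m\frac1{\theta_i}|J[y'](x_i)|^2\big)$; external work $\mathcal{W}_{ext}(y)=(p,y)_H$; dissipative work $\mathcal{W}_d(y)=-c_d(\dot y,y)_H$ of the viscous damping force $-c_d\dot y$. Action (Extended Hamilton's Principle): with $t_1<t_2$ the time limits of the action, $I(y)=\int_{t_1}^{t_2}\big(T_k(y)-U_b(y)+\mathcal{W}_d(y)+\mathcal{W}_{ext}(y)\big)\,dt$. Its Gâteaux derivative $\nabla I(y)\in W'$ is defined by $\langle\nabla I(y),\eta\rangle_W=I'(y,\eta)$ for any $\eta\in W$, where $I'(y,\eta)=\lim_{\alpha\to0+}\frac{I(y+\alpha\eta)-I(y)}{\alpha}$ is the directional derivative, except that the contribution of the non-conservative damping work is defined in a non-variational manner (Rayleigh's dissipation functional): for $\eta(x,t)=\zeta(t)v(x)$, with $v\in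 V$ and $\zeta$ smooth on $[t_1,t_2]$, $\zeta(t_1)=\zeta(t_2)=0$, it is $\mathcal{W}_d'(y,\eta)=-c_d\int_{t_1}^{t_2}(\dot y(t),v)_H\,\zeta(t)\,dt$. *)

(* Defs.v *)
From HB Require Import structures.
From mathcomp Require Import all_boot all_order all_algebra.
From mathcomp Require Import all_classical all_reals all_analysis.
Import Order.TTheory GRing.Theory Num.Theory.
Import numFieldNormedType.Exports.

Set Implicit Arguments.
Unset Strict Implicit.
Unset Printing Implicit Defensive.

Local Open Scope classical_set_scope.
Local Open Scope ring_scope.

(* Elements of L^2, of Sobolev spaces and of Bochner spaces are handled through
   representatives: the spaces below are predicates on functions, and equality
   in these spaces is equality almost everywhere. *)

(* Real functions of one real variable, and functionals on them; R^o makes these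
   function types vector spaces over R. *)
Notation fct R := (R -> R^o).
Notation functional R := (fct R -> R^o).

Section OneVariable.
Context {R : realType}.
Notation mu := (@lebesgue_measure R).
Implicit Types (a b x r : R) (u v g : R -> R).

Definition L2 a b u : Prop := u \_ `]a, b[ \in Lfun mu 2%:E.

Definition smooth u : Prop := forall n x, derivable (derive1n n u) x 1.

(* Test functions of the open interval (a, b): smooth with compact support. *)
Definition test_fun a b u : Prop :=
  smooth u /\ exists c d, [/\ a < c, d < b &
                              forall s, ~~ (c <= s <= d) -> u s = 0].

Definition weak_deriv a b u g : Prop := forall phi : R -> R, test_fun a b phi ->
  \int[mu]_(s in `]a, b[) (u s * derive1 phi s)
  = - \int[mu]_(s in `]a, b[) (g s * phi s).

(* One-sided values u(x^+), u(x^-) of the a.e. class of u: limits of some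
   representative (they do not depend on the representative). *)
Definition is_right_val u x r : Prop := exists w : R -> R,
  (\forall s \ae mu, w s = u s) /\ w s @[s --> x^'+] --> r.
Definition is_left_val u x r : Prop := exists w : R -> R,
  (\forall s \ae mu, w s = u s) /\ w s @[s --> x^'-] --> r.

Definition right_val u x : R := xget 0 [set r | is_right_val u x r].
Definition left_val u x : R := xget 0 [set r | is_left_val u x r].

(* [jump] is only meaningful when both one-sided values exist; [is_jump] says
   in addition that they do. *)
Definition jump u x : R := right_val u x - left_val u x.
Definition is_jump u x j : Prop :=
  exists r l, [/\ is_right_val u x r, is_left_val u x l & j = r - l].

End OneVariable.

(* Only the values pos 0, ..., pos ncracks.+1 and flex 1, ..., flex ncracks are
   relevant; the i-th interval is (pos i, pos i.+1), 0 <= i <= ncracks. *)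
Record cracked_beam (R : realType) := CrackedBeam {
  ncracks : nat ;
  pos : nat -> R ;
  flex : nat -> R ;
  pos0 : pos 0%N = 0 ;
  pos_end : pos ncracks.+1 = pi ;
  pos_incr : forall i, (i <= ncracks)%N -> pos i < pos i.+1 ;
  flex_gt0 : forall i, (1 <= i <= ncracks)%N -> 0 < flex i }.

Section Spaces.
Context {R : realType} (B : cracked_beam R).
Notation mu := (@lebesgue_measure R).
Notation m := (ncracks B).
Notation x := (pos B).
Notation theta := (flex B).
Implicit Types (u v w f g : fct R) (F G : functional R).

Definition inH (u : R -> R) : Prop := forall i, (i <= m)%N -> L2 (x i) (x i.+1) u.

Definition ipH (u v : R -> R) : R :=
  \sum_(0 <= i < m.+1) \int[mu]_(s in `]x i, x i.+1[) (u s * v s).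

Definition normH (u : R -> R) : R := Num.sqrt (ipH u u).

(* Broken weak derivative: g is square integrable and is the weak derivative of
   u on each interval separately (not across the cracks). *)
Definition is_wD u g : Prop :=
  inH g /\ forall i, (i <= m)%N -> weak_deriv (x i) (x i.+1) u g.

(* A representative of the broken weak derivative, meaningful when there is
   one, which is what [inHk] guarantees. *)
Definition wD u : fct R := xget (0 : fct R) [set g | is_wD u g].
Definition wDn k u : fct R := iter k wD u.

(* The direct sum of the H^k(l_i). *)
Definition inHk k u : Prop :=
  inH u /\ forall j, (j < k)%N -> is_wD (wDn j u) (wDn j.+1 u).

Definition inV u : Prop :=
  [/\ inHk 2 u, is_right_val u 0 0, is_left_val u pi 0 &
      forall i, (1 <= i <= m)%N -> is_jump u (x i) 0].

Definition ipV u v : R := ipH (wDn 2 u) (wDn 2 v) +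
  \sum_(1 <= i < m.+1) jump (wDn 1 u) (x i) * jump (wDn 1 v) (x i).

Definition normV u : R := Num.sqrt (ipV u u).

(* Elements of V' are functionals of which only the values on V matter; the
   pairing <F, v>_V is F v. *)
Definition inVd F : Prop :=
  (forall (a : R) u v, inV u -> inV v -> F (a *: u + v) = a * (F u : R) + F v :> R) /\
  (exists C : R, forall v, inV v -> `|F v : R| <= C * normV v).

Definition eqVd F G : Prop := forall v, inV v -> F v = G v.

Definition normVd F : R :=
  sup [set `|F v : R| | v in [set v | inV v /\ normV v <= 1]].

(* The embedding of H into V'. *)
Definition emb f : functional R := fun v => (ipH f v : R).

Definition opA u : functional R := fun v =>
  (ipH (wDn 2 u) (wDn 2 v) + \sum_(1 <= i < m.+1)
     (theta i)^-1 * (jump (wDn 1 u) (x i) * jump (wDn 1 v) (x i)) : R).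

(* f in H represents A u. *)
Definition represents_opA f u : Prop := inH f /\ eqVd (opA u) (emb f).

Definition inDA u : Prop := inV u /\ exists f, represents_opA f u.

Definition convexV (phi : fct R -> R) : Prop :=
  forall u w (a : R), inV u -> inV w -> 0 <= a <= 1 ->
    phi (a *: u + (1 - a) *: w) <= a * phi u + (1 - a) * phi w.

Definition lscV (phi : fct R -> R) : Prop :=
  forall u (e : R), inV u -> 0 < e -> exists2 d : R, 0 < d &
    forall w, inV w -> normV (w - u) < d -> phi u - e < phi w.

Definition subdiff (phi : fct R -> R) u : set (functional R) :=
  [set F | inVd F /\ forall w, inV w -> phi u + (F (w - u) : R) <= phi w].

Definition Ub u : R := 2^-1 * (normH (wDn 2 u) ^+ 2 +
  \sum_(1 <= i < m.+1) (theta i)^-1 * `|jump (wDn 1 u) (x i)| ^+ 2).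

End Spaces.

(* L^2(0, T; X) for the (semi)normed space X = {e | P e} with norm N. *)
Section Bochner.
Context {R : realType} (E : lmodType R) (P : set E) (N : E -> R).
Notation mu := (@lebesgue_measure R).

Definition simple_path (s : R -> E) : Prop :=
  exists n (A : 'I_n -> set R) (c : 'I_n -> E),
    [/\ forall k, measurable (A k), forall k, P (c k) &
        forall t, s t = \sum_(k < n) (\1_(A k) t : R) *: c k].

(* A pointwise limit of simple paths; as measurability on R is Borel
   measurability in the library, this is asked at every t of (0, T), which
   every a.e. class satisfies for a suitable representative. *)
Definition strongly_measurable (T : R) (f : R -> E) : Prop :=
  exists2 s : nat -> R -> E, forall n, simple_path (s n) &
    forall t, 0 < t < T -> P (f t) /\ N (f t - s n t) @[n --> \oo] --> (0 : R).

Definition L2path (T : R) (f : R -> E) : Prop :=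
  strongly_measurable T f /\ L2 0 T (fun t => N (f t)).

End Bochner.

Section Motion.
Context {R : realType} (B : cracked_beam R).
Notation mu := (@lebesgue_measure R).
Implicit Types (t T cd : R) (y dy p : R -> fct R)
               (ddy : R -> functional R) (v : fct R) (zeta : R -> R).

(* Distributional time derivative on (0, T): g = f' means
   int f phi' dt = - int g phi dt for every test function phi, the (vector
   valued) integrals being determined by their pairings with S. *)
Definition time_deriv (S : set (fct R)) T (f g : R -> functional R) : Prop :=
  forall phi : R -> R, test_fun 0 T phi -> forall v, S v ->
    \int[mu]_(t in `]0, T[) ((f t v : R) * derive1 phi t)
    = - \int[mu]_(t in `]0, T[) ((g t v : R) * phi t).

(* y belongs to W, with first and second time derivatives dy and ddy. *)
Definition inW T y dy ddy : Prop :=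
  [/\ L2path (inV B) (normV B) T y,
      L2path (inH B) (normH B) T dy,
      L2path (inVd B) (normVd B) T ddy,
      time_deriv (inH B) T (fun t => emb B (y t)) (fun t => emb B (dy t)) &
      time_deriv (inV B) T (fun t => emb B (dy t)) ddy].

Definition kinetic dy t : R := 2^-1 * normH B (dy t) ^+ 2.
Definition work_ext p y t : R := ipH B (p t) (y t).

(* The action without the damping work, whose contribution to the gradient is
   not a directional derivative. *)
Definition action_cons t1 t2 p y dy : R :=
  \int[mu]_(t in `]t1, t2[) (kinetic dy t - Ub B (y t) + work_ext p y t).

Definition damping_variation t1 t2 cd dy zeta v : R :=
  - cd * \int[mu]_(t in `]t1, t2[) (ipH B (dy t) v * zeta t).

(* d is the value of the gradient of the action at y (with velocity dy) on the
   variation eta(t) = zeta(t) v, whose velocity is zeta'(t) v. *)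
Definition is_grad_action t1 t2 cd p y dy zeta v (d : R) : Prop :=
  let eta := fun t => (zeta t *: v : fct R) in
  let deta := fun t => (derive1 zeta t *: v : fct R) in
  exists2 c : R,
    (action_cons t1 t2 p (fun t => y t + alpha *: eta t)
                         (fun t => dy t + alpha *: deta t)
     - action_cons t1 t2 p y dy) / alpha @[alpha --> 0^'+] --> c &
    d = c + damping_variation t1 t2 cd dy zeta v.

Definition stationary t1 t2 cd p y dy : Prop :=
  forall zeta v, smooth zeta -> zeta t1 = 0 -> zeta t2 = 0 -> inV B v ->
    is_grad_action t1 t2 cd p y dy zeta v 0.

(* The equation of motion in V' at time t. *)
Definition motion_eq cd p y dy ddy t : Prop :=
  eqVd B (ddy t + opA B (y t) + cd *: emb B (dy t)) (emb B (p t)).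

(* The equation y_tt + y'''' + c_d y_t = p between functions at time t; the
   second time derivative, a priori in V', is asked to be in H. *)
Definition beam_eq cd p y dy ddy t : Prop :=
  exists a : fct R, [/\ inH B a, eqVd B (ddy t) (emb B a) &
    forall i, (i <= ncracks B)%N -> \forall s \ae mu,
      s \in `]pos B i, pos B i.+1[ ->
      (a s : R) + wDn B 4 (y t) s + cd * (dy t s : R) = p t s :> R].

End Motion.

(* Main.v *)
Require Import Defs.
From HB Require Import structures.
From mathcomp Require Import all_boot all_order all_algebra.
From mathcomp Require Import all_classical all_reals all_analysis.
From mathcomp Require Import measurable_realfun.
From mathcomp Require Import ring lra.
Import Order.TTheory GRing.Theory Num.Theory.
Import numFieldNormedType.Exports.

Set Implicit Arguments.
Unset Strict Implicit.
Unset Printing Implicit Defensive.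

Local Open Scope classical_set_scope.
Local Open Scope ring_scope.

(** Part (a) is quadratic algebra. The inner product of V and the operator A are two
    bending forms [bend k], which differ by the stiffnesses k of the cracks and bound each
    other, and Ub is half of the square of the second one. For a semi-inner product b the
    expansion [quad_expand] of b (w, w) / 2 around u yields convexity, lower semicontinuity
    and, with [quad_subgradient], the subdifferential. This requires that weak derivatives
    and jumps, which are defined by choice, be linear up to null sets. They are because of
    the fundamental lemma of the calculus of variations ([fundamental_lemma]), and of the
    lemma of du Bois-Reymond ([weak_deriv_AC]): a function with an integrable weak
    derivative is a primitive of it, and has one-sided values. The test functions come
    from e^(-1/x), and integration by parts of primitives is Fubini on a triangle.

    For part (b), the action along y + alpha zeta v is a polynomial in alpha, whose
    derivative at 0 is read off in [action_derivative]. The pairings in it are integrable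
    in time because the paths are strongly measurable and square integrable, and because
    the norm of V dominates that of H ([poincare]). If zeta is a test function of
    ]t1, t2[, stationarity says that the functional ddy + A y + cd dy - p vanishes at v for
    almost every t, for each v in V. The exceptional null set is made independent of v in
    [weakly_null_path]: the four paths have separable ranges, so that countably many v
    are enough.

    For part (c), A u = f is tested with functions that are smooth on each interval, which
    splits it into functionals of one interval each ([residual]), with sum zero. Test
    functions of a single interval show that f is the second weak derivative of u'' there,
    so that u'' is in H^2 of each interval ([strong_derivatives]). Then integration by
    parts turns the functionals into boundary terms. Cubic polynomials that vanish at the
    two ends of an interval give the value of u'' at each end ([moment_traces]), and hat
    functions around a crack give the continuity of u''' ([shear_continuous]). *)

(** * Smooth functions and the flat function *)

Section Smooth.
Context {R : realType}.
Implicit Types (u v f g : R -> R) (x a b c d : R).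

(** Differentiability up to order n, by which smoothness of products is proved by
    induction on n rather than with the Leibniz formula. *)
Definition ndiff n u : Prop := forall k x, (k < n)%N -> derivable (derive1n k u) x 1.

Lemma ndiffS n u :
  ndiff n.+1 u <-> (forall x, derivable u x 1) /\ ndiff n (derive1 u).
Proof.
split=> [h|[h0 h] [|k] x kn //].
- split=> [x|k x kn]; first exact: (h 0%N).
  by have := h k.+1 x kn; rewrite derive1Sn.
- by rewrite derive1Sn; exact: h.
Qed.

Lemma smooth_ndiff u : smooth u <-> forall n, ndiff n u.
Proof. by split=> [h n k x _|h n x]; [exact: h|exact: (h n.+1)]. Qed.

Lemma ndiffW n u : ndiff n.+1 u -> ndiff n u.
Proof. by move=> h k x kn; apply: h; exact: ltnW. Qed.

Lemma ndiffD n u v : ndiff n u -> ndiff n v -> ndiff n (u \+ v).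
Proof.
elim: n u v => [|n ih] u v; first by move=> _ _ k.
move=> /ndiffS[du hu] /ndiffS[dv hv]; apply/ndiffS; split.
  by move=> x; apply: derivableD.
rewrite (_ : derive1 (u \+ v) = derive1 u \+ derive1 v); first exact: ih.
by apply/funext => x; rewrite !derive1E deriveD// -?derive1E.
Qed.

Lemma ndiffM n u v : ndiff n u -> ndiff n v -> ndiff n (u \* v).
Proof.
elim: n u v => [|n ih] u v; first by move=> _ _ k.
move=> hu hv; have := hu; have := hv.
move=> /ndiffS[dv hv'] /ndiffS[du hu']; apply/ndiffS; split.
  by move=> x; apply: derivableM.
have -> : derive1 (u \* v) = (fun x => u x * derive1 v x + v x * derive1 u x) :> (R -> R).
  by apply/funext => x; rewrite !derive1E deriveM// -!derive1E.
exact: ndiffD (ih _ _ (ndiffW hu) hv') (ih _ _ (ndiffW hv) hu').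
Qed.

Lemma ndiff_affine n u a b : ndiff n u -> ndiff n (fun x => u (a * x + b)).
Proof.
elim: n u a b => [|n ih] u a b; first by move=> _ k.
move=> /ndiffS[du hu'].
have da x : is_derive x 1 (fun x => a * x + b) a.
  have h := @is_deriveD R R^o R^o (a *: id) (cst b) x 1 _ _
    (@is_deriveZ R R^o R^o id a x 1 _ (is_derive_id x 1)) (is_derive_cst b x 1).
  by move: h; rewrite addr0 /GRing.scale/= mulr1.
have dua x : is_derive x 1 (fun x => u (a * x + b)) (a * derive1 u (a * x + b)).
  have := du (a * x + b) => /derivableP; rewrite -derive1E => d1.
  rewrite mulrC; exact: (@is_derive1_comp _ u (fun x => a * x + b) x _ _ d1 (da x)).
apply/ndiffS; split; first by move=> x; exact: ex_derive.
rewrite (_ : derive1 _ = cst a \* (fun x => derive1 u (a * x + b))).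
  apply: ndiffM; last exact: ih.
  move=> k x _; elim: k a x {ih da dua hu' du} => [|k ihk] a x.
    exact: derivable_cst.
  rewrite derive1Sn (_ : derive1 _ = cst 0); first exact: ihk.
  by apply/funext => z; rewrite derive1_cst.
by apply/funext => x; rewrite derive1E; exact: derive_val.
Qed.

Lemma smoothM u v : smooth u -> smooth v -> smooth (u \* v).
Proof. by move=> /smooth_ndiff hu /smooth_ndiff hv; apply/smooth_ndiff => n; exact: ndiffM. Qed.

Lemma smoothD u v : smooth u -> smooth v -> smooth (u \+ v).
Proof. by move=> /smooth_ndiff hu /smooth_ndiff hv; apply/smooth_ndiff => n; exact: ndiffD. Qed.

Lemma smooth_affine u a b : smooth u -> smooth (fun x => u (a * x + b)).
Proof. by move=> /smooth_ndiff hu; apply/smooth_ndiff => n; exact: ndiff_affine. Qed.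

Lemma smooth_cst a : smooth (cst a : R -> R).
Proof.
move=> k; elim: k a => [|k ihk] a x; first exact: derivable_cst.
rewrite derive1Sn (_ : derive1 _ = cst 0); first exact: ihk.
by apply/funext => z; rewrite derive1_cst.
Qed.

Lemma smooth_id : smooth (id : R -> R).
Proof.
case=> [|n] x; first exact: derivable_id.
rewrite derive1Sn (_ : derive1 (id : R -> R) = cst (1 : R)); first exact: smooth_cst.
by apply/funext => z; rewrite derive1E derive_id.
Qed.

Lemma smooth_derive u : smooth u -> smooth (derive1 u).
Proof. by move=> h n x; have := h n.+1 x; rewrite derive1Sn. Qed.

Lemma smooth_derivable u x : smooth u -> derivable u x 1.
Proof. by move=> h; exact: (h 0%N). Qed.

Lemma smooth_prim u f : (forall x, is_derive x 1 u (f x)) -> smooth f -> smooth u.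
Proof.
move=> du hf [|n] x; first exact: ex_derive.
rewrite derive1Sn (_ : derive1 u = f); first exact: hf.
by apply/funext => z; rewrite derive1E derive_val.
Qed.

(** Smoothness by coinduction: it is enough to find a set of differentiable functions
    that contains u and is stable under differentiation. *)
Lemma smooth_closed (S : set (R -> R)) :
  (forall u, S u -> (forall x, derivable u x 1) /\ S (derive1 u)) ->
  forall u, S u -> smooth u.
Proof.
move=> hS u Su n; elim: n u Su => [|n ih] u Su x.
  by have [] := hS u Su.
by rewrite derive1Sn; apply: ih; have [] := hS u Su.
Qed.

Lemma smooth_continuous u : smooth u -> continuous u.
Proof.
move=> h x; apply: differentiable_continuous; apply/derivable1_diffP.
exact: (h 0%N).
Qed.

(** The function x |-> p(1/x) e^(-1/x) for x > 0, extended by 0. Every derivative of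
    e^(-1/x) has this form, which is why p is a parameter. *)
Definition flat (p : {poly R}) x : R := if x <= 0 then 0 else p.[x^-1] * expR (- x^-1).

(** By linearity p is a monomial, and x^(n+1) <= (n+1)! e^x bounds x^n e^(-x) by a
    multiple of 1/x. *)
Lemma horner_expRN_cvg0 (p : {poly R}) : p.[x] * expR (- x) @[x --> +oo%R] --> 0.
Proof.
have X n : x ^+ n * expR (- x) @[x --> +oo%R] --> (0:R).
  apply: (@squeeze_cvgr _ _ _ _ (fun=> 0) (fun x => n.+1`!%:R * x^-1)); last 2 first.
  - exact: cvg_cst.
  - rewrite -(mulr0 (n.+1`!%:R)); apply: cvgMl_tmp.
    apply/gtr0_cvgV0.
      by near=> x; near: x; exact: nbhs_pinfty_gt.
    exact: cvg_id.
  near=> x.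
  have x0 : 0 < x by near: x; exact: nbhs_pinfty_gt.
  apply/andP; split; first by rewrite mulr_ge0// ?exprn_ge0 ?expR_ge0// ltW.
  rewrite expRN ler_pdivrMr ?expR_gt0//.
  have h : x ^+ n.+1 <= n.+1`!%:R * expR x.
    rewrite mulrC -ler_pdivrMr ?ltr0n ?fact_gt0//.
    have := @expR_ge1Dxn R x n (ltW x0); lra.
  by rewrite mulrAC ler_pdivlMr// -exprSr.
have -> : (fun x => p.[x] * expR (- x)) =
    (fun x => \sum_(i < size p) p`_i * (x ^+ i * expR (- x))).
  apply/funext => x; rewrite horner_coef mulr_suml.
  by apply: eq_bigr => i _; rewrite mulrA.
have h : \sum_(i < size p) p`_i * (x ^+ i * expR (- x)) @[x --> +oo%R] -->
    \sum_(i < size p) p`_i * (0:R).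
  by apply: cvg_big => [|i _]; [exact: add_continuous|apply: cvgMl_tmp; exact: X].
by move: h; rewrite big1// => i _; rewrite mulr0.
Unshelve. all: by end_near. Qed.

Lemma flat_cvg0 p : flat p x @[x --> 0^'] --> (0:R).
Proof.
apply: (@cvg_at_right_left_dnbhs R R^o).
  have inv : x^-1 @[x --> (0:R)^'+] --> +oo%R.
    apply/gtr0_cvgV0; first by near=> x; rewrite invr_gt0; near: x; exact: nbhs_right_gt.
    rewrite (_ : unstable.inv_fun _ = id); last by apply/funext => y; rewrite /= invrK.
    exact: cvg_at_right_filter cvg_id.
  apply: cvg_trans (cvg_comp _ _ inv (@horner_expRN_cvg0 p)).
  apply: near_eq_cvg; near=> x.
  by rewrite /flat leNgt ifF//; apply/negbTE; rewrite negbK; near: x; exact: nbhs_right_gt.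
apply: (@cvg_trans _ (cst (0:R) @ 0^'-)); last exact: cvg_cst.
apply: near_eq_cvg; near=> x.
by rewrite /flat ifT//; near: x; exact: nbhs_left_le.
Unshelve. all: by end_near. Qed.

(** For x > 0 this is the chain rule; at 0 the difference quotient of [flat p] is
    [flat ('X * p)], which tends to 0. *)
Lemma is_derive_flat p x : is_derive x 1 (flat p) (flat ('X^2 * (p - p^`())) x).
Proof.
have [x0|x0|->] := ltgtP x 0.
- apply: (@near_eq_is_derive _ _ _ (cst 0)).
    near=> y; rewrite /flat ifT// ltW//; near: y; exact: lt_nbhsl.
  by rewrite /flat ltW//; exact: is_derive_cst.
- apply: (@near_eq_is_derive _ _ _ (fun x => p.[x^-1] * expR (- x^-1))).
    near=> y; rewrite /flat ifF//; apply/negbTE; rewrite -ltNge.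
    by near: y; exact: lt_nbhsr.
  have dV : is_derive x 1 (fun x : R => x^-1) (- x^-2).
    apply: DeriveDef; first by apply: derivableV; rewrite ?gt_eqF.
    by rewrite deriveV ?gt_eqF// derive_id /GRing.scale/= mulr1.
  have dp := @is_derive1_comp _ (horner p) (fun x => x^-1) x _ _ (is_derive_poly p x^-1) dV.
  have dN := @is_deriveN R R^o R^o (fun x => x^-1) x 1 _ dV.
  have de := @is_derive1_comp _ (@expR R) (fun x => - x^-1) x _ _ (is_derive_expR _) dN.
  apply: is_derive_eq (is_deriveM dp de) _.
  rewrite /flat leNgt x0/= !hornerE /GRing.scale/= -!exprVn; ring.
- have -> : flat ('X^2 * (p - p^`())) 0 = 0 by rewrite /flat lexx.
  suff h : h^-1 *: ((flat p \o shift 0) (h *: 1) - flat p 0) @[h --> (0:R)^'] --> (0:R^o).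
    by apply: DeriveDef; [apply/cvg_ex; exists 0|exact: cvg_lim h].
  apply: cvg_trans (flat_cvg0 ('X * p)).
  apply: near_eq_cvg; near=> y.
  rewrite /flat/= lexx subr0 addr0 /GRing.scale/= mulr1.
  case: ifPn => _; first by rewrite mulr0.
  by rewrite hornerM hornerX -mulrA.
Unshelve. all: by end_near. Qed.

Lemma smooth_flat p : smooth (flat p).
Proof.
apply: (@smooth_closed (range flat)); last by exists p.
move=> _ [q _ <-]; split=> [x|].
  by have [] := is_derive_flat q x.
exists ('X^2 * (q - q^`())) => //.
by apply/funext => x; rewrite derive1E; have [_ ->] := is_derive_flat q x.
Qed.

End Smooth.

(** * Integrable and square integrable functions on an interval *)

Section L2Spaces.
Context {R : realType}.
Notation mu := (@lebesgue_measure R).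
Implicit Types (u v w f g h : R -> R) (x a b c d r s t : R).

#[global] Instance ae_mu_filter : Filter (nbhs (almost_everywhere mu)).
Proof. exact: (ae_filter_ringOfSetsType mu). Qed.

Definition int_on a b f := mu.-integrable `]a, b[ (EFin \o f).

Lemma int_onS a b c d f : a <= c -> d <= b -> int_on a b f -> int_on c d f.
Proof.
move=> ac db; apply: integrableS => // s /=; rewrite !in_itv/= => /andP[cs sd].
by rewrite (le_lt_trans ac cs) (lt_le_trans sd db).
Qed.

Lemma int_on_mfun a b f : int_on a b f -> measurable_fun `]a, b[ f.
Proof. by move=> /measurable_int/measurable_EFinP. Qed.

Lemma int_onD a b f g : int_on a b f -> int_on a b g -> int_on a b (fun s => f s + g s).
Proof.
move=> hf hg; have := @integrableD _ _ _ mu `]a, b[ (measurable_itv _) _ _ hf hg.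
by apply: eq_integrable => // s _; rewrite /= EFinD.
Qed.

Lemma int_onZ a b c f : int_on a b f -> int_on a b (fun s => c * f s).
Proof.
move=> hf; have := @integrableZl _ _ _ mu `]a, b[ (measurable_itv _) c _ hf.
by apply: eq_integrable => // s _; rewrite /= EFinM.
Qed.

Lemma int_onN a b f : int_on a b f -> int_on a b (fun s => - f s).
Proof. by move=> /(int_onZ (-1)); under eq_fun do rewrite mulN1r. Qed.

Lemma int_onB a b f g : int_on a b f -> int_on a b g -> int_on a b (fun s => f s - g s).
Proof. by move=> hf /int_onN; exact: int_onD. Qed.

Lemma le_int_on a b f g : measurable_fun `]a, b[ f ->
  (forall s, a < s < b -> `|f s| <= g s) -> int_on a b g -> int_on a b f.
Proof.
move=> mf fg; apply: le_integrable => //; first exact/measurable_EFinP.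
move=> s /=; rewrite in_itv/= => sab; rewrite lee_fin (le_trans (fg s sab))//.
exact: ler_norm.
Qed.

Lemma int_on_bounded a b f c : measurable_fun `]a, b[ f ->
  (forall s, a < s < b -> `|f s| <= c) -> int_on a b f.
Proof.
move=> mf fc; have [ab|ba] := ltP a b; last first.
  by rewrite /int_on set_itv_ge -?leNgt ?bnd_simp//; exact: integrable_set0.
apply: measurable_bounded_integrable => //.
  by rewrite /= lebesgue_measure_itv/= lte_fin ab ltry.
exists c; split; first exact: num_real.
move=> y cy s /=; rewrite in_itv/= => /fc fs; exact: le_trans fs (ltW cy).
Qed.

Lemma int_on_cst a b c : int_on a b (fun=> c).
Proof. by apply: (@int_on_bounded _ _ _ `|c|) => //; exact: measurable_cst. Qed.

Lemma int_on_restrict a b f : int_on a b f ->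
  mu.-integrable setT (EFin \o (f \_ `]a, b[)).
Proof. by move=> /integrable_mkcond -/(_ (measurable_itv _)); rewrite restrict_EFin. Qed.

Lemma mfun_restrict a b f : measurable_fun setT (f \_ `]a, b[) <->
  measurable_fun `]a, b[ f.
Proof.
by rewrite -(measurable_restrict f (measurable_itv _) measurableT) setTI.
Qed.

(** Square integrability in terms of the integral alone: the algebra of [L2] becomes that
    of integrable functions. *)
Lemma L2P a b u :
  L2 a b u <-> measurable_fun `]a, b[ u /\ int_on a b (fun s => u s ^+ 2).
Proof.
have E : (fun x => (u \_ `]a, b[) x ^+ 2) = (fun s => u s ^+ 2) \_ `]a, b[.
  by apply/funext => s; rewrite !patchE; case: ifP => // _; rewrite expr0n.
split=> [h|[mu' iu]].
- have := Lfun2_integrable_sqr h; move: h.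
  rewrite /L2 inE => /andP[]; rewrite inE/= => mu' _ h; split.
    exact/mfun_restrict.
  by apply/integrable_mkcond => //; rewrite restrict_EFin -E.
- rewrite /L2 inE; apply/andP; split; rewrite inE/=; first exact/mfun_restrict.
  rewrite /finite_norm.
  rewrite unlock /Lnorm; apply: poweR_lty.
  move/integrable_mkcond : iu => /(_ (measurable_itv _)) /integrableP[_].
  rewrite restrict_EFin -E; apply: le_lt_trans.
  rewrite le_eqVlt; apply/orP; left; apply/eqP; apply: eq_integral => s _.
  by rewrite /= normrX powR_mulrn.
Qed.

Lemma L2_mfun a b u : L2 a b u -> measurable_fun `]a, b[ u.
Proof. by move=> /L2P[]. Qed.

Lemma L2_sqr a b u : L2 a b u -> int_on a b (fun s => u s ^+ 2).
Proof. by move=> /L2P[]. Qed.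

Lemma L2M a b u v : L2 a b u -> L2 a b v -> int_on a b (fun s => u s * v s).
Proof.
move=> /L2P[mu' iu] /L2P[mv iv]; apply: (le_int_on _ _ (int_onD iu iv)).
  exact: measurable_funM.
move=> s _; rewrite normrM -(normr_id (u s)) -(normr_id (v s)).
rewrite -(real_normK (num_real (u s))) -(real_normK (num_real (v s))) !normr_id.
have := sqr_ge0 (`|u s| - `|v s|); have := normr_ge0 (u s); have := normr_ge0 (v s).
rewrite sqrrB => h1 h2 h3; have := mulr_ge0 h1 h2. nra.
Qed.

Lemma L2D a b u v : L2 a b u -> L2 a b v -> L2 a b (fun s => u s + v s).
Proof.
move=> hu hv; have /L2P[mu' iu] := hu; have /L2P[mv iv] := hv; apply/L2P; split.
  exact: measurable_funD.
have h := int_onD (int_onD iu iv) (int_onZ 2 (L2M hu hv)).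
by apply: eq_integrable h => // s _ /=; congr EFin; ring.
Qed.

Lemma L2Z a b c u : L2 a b u -> L2 a b (fun s => c * u s).
Proof.
move=> /L2P[mu' iu]; apply/L2P; split; first exact: measurable_funM.
by have := int_onZ (c ^+ 2) iu; apply: eq_integrable => // s _ /=; congr EFin; ring.
Qed.

Lemma L2_bounded a b u c : measurable_fun `]a, b[ u ->
  (forall s, a < s < b -> `|u s| <= c) -> L2 a b u.
Proof.
move=> mu' uc; apply/L2P; split => //.
apply: (@int_on_bounded _ _ _ (c ^+ 2)); first exact: measurable_funX.
by move=> s /uc uc'; rewrite normrX lerXn2r// nnegrE (le_trans _ uc').
Qed.

Lemma L2_cst a b c : L2 a b (fun=> c).
Proof. by apply: (@L2_bounded _ _ _ `|c|). Qed.

Lemma L2_int a b u : L2 a b u -> int_on a b u.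
Proof. by move=> /L2M /(_ (L2_cst a b 1)); under eq_fun do rewrite mulr1. Qed.

Lemma continuous_mfun (D : set R) u : continuous u -> measurable_fun D u.
Proof. by move=> cu; apply: measurable_funTS; exact: continuous_measurable_fun. Qed.

Lemma L2_continuous a b u : continuous u -> L2 a b u.
Proof.
move=> cu; have [ab|ba] := ltP a b; last first.
  apply: (@L2_bounded _ _ _ 0) => [|s]; last lra.
  by rewrite set_itv_ge -?leNgt ?bnd_simp//; exact: measurable_fun_set0.
have [m mP] : exists m : R, forall s, a <= s <= b -> `|u s| <= m.
  have cn : {within `[a, b], continuous (fun s => `|u s|)}.
    by apply: continuous_subspaceT => s; exact: (@cvg_norm _ R^o _ _ _ _ _ (cu s)).
  have [c _ hc] := EVT_max (ltW ab) cn; exists `|u c| => s sab; apply: hc.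
  by rewrite in_itv/=.
apply: (@L2_bounded _ _ _ m) => [|s /andP[s1 s2]]; last by apply: mP; rewrite !ltW.
exact: continuous_mfun.
Qed.

Lemma ae_mulr a b f g h : {ae mu, forall s, s \in `]a, b[ -> f s = g s} ->
  {ae mu, forall s, s \in `]a, b[ -> f s * h s = g s * h s}.
Proof. by apply: filterS => s /[apply] ->. Qed.

Lemma ae_Rintegral a b f g : measurable_fun `]a, b[ f -> measurable_fun `]a, b[ g ->
  {ae mu, forall s, s \in `]a, b[ -> f s = g s} ->
  \int[mu]_(s in `]a, b[) f s = \int[mu]_(s in `]a, b[) g s.
Proof.
move=> mf mg fg; congr fine; apply: ae_eq_integral => //; try exact/measurable_EFinP.
by apply: filterS fg => s fg sab; rewrite fg.
Qed.

End L2Spaces.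

(** * Test functions and the fundamental lemma of the calculus of variations *)

Section FundamentalLemma.
Context {R : realType}.
Notation mu := (@lebesgue_measure R).
Implicit Types (u v w f g h : R -> R) (x a b c d r s t : R).

Definition step : R -> R := flat 1.

Lemma step_le0 x : x <= 0 -> step x = 0.
Proof. by rewrite /step /flat => ->. Qed.

Lemma step_gt0 x : 0 < x -> step x = expR (- x^-1).
Proof. by rewrite /step /flat leNgt => ->; rewrite hornerC mul1r. Qed.

Lemma step_bound x : 0 <= step x <= 1.
Proof.
have [x0|x0] := leP x 0; first by rewrite step_le0// lexx ler01.
by rewrite step_gt0// expR_ge0 expR_le1 oppr_le0 invr_ge0 ltW.
Qed.

Lemma smooth_step : smooth step.
Proof. exact: smooth_flat. Qed.

Lemma step_cvg x : step (n.+1%:R * x) @[n --> \oo] --> ((0 < x)%R%:R : R).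
Proof.
have [x0|x0] := leP x 0.
  rewrite (_ : (fun _ => _) = cst 0); first exact: cvg_cst.
  by apply/funext => n; rewrite step_le0// mulr_ge0_le0.
have -> : (fun n => step (n.+1%:R * x)) = (fun n => expR (- (n.+1%:R^-1 * x^-1))).
  by apply/funext => n; rewrite step_gt0 ?mulr_gt0// invfM.
rewrite (_ : true%:R = expR (- (0 * x^-1))); last by rewrite mul0r oppr0 expR0.
apply: (@continuous_cvg _ _ _ _ _ _ (@expR R)); first exact: continuous_expR.
by apply: cvgN; apply: cvgMr_tmp; exact: cvg_harmonic.
Qed.

(** A product of two copies of e^(-1/x), one from each end, dilated by n + 1. As e^(-1/x)
    tends to 1 at infinity, dilation alone makes these bumps tend to the indicator function
    of ]c, d[. *)
Definition bump c d (n : nat) s : R :=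
  step (n.+1%:R * (s - c)) * step (n.+1%:R * (d - s)).

Lemma smooth_bump c d n : smooth (bump c d n).
Proof.
rewrite (_ : bump c d n = (fun s => step (n.+1%:R * s + (- n.+1%:R * c))) \*
  (fun s => step ((- n.+1%:R) * s + n.+1%:R * d))).
  by apply: smoothM; apply: smooth_affine; exact: smooth_step.
by apply/funext => s; rewrite /bump/=; congr (step _ * step _); ring.
Qed.

Lemma bump_bound c d n s : 0 <= bump c d n s <= 1.
Proof.
have /andP[h1 h2] := step_bound (n.+1%:R * (s - c)).
have /andP[h3 h4] := step_bound (n.+1%:R * (d - s)).
by rewrite /bump mulr_ge0//= mulr_ile1.
Qed.

Lemma bump_out c d n s : ~~ (c <= s <= d) -> bump c d n s = 0.
Proof.
rewrite negb_and -!ltNge => /orP[sc|ds].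
  by rewrite /bump step_le0 ?mul0r// mulr_ge0_le0// subr_le0 ltW.
by rewrite /bump [X in _ * X]step_le0 ?mulr0// mulr_ge0_le0// subr_le0 ltW.
Qed.

Lemma test_bump a b c d n : a < c -> d < b -> test_fun a b (bump c d n).
Proof.
move=> ac db; split; first exact: smooth_bump.
by exists c, d; split => // s; exact: bump_out.
Qed.

Lemma bump_cvg c d s : bump c d n s @[n --> \oo] --> (\1_`]c, d[ s : R).
Proof.
have -> : \1_`]c, d[ s = (0 < s - c)%R%:R * (0 < d - s)%R%:R :> R.
  rewrite indicE !subr_gt0 -natrM mulnb; congr ((_ : bool)%:R).
  by apply/idP/idP; rewrite inE/= in_itv.
by apply: cvgM; exact: step_cvg.
Qed.

Lemma int_on_test a b h u : int_on a b h -> continuous u ->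
  int_on a b (fun s => h s * u s).
Proof.
move=> ih cu; have [ab|ba] := ltP a b; last first.
  by rewrite /int_on set_itv_ge -?leNgt ?bnd_simp//; exact: integrable_set0.
have [m mP] : exists m : R, forall s, a <= s <= b -> `|u s| <= m.
  have cn : {within `[a, b], continuous (fun s => `|u s|)}.
    by apply: continuous_subspaceT => s; exact: (@cvg_norm _ R^o _ _ _ _ _ (cu s)).
  have [c _ hc] := EVT_max (ltW ab) cn; exists `|u c| => s sab; apply: hc.
  by rewrite in_itv/=.
have hn : int_on a b (fun s => `|h s|) by exact: integrable_norm.
apply: (le_int_on _ _ (int_onZ m hn)).
  apply: measurable_funM; first exact: int_on_mfun.
  exact: continuous_mfun.
move=> s /andP[s1 s2]; rewrite normrM mulrC ler_wpM2r//.
by apply: mP; rewrite !ltW.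
Qed.

(** Dominated convergence along [bump c d n]. *)
Lemma int_test0_itv a b h c d : int_on a b h ->
  (forall phi, test_fun a b phi -> \int[mu]_(s in `]a, b[) (h s * phi s) = 0) ->
  a < c -> d < b -> \int[mu]_(s in `]c, d[) h s = 0.
Proof.
move=> ih h0 ac db.
have sub : `]c, d[ `<=` (`]a, b[ : set R).
  by move=> s /=; rewrite !in_itv/= => /andP[? ?]; apply/andP; split; lra.
have -> : \int[mu]_(s in `]c, d[) h s = \int[mu]_(s in `]a, b[) (h s * \1_`]c, d[ s).
  rewrite -[in LHS](setIidr sub) Rintegral_mkcondr; apply: eq_Rintegral => s _.
  by rewrite patchE indicE; case: ifP; rewrite ?mulr1 ?mulr0.
have mh := int_on_mfun ih.
have mb n : measurable_fun `]a, b[ (bump c d n).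
  have cb := smooth_continuous (@smooth_bump c d n). exact: (@continuous_mfun R `]a, b[ _ cb).
have [] := @dominated_convergence _ _ R mu `]a, b[ (measurable_itv _)
  (fun n s => (h s * bump c d n s)%:E) (fun s => (h s * \1_`]c, d[ s)%:E)
  (fun s => `|h s|%:E).
- move=> n; apply/measurable_EFinP; apply: measurable_funM => //.
  exact: mb.
- apply/measurable_EFinP; apply: measurable_funM => //.
- apply: aeW => s _; apply: cvg_EFin; first by near=> n.
  by apply: cvgMl_tmp; exact: bump_cvg.
- exact: integrable_norm.
- apply: aeW => s n _; have /andP[b0 b1] := bump_bound c d n s.
  by rewrite lee_fin normrM (ger0_norm b0) ler_piMr.
move=> hi _ /= hc.
have E n : (\int[mu]_(x in `]a, b[) (h x * bump c d n x)%:E = 0)%E.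
  rewrite -[LHS]fineK.
    by have := h0 _ (test_bump n ac db); rewrite /Rintegral => ->.
  apply: integrable_fin_num => //; apply: int_on_test => //.
  exact: smooth_continuous (@smooth_bump c d n).
have hc0 : (\int[mu]_(x in `]a, b[) (h x * bump c d n x)%:E)%E @[n --> \oo] --> 0%E.
  by under eq_fun do rewrite E; exact: cvg_cst.
by rewrite /Rintegral (cvg_unique _ hc hc0).
Unshelve. all: by end_near. Qed.

(** The indefinite integral of h is locally constant on ]a, b[, while by the Lebesgue
    differentiation theorem its derivative is h almost everywhere. *)
Lemma int_itv0_ae0 a b h : int_on a b h ->
  (forall c d, a < c -> c < d -> d < b -> \int[mu]_(s in `]c, d[) h s = 0) ->
  {ae mu, forall s, s \in `]a, b[ -> h s = 0}.
Proof.
move=> ih h0; pose hr := h \_ `]a, b[.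
have ihr : mu.-integrable setT (EFin \o hr).
  by move/integrable_mkcond : ih => /(_ (measurable_itv _)); rewrite restrict_EFin.
have ihry y : mu.-integrable `]-oo, y] (EFin \o hr) by exact: integrableS ihr.
have lhr : locally_integrable setT hr by apply: open_integrable_locally => //; exact: openT.
pose F x := \int[mu]_(t in [set` `]-oo, x]]) hr t.
have Fcst x y : a < x -> x <= y -> y < b -> F x = F y.
  move=> ax + yb; rewrite le_eqVlt => /predU1P[->//|xy].
  apply/esym/eqP; rewrite -subr_eq0 /F Rintegral_itvB//; last by rewrite bnd_simp ltW.
  rewrite -Rintegral_itv_bndo_bndc; last by apply: integrableS ihr.
  rewrite -(h0 x y)//; apply/eqP/eq_Rintegral => s; rewrite inE/= in_itv/= => /andP[xs sy].
  by rewrite /hr patchE mem_set//= in_itv/= (lt_trans ax xs) (lt_trans sy yb).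
have := FTC1Ny ihry lhr; apply: filterS => x /= [_ Fx]; rewrite in_itv/= => /andP[ax xb].
have -> : h x = hr x by rewrite /hr patchE mem_set//= in_itv/= ax xb.
rewrite -Fx derive1E (@near_eq_derive _ _ _ _ (cst (F x))) ?derive_cst//.
near=> y; have ay : a < y by near: y; exact: lt_nbhsr.
have yb : y < b by near: y; exact: lt_nbhsl.
rewrite -[LHS]/(F y)/=.
by have [/ltW xy|/ltW yx|->//] := ltgtP x y; [rewrite (Fcst x y)|rewrite (Fcst y x)].
Unshelve. all: by end_near. Qed.

Lemma fundamental_lemma a b h : int_on a b h ->
  (forall phi, test_fun a b phi -> \int[mu]_(s in `]a, b[) (h s * phi s) = 0) ->
  {ae mu, forall s, s \in `]a, b[ -> h s = 0}.
Proof. by move=> ih h0; apply: int_itv0_ae0 => // c d ac _ db; exact: (int_test0_itv ih h0 ac db). Qed.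

Lemma test_smooth a b u : test_fun a b u -> smooth u. Proof. by case. Qed.

Lemma test_continuous a b u : test_fun a b u -> continuous u.
Proof. by move=> /test_smooth/smooth_continuous. Qed.

Lemma test_out a b u s : test_fun a b u -> ~~ (a < s < b) -> u s = 0.
Proof.
move=> [_ [c [d [ac db u0]]]] sab; apply: u0; apply: contra sab => /andP[cs sd].
by rewrite (lt_le_trans ac cs) (le_lt_trans sd db).
Qed.

Lemma test_derive a b u : test_fun a b u -> test_fun a b (derive1 u).
Proof.
move=> [su [c [d [ac db u0]]]]; split; first exact: smooth_derive.
exists c, d; split => // s scd; rewrite derive1E (@near_eq_derive _ _ _ _ (cst 0)) ?derive_cst//.
move: scd; rewrite negb_and -!ltNge => /orP[sc|ds].
  by near=> y; apply: u0; rewrite negb_and -!ltNge; apply/orP; left; near: y; exact: lt_nbhsl.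
by near=> y; apply: u0; rewrite negb_and -!ltNge; apply/orP; right; near: y; exact: lt_nbhsr.
Unshelve. all: by end_near. Qed.

Lemma test_lin a b c u v : test_fun a b u -> test_fun a b v -> test_fun a b (fun s => u s + c * v s).
Proof.
move=> [su [c1 [d1 [ac1 db1 u0]]]] [sv [c2 [d2 [ac2 db2 v0]]]]; split.
  exact: (@smoothD _ u (cst c \* v) su (@smoothM _ (cst c) v (@smooth_cst _ c) sv)).
exists (Num.min c1 c2), (Num.max d1 d2); split => [||s].
- by rewrite lt_min ac1.
- by rewrite gt_max db1.
rewrite negb_and -!ltNge => /orP[|]; rewrite ?lt_min ?gt_max => /andP[h1 h2];
 by rewrite u0 ?v0 ?mulr0 ?addr0// negb_and -!ltNge ?h1 ?h2 ?orbT.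
Qed.

Lemma smooth_FTC u a b : smooth u -> a <= b ->
  \int[mu]_(s in `]a, b[) derive1 u s = u b - u a.
Proof.
move=> su; rewrite le_eqVlt => /predU1P[->|ab].
  by rewrite set_itv_ge ?bnd_simp// Rintegral_set0 subrr.
rewrite Rintegral_itv_bndo_bndc; last first.
  apply: L2_int; apply: L2_continuous; exact: smooth_continuous (smooth_derive su).
rewrite Rintegral_itv_obnd_cbnd; last first.
  apply: (@integrableS _ _ _ mu `[a, b]) => //; first exact: subset_itv_oc_cc.
  apply: continuous_compact_integrable; first exact: segment_compact.
  apply: continuous_subspaceT; exact: smooth_continuous (smooth_derive su).
rewrite /Rintegral (@continuous_FTC2 _ _ u)//.
- apply: continuous_subspaceT; exact: smooth_continuous (smooth_derive su).
- split; first by move=> x _; exact: smooth_derivable.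
  + by apply: cvg_at_right_filter; exact: smooth_continuous.
  + by apply: cvg_at_left_filter; exact: smooth_continuous.
Qed.

(** The primitive from the left vanishes to the left of the support of psi, and to the
    right of it because psi has mean zero. *)
Lemma test_prim a b psi : test_fun a b psi ->
  \int[mu]_(s in `]a, b[) psi s = 0 ->
  exists2 phi, test_fun a b phi & derive1 phi = psi.
Proof.
move=> [sp [c [d [ac db p0]]]] I0.
have cp := smooth_continuous sp.
have ip : mu.-integrable setT (EFin \o psi).
  have : mu.-integrable `[c, d] (EFin \o psi).
    apply: continuous_compact_integrable; first exact: segment_compact.
    exact: continuous_subspaceT.
  move=> /integrable_mkcond -/(_ (measurable_itv _)).
  apply: eq_integrable => // s _; rewrite patchE; case: ifPn => //.
  by rewrite notin_setE/= in_itv/= => /negP/p0 ->.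
pose phi x := \int[mu]_(t in [set` `]-oo, x]]) psi t.
have dphi x : is_derive x 1 phi (psi x).
  have [] := @continuous_FTC1 R psi -oo%O x (x + 1) _ _ _ (cp x).
  - by rewrite ltrDl.
  - exact: integrableS ip.
  - by rewrite ltNyr.
  - by rewrite derive1E => h1 h2; exact: DeriveDef.
exists phi; last by apply/funext => x; rewrite derive1E derive_val.
split; first exact: smooth_prim dphi sp.
exists c, d; split => // s; rewrite negb_and -!ltNge => /orP[sc|ds].
  rewrite /phi -(Rintegral_set0 mu psi) Rintegral_mkcond [RHS]Rintegral_mkcond.
  apply: eq_Rintegral => x _; rewrite !patchE in_set0; case: ifPn => //.
  rewrite inE/= in_itv/= => xs; apply: p0; rewrite negb_and -ltNge (le_lt_trans xs)//.
rewrite -[RHS]I0 /phi Rintegral_mkcond [RHS]Rintegral_mkcond.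
apply: eq_Rintegral => x _; rewrite !patchE.
have [xcd|/p0 ->] := boolP (c <= x <= d); last by rewrite !if_same.
case/andP: xcd => cx xd.
rewrite !mem_set//= in_itv/=; first by rewrite (lt_le_trans ac cx) (le_lt_trans xd db).
exact: ltW (le_lt_trans xd ds).
Qed.

End FundamentalLemma.

(** * Primitives of integrable functions *)

Section Primitives.
Context {R : realType}.
Notation mu := (@lebesgue_measure R).
Implicit Types (u v w f g h : R -> R) (x a b c d r s t : R).

Definition prim a g x : R := \int[mu]_(r in `]a, x[) g r.

Lemma int_on_shorten a b x g : x <= b -> int_on a b g -> int_on a x g.
Proof. by move=> xb; exact: int_onS. Qed.

Lemma prim_le_norm a b g x : int_on a b g -> x <= b ->
  `|prim a g x| <= \int[mu]_(r in `]a, b[) `|g r|.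
Proof.
move=> ig xb; rewrite /prim (le_trans (le_normr_Rintegral _ _))//.
  exact: int_on_shorten ig.
have sub : `]a, x[ `<=` (`]a, b[ : set R).
  by move=> s /=; rewrite !in_itv/= => /andP[? ?]; apply/andP; split; lra.
rewrite -[X in Rintegral mu X _](setIidr sub) Rintegral_mkcondr.
have ign : int_on a b (fun s => `|g s|) by exact: integrable_norm.
apply: le_Rintegral => //.
  apply: (le_int_on _ _ ign).
    apply/measurable_restrict => //; apply: measurable_funS (int_on_mfun ign) => //.
  by move=> s _; rewrite patchE; case: ifP; rewrite ?normr_id ?normr0.
by move=> s _; rewrite patchE; case: ifP => _; [exact: lexx|exact: normr_ge0].
Qed.

Lemma prim_within a b g : a < b -> int_on a b g ->
  {within `[a, b], continuous (prim a g)}.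
Proof.
move=> ab ig; pose gr := g \_ `]a, b[.
have igr : mu.-integrable `[a, b] (EFin \o gr).
  apply: (@integrableS _ _ _ mu setT) => //.
  by move/integrable_mkcond : ig => /(_ (measurable_itv _)); rewrite restrict_EFin.
have := parameterized_integral_continuous (ltW ab) igr.
apply: subspace_eq_continuous => x; rewrite inE/= in_itv/= => /andP[ax xb].
rewrite /from_subspace/= /parameterized_integral -Rintegral_itv_bndo_bndc; last first.
  by apply: integrableS igr => // s /=; rewrite !in_itv/= => /andP[? ?]; apply/andP; split; lra.
rewrite -Rintegral_itv_obnd_cbnd; last first.
  by apply: integrableS igr => // s /=; rewrite !in_itv/= => /andP[? ?]; apply/andP; split; lra.
apply: eq_Rintegral => s; rewrite inE/= in_itv/= => /andP[h1 h2].
by rewrite /gr patchE mem_set//= in_itv/= h1 (lt_le_trans h2).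
Qed.

Lemma prim_cvg_right a b g : a < b -> int_on a b g -> prim a g s @[s --> a^'+] --> (0:R).
Proof.
move=> ab ig; have /(continuous_within_itvP _ ab)[_ + _] := prim_within ab ig.
by rewrite {2}/prim set_itv_ge ?bnd_simp// Rintegral_set0.
Qed.

Lemma prim_cvg_left a b g : a < b -> int_on a b g -> prim a g s @[s --> b^'-] --> prim a g b.
Proof. by move=> ab ig; have /(continuous_within_itvP _ ab)[] := prim_within ab ig. Qed.

Lemma prim_mfun a b g : int_on a b g -> measurable_fun `]a, b[ (prim a g).
Proof.
move=> ig; have [ab|ba] := ltP a b; last first.
  by rewrite set_itv_ge -?leNgt ?bnd_simp//; exact: measurable_fun_set0.
apply: (@measurable_funS _ _ _ _ `[a, b]) => //; first exact: subset_itv_oo_cc.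
apply: subspace_continuous_measurable_fun => //; exact: prim_within.
Qed.

Lemma prim_int a b g h : int_on a b g -> int_on a b h -> int_on a b (fun s => prim a g s * h s).
Proof.
move=> ig ih; have ihn : int_on a b (fun s => `|h s|) by exact: integrable_norm.
apply: (le_int_on _ _ (int_onZ (\int[mu]_(r in `]a, b[) `|g r|) ihn)).
  by apply: measurable_funM; [exact: prim_mfun|exact: int_on_mfun].
move=> s /andP[_ sb]; rewrite normrM ler_wpM2r//; apply: prim_le_norm => //; exact: ltW.
Qed.

Lemma Rfubini (f : R * R -> R) :
  (mu \x mu)%E.-integrable setT (EFin \o f) ->
  (forall x, mu.-integrable setT (EFin \o (fun y => f (x, y)))) ->
  (forall y, mu.-integrable setT (EFin \o (fun x => f (x, y)))) ->
  \int[mu]_x \int[mu]_y f (x, y) = \int[mu]_y \int[mu]_x f (x, y).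
Proof.
move=> fi f1 f2; rewrite /Rintegral; congr fine.
under eq_integral => x _ do rewrite fineK ?(integrable_fin_num _ (f1 x))//.
under [RHS]eq_integral => x _ do rewrite fineK ?(integrable_fin_num _ (f2 x))//.
exact: (Fubini fi).
Qed.

(** Fubini for g(r) h(s) on the triangle r < s of the square ]a, b[ x ]a, b[: integrating
    in r first gives the first integral, integrating in s first gives the product minus the
    second one. *)
Lemma prim_fubini a b g h : int_on a b g -> int_on a b h ->
  \int[mu]_(s in `]a, b[) (prim a g s * h s) + \int[mu]_(s in `]a, b[) (g s * prim a h s)
  = prim a g b * prim a h b.
Proof.
move=> ig ih; pose G := g \_ `]a, b[; pose H := h \_ `]a, b[.
have iG : mu.-integrable setT (EFin \o G).
  by move/integrable_mkcond : ig => /(_ (measurable_itv _)); rewrite restrict_EFin.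
have iH : mu.-integrable setT (EFin \o H).
  by move/integrable_mkcond : ih => /(_ (measurable_itv _)); rewrite restrict_EFin.
have mG : measurable_fun setT G by move/measurable_int/measurable_EFinP : iG.
have mH : measurable_fun setT H by move/measurable_int/measurable_EFinP : iH.
pose f (z : R * R) := if z.1 < z.2 then G z.1 * H z.2 else 0.
have mf : measurable_fun setT f.
  apply: measurable_fun_ifT => //.
    exact: measurable_fun_ltr.
  by apply: measurable_funM; exact: measurableT_comp.
have fle z : `|f z| <= `|G z.1| * `|H z.2|.
  by rewrite /f; case: ifP => _; rewrite ?normrM// normr0 mulr_ge0.
have f1 x : mu.-integrable setT (EFin \o (fun y => f (x, y))).
  apply: (@le_integrable _ _ _ mu setT _ _ (EFin \o (fun y => G x * H y))) => //.
  - by apply/measurable_EFinP; exact: (measurableT_comp mf).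
  - by move=> y _; rewrite lee_fin (le_trans (fle _))//= normrM.
  - have := @integrableZl _ _ _ mu setT measurableT (G x) _ iH.
    by apply: eq_integrable => // s _; rewrite /= EFinM.
have f2 y : mu.-integrable setT (EFin \o (fun x => f (x, y))).
  apply: (@le_integrable _ _ _ mu setT _ _ (EFin \o (fun x => G x * H y))) => //.
  - by apply/measurable_EFinP; exact: (measurableT_comp mf).
  - by move=> x _; rewrite lee_fin (le_trans (fle _))//= normrM.
  - have := @integrableZl _ _ _ mu setT measurableT (H y) _ iG.
    by apply: eq_integrable => // s _; rewrite /= mulrC EFinM.
have fi : (mu \x mu)%E.-integrable setT (EFin \o f).
  apply/integrable12ltyP; first exact/measurable_EFinP.
  have IH : (\int[mu]_y `|(H y)%:E| < +oo)%E by case/integrableP : iH.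
  have IHf : (\int[mu]_y `|(H y)%:E|)%E \is a fin_num by rewrite ge0_fin_numE// integral_ge0.
  have IG : (\int[mu]_x `|(G x)%:E| < +oo)%E by case/integrableP : iG.
  have mGn : measurable_fun setT (fun x => `|(G x)%:E|%E).
    by apply: measurableT_comp => //; exact/measurable_EFinP.
  have mHn : measurable_fun setT (fun x => `|(H x)%:E|%E).
    by apply: measurableT_comp => //; exact/measurable_EFinP.
  apply: (@le_lt_trans _ _ (\int[mu]_x (`|(G x)%:E| * \int[mu]_y `|(H y)%:E|))%E).
    apply: ge0_le_integral => //.
    - by move=> x _; exact: integral_ge0.
    - apply: (@measurable_fun_fubini_tonelli_F _ _ _ _ _ mu (fun z => `|(f z)%:E|%E)) => //.
      by apply: measurableT_comp => //; exact/measurable_EFinP.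
    - by apply: emeasurable_funM.
    - move=> x _; rewrite -ge0_integralZl//.
      apply: ge0_le_integral => //.
      + by apply: measurableT_comp => //; apply/measurable_EFinP; exact: (measurableT_comp mf).
      + by apply: emeasurable_funM.
      + by move=> y _; rewrite -abseM -EFinM lee_fin normrM; exact: fle.
  rewrite ge0_integralZr//; last by exact: integral_ge0.
  by rewrite lte_mul_pinfty ?integral_ge0// ge0_fin_numE// integral_ge0.
have := Rfubini fi f1 f2.
have -> : \int[mu]_y \int[mu]_x f (x, y) = \int[mu]_(s in `]a, b[) (prim a g s * h s).
  rewrite [RHS]Rintegral_mkcond; apply: eq_Rintegral => y _; rewrite patchE.
  case: ifPn => [|yab].
    rewrite inE/= in_itv/= => /andP[ay yb].
    rewrite /prim Rintegral_mkcond -RintegralZr//; last first.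
      by apply: int_on_restrict; apply: int_on_shorten ig; exact: ltW.
    apply: eq_Rintegral => x _; rewrite /f/= /G /H !patchE.
    rewrite [y \in _]mem_set/= ?in_itv/= ?ay//.
    have [xy|yx] := ltP x y.
      have E : (x \in `]a, b[%classic) = (x \in `]a, y[%classic).
        by apply/idP/idP; rewrite !inE/= !in_itv/= => /andP[? ?]; apply/andP; split; lra.
      by rewrite E; case: ifP => //; rewrite mul0r.
    rewrite ifF ?mul0r//; apply/negbTE; rewrite notin_setE/= in_itv/=; apply/negP; lra.
  rewrite -[RHS]/(0 : R) (_ : (fun _ => _) = cst 0) ?Rintegral_cst// ?mul0r//.
  by apply/funext => x; rewrite /f/= /H patchE (negbTE yab) mulr0 if_same.
have -> : \int[mu]_x \int[mu]_y f (x, y) =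
    \int[mu]_(s in `]a, b[) (g s * (prim a h b - prim a h s)).
  rewrite [RHS]Rintegral_mkcond; apply: eq_Rintegral => x _; rewrite patchE.
  case: ifPn => [|xab].
    rewrite inE/= in_itv/= => /andP[ax xb].
    have -> : prim a h b - prim a h x = \int[mu]_(r in `]x, b[) h r.
      rewrite /prim [X in _ - X]Rintegral_itv_bndo_bndc; last first.
        by apply: int_on_shorten ih; exact: ltW.
      by rewrite Rintegral_itvB// bnd_simp ltW.
    rewrite [in RHS]Rintegral_mkcond -RintegralZl//; last first.
      by apply: int_on_restrict; apply: int_onS ih => //; exact: ltW.
    apply: eq_Rintegral => y _; rewrite /f/= /G /H !patchE.
    rewrite [x \in _]mem_set/= ?in_itv/= ?ax//.
    have [xy|yx] := ltP x y.
      have E : (y \in `]a, b[%classic) = (y \in `]x, b[%classic).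
        by apply/idP/idP; rewrite !inE/= !in_itv/= => /andP[? ?]; apply/andP; split; lra.
      by rewrite E; case: ifP => //; rewrite mulr0.
    rewrite ifF ?mulr0//; apply/negbTE; rewrite notin_setE/= in_itv/=; apply/negP; lra.
  rewrite -[RHS]/(0 : R) (_ : (fun _ => _) = cst 0) ?Rintegral_cst// ?mul0r//.
  by apply/funext => y; rewrite /f/= /G patchE (negbTE xab) mul0r if_same.
move=> <-; under eq_Rintegral do rewrite mulrBr.
rewrite RintegralB//; last 2 first.
- by have := int_onZ (prim a h b) ig; under eq_fun do rewrite mulrC.
- by have := prim_int ih ig; under eq_fun do rewrite mulrC.
rewrite addrNK RintegralZr//.
Qed.

End Primitives.

(** * Weak derivatives and primitives *)

Section DuBoisReymond.
Context {R : realType}.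
Notation mu := (@lebesgue_measure R).
Implicit Types (u v w f g h phi psi : R -> R) (x a b c d r s t k : R).

(** Up to a null set, u is absolutely continuous on ]a, b[ with derivative g and initial
    value c. *)
Definition AC a b u g c : Prop :=
  [/\ int_on a b u, int_on a b g &
      {ae mu, forall s, s \in `]a, b[ -> u s = c + prim a g s}].

Lemma ae_itv_ex a b (P : R -> Prop) : a < b ->
  {ae mu, forall s, s \in `]a, b[ -> P s} -> exists2 s, a < s < b & P s.
Proof.
move=> ab [N [mN N0 NP]]; apply: contrapT => h.
have : (mu `]a, b[ <= mu N)%E.
  apply: le_measure; rewrite ?inE// => s /= sab; apply: NP => /= /(_ sab) Ps.
  by apply: h; exists s => //; rewrite in_itv in sab.
by rewrite N0 /= lebesgue_measure_itv/= lte_fin ab -EFinB lee_fin leNgt subr_gt0 ab.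
Qed.

Lemma AC_smooth a b u : smooth u -> AC a b u (derive1 u) (u a).
Proof.
move=> su; split.
- by apply: L2_int; apply: L2_continuous; exact: smooth_continuous su.
- by apply: L2_int; apply: L2_continuous; exact: smooth_continuous (smooth_derive su).
- apply: aeW => s; rewrite in_itv/= => /andP[/ltW sa _].
  by rewrite /prim smooth_FTC// addrC subrK.
Qed.

(** Integration by parts; c + prim a g b is the final value of u. *)
Lemma AC_ibp a b u g c v h d : AC a b u g c -> AC a b v h d ->
  \int[mu]_(s in `]a, b[) (u s * h s) + \int[mu]_(s in `]a, b[) (g s * v s) =
  (c + prim a g b) * (d + prim a h b) - c * d.
Proof.
move=> uA vA; have [iu ig ue] := uA; have [iv ih ve] := vA.
have m1 : measurable_fun `]a, b[ (fun s => u s * h s).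
  by apply: measurable_funM; exact: int_on_mfun.
have m2 : measurable_fun `]a, b[ (fun s => g s * v s).
  by apply: measurable_funM; exact: int_on_mfun.
have i1 := prim_int ig ih.
have i2 : int_on a b (fun s => g s * prim a h s).
  by have := prim_int ih ig; under eq_fun do rewrite mulrC.
have j1 := int_onZ c ih.
have j2 : int_on a b (fun s => g s * d) by have := int_onZ d ig; under eq_fun do rewrite mulrC.
rewrite (ae_Rintegral m1 (int_on_mfun (int_onD j1 i1))); last first.
  by apply: filterS ue => s us sab; rewrite us// mulrDl.
rewrite (ae_Rintegral m2 (int_on_mfun (int_onD j2 i2))); last first.
  by apply: filterS ve => s vs sab; rewrite vs// mulrDr.
rewrite !RintegralD// RintegralZl// RintegralZr//.
have := prim_fubini ig ih; rewrite -/(prim a g b) -/(prim a h b) => E.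
rewrite addrACA E; ring.
Qed.

Lemma AC_weak_deriv a b u g c : AC a b u g c -> weak_deriv a b u g.
Proof.
move=> uA phi tphi; have := AC_ibp uA (AC_smooth a b (test_smooth tphi)).
rewrite -/(prim a (derive1 phi) b).
have -> : phi a = 0 by apply: test_out tphi _; rewrite ltxx.
rewrite add0r mulr0 subr0.
have [ab|ba] := leP a b.
  rewrite [prim a (derive1 phi) b]smooth_FTC//; last exact: test_smooth tphi.
  rewrite (test_out tphi) ?ltxx ?andbF// (test_out (s := a) tphi) ?ltxx//.
  by rewrite subrr mulr0 => /eqP; rewrite addr_eq0 => /eqP.
by rewrite set_itv_ge ?bnd_simp -?leNgt ?ltW// !Rintegral_set0 oppr0.
Qed.

(** Otherwise the constant 1 would vanish almost everywhere by the fundamental lemma. *)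
Lemma test_nonzero_mean a b : a < b ->
  exists2 psi, test_fun a b psi & \int[mu]_(s in `]a, b[) psi s != 0.
Proof.
move=> ab; apply: contrapT => h.
have [] := @ae_itv_ex a b (fun=> (1 : R) = 0) ab.
  apply: (@fundamental_lemma _ a b (fun=> 1)); first exact: int_on_cst.
  move=> phi tphi; under eq_Rintegral do rewrite mul1r.
  by apply: contrapT => /eqP h'; apply: h; exists phi.
by move=> _ _ /eqP; rewrite oner_eq0.
Qed.

Lemma test_int a b phi : test_fun a b phi -> int_on a b phi.
Proof. by move=> /test_continuous/L2_continuous/L2_int. Qed.

(** Fix psi0 with nonzero integral: any psi is a multiple of psi0 up to a function of mean
    zero, and functions of mean zero are derivatives of test functions. *)
Lemma annihilate_derivatives a b (L : (R -> R) -> R) : a < b ->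
  (forall phi psi k, test_fun a b phi -> test_fun a b psi ->
     L (fun s => phi s + k * psi s) = L phi + k * L psi) ->
  (forall phi, test_fun a b phi -> L (derive1 phi) = 0) ->
  exists k, forall psi, test_fun a b psi -> L psi = k * \int[mu]_(s in `]a, b[) psi s.
Proof.
move=> ab Llin L0; have [psi0 t0 I0] := test_nonzero_mean ab.
exists (L psi0 / \int[mu]_(s in `]a, b[) psi0 s) => psi tpsi.
set I := \int[mu]_(s in _) psi s; set I' := \int[mu]_(s in _) psi0 s in I0 *.
have tl := test_lin (- (I / I')) tpsi t0.
have [|phi tphi dphi] := test_prim tl.
  rewrite RintegralD//; last 2 first.
  - exact: test_int.
  - by apply: int_onZ; exact: test_int.
  rewrite RintegralZl//; last exact: test_int.
  by rewrite -/I -/I' mulNr divfK// subrr.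
have := L0 _ tphi; rewrite dphi Llin// mulNr => /eqP; rewrite subr_eq0 => /eqP ->.
by rewrite mulrC mulrA mulrAC.
Qed.

(** The du Bois-Reymond lemma: the difference of u and the primitive of g annihilates the
    derivatives of test functions, hence is constant. *)
Lemma weak_deriv_AC a b u g : a < b -> int_on a b u -> int_on a b g ->
  weak_deriv a b u g -> exists c, AC a b u g c.
Proof.
move=> ab iu ig wd.
have ipr : int_on a b (prim a g).
  by have := prim_int ig (int_on_cst a b 1); under eq_fun do rewrite mulr1.
have pA : AC a b (prim a g) g 0 by split => //; apply: aeW => s _; rewrite add0r.
pose h s := u s - prim a g s.
have ih : int_on a b h by exact: int_onB.
have hphi phi : test_fun a b phi -> int_on a b (fun s => h s * phi s).
  by move=> /test_continuous; exact: int_on_test.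
have [phi psi k tphi tpsi|phi tphi|k hk] :=
  @annihilate_derivatives a b (fun psi => \int[mu]_(s in `]a, b[) (h s * psi s)) ab.
- rewrite -RintegralZl// -?RintegralD//; try exact: hphi.
  + by apply: eq_Rintegral => s _; ring.
  + by apply: int_onZ; exact: hphi.
- have cd := test_continuous (test_derive tphi).
  under eq_Rintegral do rewrite mulrBl.
  rewrite RintegralB//; try exact: int_on_test.
  by rewrite wd// (AC_weak_deriv pA)// subrr.
exists k; split => //.
have := @fundamental_lemma _ a b (fun s => h s - k) (int_onB ih (int_on_cst a b k)).
move=> /(_ _)/wrap[phi tphi|].
  under eq_Rintegral do rewrite mulrBl.
  rewrite RintegralB//; last by apply: int_onZ; exact: test_int.
    by rewrite hk// RintegralZl ?subrr//; exact: test_int.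
  exact: hphi.
apply: filterS => s /[apply] /eqP; rewrite subr_eq0 => /eqP <-.
by rewrite /h subrK.
Qed.

(** The du Bois-Reymond lemma of second order. With F the primitive of f, integration by
    parts shows that psi |-> int (w psi' + F psi) annihilates derivatives of test functions,
    so that it is a multiple of psi |-> int psi. Thus w gains a weak derivative of first
    order although only its second one is prescribed. *)
Lemma weak_deriv2_AC a b w f : a < b -> int_on a b w -> int_on a b f ->
  (forall phi, test_fun a b phi ->
    \int[mu]_(s in `]a, b[) (w s * derive1 (derive1 phi) s) =
    \int[mu]_(s in `]a, b[) (f s * phi s)) ->
  exists k, weak_deriv a b w (fun s => k + prim a f s).
Proof.
move=> ab iw ig wd.
have ipr : int_on a b (prim a f).
  by have := prim_int ig (int_on_cst a b 1); under eq_fun do rewrite mulr1.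
have pA : AC a b (prim a f) f 0 by split => //; apply: aeW => s _; rewrite add0r.
have i1 psi : test_fun a b psi -> int_on a b (fun s => w s * derive1 psi s).
  by move=> /test_derive/test_continuous; exact: int_on_test.
have i2 psi : test_fun a b psi -> int_on a b (fun s => prim a f s * psi s).
  by move=> /test_continuous; exact: int_on_test.
have dl phi psi k : test_fun a b phi -> test_fun a b psi ->
    derive1 (fun s => phi s + k * psi s) = (fun s => derive1 phi s + k * derive1 psi s).
  move=> /test_smooth sphi /test_smooth spsi; apply/funext => s.
  have h1 := @derivableP _ _ _ _ _ _ (@smooth_derivable _ _ s sphi).
  have h2 := @derivableP _ _ _ _ _ _ (@smooth_derivable _ _ s spsi).
  have := @is_deriveD R R^o R^o phi (k *: psi) s 1 _ _ h1 (@is_deriveZ R R^o R^o psi k s 1 _ h2).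
  by rewrite !derive1E => -[_ ->].
have i3 psi : test_fun a b psi ->
    int_on a b (fun s => w s * derive1 psi s + prim a f s * psi s).
  by move=> tpsi; apply: int_onD; [exact: i1|exact: i2].
have [phi psi k tphi tpsi|phi tphi|k hk] := @annihilate_derivatives a b
  (fun psi => \int[mu]_(s in `]a, b[) (w s * derive1 psi s + prim a f s * psi s)) ab.
- rewrite dl// -RintegralZl//; last exact: i3.
  rewrite -RintegralD//; [|exact: i3|by apply: int_onZ; exact: i3].
  by apply: eq_Rintegral => s _; ring.
- rewrite RintegralD//; [|exact: i1 (test_derive tphi)|exact: i2 (test_derive tphi)].
  by rewrite wd// (AC_weak_deriv pA)// addrN.
exists (- k) => psi tpsi.
under [X in - X]eq_Rintegral do rewrite mulrDl.
rewrite RintegralD//; [|by apply: int_onZ; exact: test_int|exact: i2].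
rewrite RintegralZl//; last exact: test_int.
have := hk _ tpsi; rewrite RintegralD//; [|exact: i1|exact: i2].
by rewrite mulNr => <-; ring.
Qed.

End DuBoisReymond.

(** * One-sided values *)

Section Traces.
Context {R : realType}.
Notation mu := (@lebesgue_measure R).
Implicit Types (u v w f g h : R -> R) (x a b c d r s t k : R).

Lemma near_at_right x (P : R -> Prop) :
  (\forall s \near x^'+, P s) -> exists2 e, 0 < e & forall s, x < s < x + e -> P s.
Proof.
move=> [e /= e0 he]; exists e => // s /andP[xs se]; apply: he => //=.
by rewrite distrC gtr0_norm ?subr_gt0// ltrBlDl.
Qed.

Lemma near_at_left x (P : R -> Prop) :
  (\forall s \near x^'-, P s) -> exists2 e, 0 < e & forall s, x - e < s < x -> P s.
Proof.
move=> [e /= e0 he]; exists e => // s /andP[se sx]; apply: he => //=.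
by rewrite gtr0_norm ?subr_gt0// ltrBlDl -ltrBlDr.
Qed.

(** Two representatives with different limits at x^+ would differ on a whole interval
    ]x, x + e[, which is not a null set. *)
Lemma right_val_uniq u x r r' : is_right_val u x r -> is_right_val u x r' -> r = r'.
Proof.
move=> [w [wu wr]] [w' [wu' wr']]; apply/eqP; rewrite -subr_eq0; apply/negPn/negP => rr.
have h : w s - w' s @[s --> x^'+] --> r - r' by exact: cvgB.
have /near_at_right[e e0 he] : \forall s \near x^'+, w s - w' s != 0.
  have /cvgr_dist_lt /(_ `|r - r'|) := h; rewrite normr_gt0 => /(_ rr).
  by apply: filterS => s; apply: contraTneq => ->; rewrite subr0 ltxx.
have [||s /he + E] := @ae_itv_ex R x (x + e) (fun s => w s = w' s).
- by rewrite ltrDl.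
- by apply: filterS2 wu wu' => s -> ->.
by rewrite E subrr eqxx.
Qed.

Lemma left_val_uniq u x r r' : is_left_val u x r -> is_left_val u x r' -> r = r'.
Proof.
move=> [w [wu wr]] [w' [wu' wr']]; apply/eqP; rewrite -subr_eq0; apply/negPn/negP => rr.
have h : w s - w' s @[s --> x^'-] --> r - r' by exact: cvgB.
have /near_at_left[e e0 he] : \forall s \near x^'-, w s - w' s != 0.
  have /cvgr_dist_lt /(_ `|r - r'|) := h; rewrite normr_gt0 => /(_ rr).
  by apply: filterS => s; apply: contraTneq => ->; rewrite subr0 ltxx.
have [||s /he + E] := @ae_itv_ex R (x - e) x (fun s => w s = w' s).
- by rewrite ltrBlDr ltrDl.
- by apply: filterS2 wu wu' => s -> ->.
by rewrite E subrr eqxx.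
Qed.

Lemma right_valE u x r : is_right_val u x r -> right_val u x = r.
Proof. by move=> h; apply: xget_unique => // r' h'; exact: right_val_uniq h' h. Qed.

Lemma left_valE u x r : is_left_val u x r -> left_val u x = r.
Proof. by move=> h; apply: xget_unique => // r' h'; exact: left_val_uniq h' h. Qed.

(** One-sided values are local, whereas the representatives in [is_right_val] agree with u
    almost everywhere on the whole line: the representative is modified far from x. *)
Lemma right_val_eq u v x b r : x < b ->
  {ae mu, forall s, s \in `]x, b[ -> u s = v s} -> is_right_val u x r -> is_right_val v x r.
Proof.
move=> xb uv [w [wu wr]]; exists (fun s => if s \in `]x, b[ then w s else v s); split.
  by apply: filterS2 wu uv => s ws uvs; case: ifPn => // sxb; rewrite ws uvs.
apply: cvg_trans wr; apply: near_eq_cvg; near=> s; rewrite in_itv/= ifT//.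
apply/andP; split; near: s; first exact: nbhs_right_gt.
exact: nbhs_right_lt.
Unshelve. all: by end_near. Qed.

Lemma left_val_eq u v x a r : a < x ->
  {ae mu, forall s, s \in `]a, x[ -> u s = v s} -> is_left_val u x r -> is_left_val v x r.
Proof.
move=> ax uv [w [wu wr]]; exists (fun s => if s \in `]a, x[ then w s else v s); split.
  by apply: filterS2 wu uv => s ws uvs; case: ifPn => // sxb; rewrite ws uvs.
apply: cvg_trans wr; apply: near_eq_cvg; near=> s; rewrite in_itv/= ifT//.
apply/andP; split; near: s; last exact: nbhs_left_lt.
exact: nbhs_left_gt.
Unshelve. all: by end_near. Qed.

Lemma right_val_lin a u v x r r' : is_right_val u x r -> is_right_val v x r' ->
  is_right_val (fun s => a * u s + v s) x (a * r + r').
Proof.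
move=> [w [wu wr]] [w' [wu' wr']]; exists (fun s => a * w s + w' s); split.
- by apply: filterS2 wu wu' => s -> ->.
by apply: cvgD => //; exact: cvgMl_tmp.
Qed.

Lemma left_val_lin a u v x r r' : is_left_val u x r -> is_left_val v x r' ->
  is_left_val (fun s => a * u s + v s) x (a * r + r').
Proof.
move=> [w [wu wr]] [w' [wu' wr']]; exists (fun s => a * w s + w' s); split.
- by apply: filterS2 wu wu' => s -> ->.
by apply: cvgD => //; exact: cvgMl_tmp.
Qed.

Lemma cvg_right_val u x r : u s @[s --> x^'+] --> r -> is_right_val u x r.
Proof. by move=> ur; exists u; split => //; apply: aeW. Qed.

Lemma cvg_left_val u x r : u s @[s --> x^'-] --> r -> is_left_val u x r.
Proof. by move=> ur; exists u; split => //; apply: aeW. Qed.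

Lemma AC_right_val a b u g c : a < b -> AC a b u g c -> is_right_val u a c.
Proof.
move=> ab [iu ig ue]; apply: (@right_val_eq (fun s => c + prim a g s) _ _ b) => //.
  by apply: filterS ue => s /[apply].
apply: cvg_right_val; rewrite -[X in _ --> X]addr0; apply: cvgD; first exact: cvg_cst.
exact: prim_cvg_right ab ig.
Qed.

Lemma AC_left_val a b u g c : a < b -> AC a b u g c -> is_left_val u b (c + prim a g b).
Proof.
move=> ab [iu ig ue]; apply: (@left_val_eq (fun s => c + prim a g s) _ _ a) => //.
  by apply: filterS ue => s /[apply].
apply: cvg_left_val; apply: cvgD; first exact: cvg_cst.
exact: prim_cvg_left ab ig.
Qed.

End Traces.

(** * Semi-inner products *)

Section SemiInner.
Context {R : realType} (E : lmodType R).

Definition subspace (P : set E) : Prop :=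
  P 0 /\ forall (a : R) u v, P u -> P v -> P (a *: u + v).

(** Linearity is only asked on P: the forms on V are built from chosen weak derivatives,
    and the choice is linear, up to null sets, only where weak derivatives exist. *)
Definition semi_inner (P : set E) (b : E -> E -> R) : Prop :=
  [/\ subspace P, forall u v, b u v = b v u,
      forall (a : R) u v w, P u -> P v -> P w -> b (a *: u + v) w = a * b u w + b v w &
      forall u, 0 <= b u u].

Variables (P : set E) (b : E -> E -> R).
Hypothesis (Pb : semi_inner P b).

Let P0 : P 0. Proof. by case: Pb => -[]. Qed.
Let Plin a u v : P u -> P v -> P (a *: u + v). Proof. by case: Pb => -[_ h] _ _ _; exact: h. Qed.
Let sym u v : b u v = b v u. Proof. by case: Pb. Qed.
Let lin a u v w : P u -> P v -> P w -> b (a *: u + v) w = a * b u w + b v w.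
Proof. by case: Pb => _ _ h _; exact: h. Qed.
Let pos u : 0 <= b u u. Proof. by case: Pb. Qed.

Lemma semi_expand a u v : P u -> P v ->
  b (a *: u + v) (a *: u + v) = a ^+ 2 * b u u + 2 * a * b u v + b v v.
Proof.
move=> Pu Pv; rewrite lin//; last exact: Plin.
rewrite (sym u) (sym v) !lin//; try exact: Plin.
rewrite (sym v u); ring.
Qed.

(** The usual discriminant argument; degenerate vectors are not excluded, because functions
    equal almost everywhere are not identified. *)
Lemma semi_CS u v : P u -> P v -> `|b u v| <= Num.sqrt (b u u) * Num.sqrt (b v v).
Proof.
move=> Pu Pv; rewrite -sqrtrM// -sqrtr_sqr ler_wsqrtr//.
(* if b u u = 0 and b u v <> 0, then b is negative at a suitable multiple of u plus v *)
have [u0|u0] := eqVneq (b u u) 0.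
  have [->|n0] := eqVneq (b u v) 0; first by rewrite expr0n u0 mul0r.
  have := pos ((- (b v v + 1) / (2 * b u v)) *: u + v).
  rewrite semi_expand// u0 mulr0 add0r.
  have -> : 2 * (- (b v v + 1) / (2 * b u v)) * b u v = - (b v v + 1) by field.
  lra.
have := pos ((- b u v / b u u) *: u + v); rewrite semi_expand//.
have -> : (- b u v / b u u) ^+ 2 * b u u + 2 * (- b u v / b u u) * b u v + b v v =
  (b u u * b v v - b u v ^+ 2) / b u u by field.
by rewrite ler_pdivlMr ?mul0r ?subr_ge0// lt_neqAle eq_sym u0 pos.
Qed.

Lemma semi_norm_sqr u : Num.sqrt (b u u) ^+ 2 = b u u.
Proof. by rewrite sqr_sqrtr. Qed.

End SemiInner.

(** * Broken Sobolev spaces and the space V *)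

Section Broken.
Context {R : realType} (B : cracked_beam R).
Notation mu := (@lebesgue_measure R).
Notation m := (ncracks B).
Notation x := (pos B).
Notation theta := (flex B).
Implicit Types (u v w f g h : fct R) (F G : functional R) (a c d r s t : R).

Lemma pos_lt i : (i <= m)%N -> x i < x i.+1.
Proof. exact: pos_incr. Qed.

Lemma pos_le i j : (i <= j)%N -> (j <= m.+1)%N -> x i <= x j.
Proof.
elim: j => [|j ih]; first by rewrite leqn0 => /eqP ->.
rewrite leq_eqVlt => /predU1P[->//|]; rewrite ltnS => ij jm.
by rewrite (le_trans (ih ij (ltnW jm)))// ltW// pos_lt.
Qed.

(** Equality in H; the values at the cracks and outside of the beam are irrelevant. *)
Definition aeH u v : Prop := forall i, (i <= m)%N ->
  {ae mu, forall s, s \in `]x i, x i.+1[ -> u s = v s}.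

Lemma aeH_refl u : aeH u u. Proof. by move=> i _; apply: aeW. Qed.

Lemma aeH_sym u v : aeH u v -> aeH v u.
Proof. by move=> h i /h; apply: filterS => s /[apply]. Qed.

Lemma inH_int u i : inH B u -> (i <= m)%N -> int_on (x i) (x i.+1) u.
Proof. by move=> /[apply]; exact: L2_int. Qed.

Lemma inH_lin a u v : inH B u -> inH B v -> inH B (a *: u + v).
Proof.
by move=> hu hv i im; exact: (L2D (L2Z a (hu i im)) (hv i im)).
Qed.

Lemma inH0 : inH B 0.
Proof. by move=> i _; exact: L2_cst. Qed.

Lemma ipH_sym u v : ipH B u v = ipH B v u.
Proof.
by apply: eq_bigr => i _; apply: eq_Rintegral => s _; rewrite mulrC.
Qed.

Lemma ipH_ge0 u : 0 <= ipH B u u.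
Proof. by apply: sumr_ge0 => i _; apply: Rintegral_ge0 => s _; rewrite -expr2 sqr_ge0. Qed.

Lemma ipH_lin a u v w : inH B u -> inH B v -> inH B w ->
  ipH B (a *: u + v) w = a * ipH B u w + ipH B v w.
Proof.
move=> hu hv hw; rewrite /ipH mulr_sumr -big_split/=.
rewrite !big_mkord; apply: eq_bigr => -[i /=]; rewrite ltnS => im _.
rewrite -RintegralZl//; last exact: L2M (hu i im) (hw i im).
rewrite -RintegralD//.
- by apply: eq_Rintegral => s _; rewrite !fctE mulrDl mulrA.
- by apply: int_onZ; exact: L2M (hu i im) (hw i im).
- exact: L2M (hv i im) (hw i im).
Qed.

Lemma ipH_semi : semi_inner (inH B) (ipH B).
Proof.
split; [split|exact: ipH_sym|exact: ipH_lin|exact: ipH_ge0].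
  exact: inH0.
exact: inH_lin.
Qed.

Lemma ipH_ae u u' v : inH B u -> inH B u' -> inH B v -> aeH u u' -> ipH B u v = ipH B u' v.
Proof.
move=> hu hu' hv uu'; rewrite /ipH !big_mkord; apply: eq_bigr => -[i /=]; rewrite ltnS => im _.
apply: ae_Rintegral.
- by apply: measurable_funM; apply: L2_mfun; [exact: hu|exact: hv].
- by apply: measurable_funM; apply: L2_mfun; [exact: hu'|exact: hv].
- exact: ae_mulr (uu' i im).
Qed.

Lemma ipH_ae2 u u' v v' : inH B u -> inH B u' -> inH B v -> inH B v' ->
  aeH u u' -> aeH v v' -> ipH B u v = ipH B u' v'.
Proof.
by move=> hu hu' hv hv' uu' vv'; rewrite (ipH_ae hu hu')// ipH_sym (ipH_ae hv hv')// ipH_sym.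
Qed.

Lemma weak_deriv_eq a c (u u' g g' : R -> R) :
  measurable_fun `]a, c[ u -> measurable_fun `]a, c[ u' ->
  measurable_fun `]a, c[ g -> measurable_fun `]a, c[ g' ->
  {ae mu, forall s, s \in `]a, c[ -> u s = u' s} ->
  {ae mu, forall s, s \in `]a, c[ -> g s = g' s} ->
  weak_deriv a c u g -> weak_deriv a c u' g'.
Proof.
move=> mu1 mu2 mg1 mg2 uu gg ug phi tphi.
have mp := @continuous_mfun R `]a, c[ _ (test_continuous tphi).
have mdp := @continuous_mfun R `]a, c[ _ (test_continuous (test_derive tphi)).
rewrite -(ae_Rintegral (measurable_funM mu1 mdp) (measurable_funM mu2 mdp)); last exact: ae_mulr.
rewrite -(ae_Rintegral (measurable_funM mg1 mp) (measurable_funM mg2 mp)); last exact: ae_mulr.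
exact: ug.
Qed.

Lemma weak_deriv_lin a c (k : R) (u v g h : R -> R) :
  int_on a c u -> int_on a c v -> int_on a c g -> int_on a c h ->
  weak_deriv a c u g -> weak_deriv a c v h ->
  weak_deriv a c (fun s => k * u s + v s) (fun s => k * g s + h s).
Proof.
move=> iu iv ig ih ug vh phi tphi.
have cp := test_continuous tphi; have cdp := test_continuous (test_derive tphi).
have L (f1 f2 psi : R -> R) : int_on a c f1 -> int_on a c f2 -> continuous psi ->
    \int[mu]_(s in `]a, c[) ((k * f1 s + f2 s) * psi s) =
    k * \int[mu]_(s in `]a, c[) (f1 s * psi s) + \int[mu]_(s in `]a, c[) (f2 s * psi s).
  move=> i1 i2 cpsi; rewrite -RintegralZl//; last exact: int_on_test.
  rewrite -RintegralD//.
  - by apply: eq_Rintegral => s _; ring.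
  - by apply: int_onZ; exact: int_on_test.
  - exact: int_on_test.
by rewrite !L// ug// vh// mulrN -opprD.
Qed.

Lemma is_wD_uniq u g h : is_wD B u g -> is_wD B u h -> aeH g h.
Proof.
move=> [Hg ug] [Hh uh] i im.
have ig := inH_int Hg im; have ih := inH_int Hh im.
have := @fundamental_lemma _ (x i) (x i.+1) (fun s => g s - h s) (int_onB ig ih).
move=> /(_ _)/wrap[phi tphi|].
  have cp := test_continuous tphi.
  under eq_Rintegral do rewrite mulrBl.
  rewrite RintegralB//; try exact: int_on_test.
  by apply/eqP; rewrite subr_eq0 -eqr_opp -ug// uh.
by apply: filterS => s /[apply] /eqP; rewrite subr_eq0 => /eqP.
Qed.

Lemma is_wD_ae u u' g g' : inH B u -> inH B u' -> inH B g' -> aeH u u' -> aeH g g' ->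
  is_wD B u g -> is_wD B u' g'.
Proof.
move=> Hu Hu' Hg' uu gg [Hg ug]; split=> // i im.
by apply: weak_deriv_eq (uu i im) (gg i im) (ug i im); apply: L2_mfun; rewrite ?Hu ?Hu' ?Hg ?Hg'//;
  [exact: Hu|exact: Hu'|exact: Hg|exact: Hg'].
Qed.

Lemma is_wD_lin a u v g h : inH B u -> inH B v ->
  is_wD B u g -> is_wD B v h -> is_wD B (a *: u + v) (a *: g + h).
Proof.
move=> Hu Hv [Hg ug] [Hh vh]; split; first exact: inH_lin.
move=> i im; exact: (@weak_deriv_lin _ _ a u v g h (inH_int Hu im) (inH_int Hv im)
  (inH_int Hg im) (inH_int Hh im) (ug i im) (vh i im)).
Qed.

Lemma wD_spec u g : is_wD B u g -> is_wD B u (wD B u) /\ aeH (wD B u) g.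
Proof.
move=> ug; have h : is_wD B u (wD B u) by rewrite /wD; exact: (xgetPex (0 : fct R) (ex_intro _ g ug)).
by split; [exact: h|exact: is_wD_uniq h ug].
Qed.

(** The functions [wDn j u] are chosen successively, each as a weak derivative of the
    previous choice. Any explicit chain of weak derivatives of u shows that they exist, and
    agrees with them almost everywhere. *)
Lemma inHk_chain k u (g : nat -> fct R) : inH B u -> g 0%N = u ->
  (forall j, (j < k)%N -> is_wD B (g j) (g j.+1)) ->
  inHk B k u /\ forall j, (j <= k)%N -> aeH (wDn B j u) (g j).
Proof.
move=> Hu g0 hg.
have Hg j : (j <= k)%N -> inH B (g j).
  by case: j => [|j jk]; rewrite ?g0//; have [] := hg j jk.
have H j : (j <= k)%N -> [/\ inH B (wDn B j u), aeH (wDn B j u) (g j) &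
    forall j', (j' < j)%N -> is_wD B (wDn B j' u) (wDn B j'.+1 u)].
  elim: j => [_|j ih jk].
    by split; [exact: Hu|rewrite /wDn/= g0; exact: aeH_refl|].
  have [h1 h2 h3] := ih (ltnW jk).
  have h4 : is_wD B (wDn B j u) (g j.+1).
    exact: (is_wD_ae (Hg j (ltnW jk)) h1 (Hg _ jk) (aeH_sym h2) (aeH_refl _) (hg j jk)).
  have [h5 h6] := wD_spec h4.
  split; [by case: h5|exact: h6|].
  move=> j'; rewrite ltnS leq_eqVlt => /predU1P[->//|]; exact: h3.
split; last by move=> j /H[].
by split; [exact: Hu|move=> j jk; have [_ _ h] := H k (leqnn k); exact: h].
Qed.

Lemma inHk_wD k u j : inHk B k u -> (j < k)%N -> is_wD B (wDn B j u) (wDn B j.+1 u).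
Proof. by move=> [_]; exact. Qed.

Lemma inHk_inH k u j : inHk B k u -> (j <= k)%N -> inH B (wDn B j u).
Proof. by move=> [hu h]; case: j => // j /h[]. Qed.

Lemma inHk_lin k a u v : inHk B k u -> inHk B k v ->
  inHk B k (a *: u + v) /\
  forall j, (j <= k)%N -> aeH (wDn B j (a *: u + v)) (a *: wDn B j u + wDn B j v).
Proof.
move=> hu hv.
apply: (@inHk_chain k (a *: u + v) (fun j => a *: wDn B j u + wDn B j v)) => //.
  by apply: inH_lin; [exact: (inHk_inH hu (leq0n k))|exact: (inHk_inH hv (leq0n k))].
move=> j jk; exact: (is_wD_lin a (inHk_inH hu (ltnW jk)) (inHk_inH hv (ltnW jk))
  (inHk_wD hu jk) (inHk_wD hv jk)).
Qed.

Lemma inHk0 k : inHk B k 0 /\ forall j, (j <= k)%N -> aeH (wDn B j 0) 0.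
Proof.
apply: (@inHk_chain k 0 (fun=> 0)) => //; first exact: inH0.
move=> j _; split; first exact: inH0.
move=> i im phi tphi; under eq_Rintegral do rewrite mul0r.
under [X in - X]eq_Rintegral do rewrite mul0r.
by rewrite Rintegral_cst// mul0r oppr0.
Qed.

(** On each interval u is the primitive of its derivative, which is where its one-sided
    values come from. *)
Lemma is_wD_AC u g i : inH B u -> is_wD B u g -> (i <= m)%N ->
  [/\ AC (x i) (x i.+1) u g (right_val u (x i)),
      is_right_val u (x i) (right_val u (x i)),
      is_left_val u (x i.+1) (left_val u (x i.+1)) &
      left_val u (x i.+1) = right_val u (x i) + prim (x i) g (x i.+1)].
Proof.
move=> Hu [Hg ug] im.
have [c cA] := weak_deriv_AC (pos_lt im) (inH_int Hu im) (inH_int Hg im) (ug i im).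
have h1 := AC_right_val (pos_lt im) cA; have h2 := AC_left_val (pos_lt im) cA.
by rewrite (right_valE h1) (left_valE h2).
Qed.

Lemma right_val_aeH u v i : (i <= m)%N -> aeH u v -> right_val u (x i) = right_val v (x i).
Proof.
move=> im uv; congr xget; apply/seteqP; split => r /=.
  by apply: right_val_eq (pos_lt im) (uv i im).
by apply: right_val_eq (pos_lt im) (aeH_sym uv im).
Qed.

Lemma left_val_aeH u v i : (i <= m)%N -> aeH u v ->
  left_val u (x i.+1) = left_val v (x i.+1).
Proof.
move=> im uv; congr xget; apply/seteqP; split => r /=.
  by apply: left_val_eq (pos_lt im) (uv i im).
by apply: left_val_eq (pos_lt im) (aeH_sym uv im).
Qed.

Lemma jump_aeH u v i : (1 <= i <= m)%N -> aeH u v -> jump u (x i) = jump v (x i).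
Proof.
case: i => [//|i] /= im uv.
by rewrite /jump (right_val_aeH _ uv)// (left_val_aeH (ltnW im) uv).
Qed.

Lemma jump_lin a u v g h i : (1 <= i <= m)%N -> inH B u -> inH B v ->
  is_wD B u g -> is_wD B v h ->
  jump (a *: u + v) (x i) = a * jump u (x i) + jump v (x i).
Proof.
case: i => [//|i] /= im Hu Hv ug vh; rewrite /jump.
have [_ ur _ _] := is_wD_AC Hu ug im; have [_ vr _ _] := is_wD_AC Hv vh im.
have [_ _ ul _] := is_wD_AC Hu ug (ltnW im); have [_ _ vl _] := is_wD_AC Hv vh (ltnW im).
rewrite (right_valE (right_val_lin a ur vr)) (left_valE (left_val_lin a ul vl)); ring.
Qed.

Lemma inV_lin a u v : inV B u -> inV B v -> inV B (a *: u + v).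
Proof.
move=> [u2 u0 upi uj] [v2 v0 vpi vj]; split.
- by case: (inHk_lin a u2 v2).
- by have := right_val_lin a u0 v0; rewrite mulr0 addr0.
- by have := left_val_lin a upi vpi; rewrite mulr0 addr0.
- move=> i im; have [r [l [ur ul E]]] := uj i im; have [r' [l' [vr vl E']]] := vj i im.
  exists (a * r + r'), (a * l + l'); split.
  + exact: right_val_lin.
  + exact: left_val_lin.
  + by rewrite opprD addrACA -mulrBr -E -E' mulr0 addr0.
Qed.

Lemma is_right_val_cst c t : is_right_val (fun=> c) t c.
Proof. by apply: cvg_right_val; exact: cvg_cst. Qed.

Lemma is_left_val_cst c t : is_left_val (fun=> c) t c.
Proof. by apply: cvg_left_val; exact: cvg_cst. Qed.

Lemma inV0 : inV B 0.
Proof.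
split; [by case: (inHk0 2)|exact: is_right_val_cst|exact: is_left_val_cst|].
move=> i im; exists 0, 0; split; [exact: is_right_val_cst|exact: is_left_val_cst|].
by rewrite subrr.
Qed.

Lemma inV_subspace : subspace (inV B).
Proof. by split; [exact: inV0|exact: inV_lin]. Qed.

Lemma inV_Hk u : inV B u -> inHk B 2 u. Proof. by case. Qed.

Lemma inV_inH u j : inV B u -> (j <= 2)%N -> inH B (wDn B j u).
Proof. by move=> /inV_Hk; exact: inHk_inH. Qed.

Lemma inV_wD u j : inV B u -> (j < 2)%N -> is_wD B (wDn B j u) (wDn B j.+1 u).
Proof. by move=> /inV_Hk; exact: inHk_wD. Qed.

(** Bending forms with crack stiffnesses k: the inner product of V is the case k = 1 and
    the operator A is the case k = 1 / theta. *)
Definition bend (k : nat -> R) u v : R := ipH B (wDn B 2 u) (wDn B 2 v) +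
  \sum_(1 <= i < m.+1) k i * (jump (wDn B 1 u) (x i) * jump (wDn B 1 v) (x i)).

Lemma ipD_lin a u v w : inV B u -> inV B v -> inH B w ->
  ipH B (wDn B 2 (a *: u + v)) w = a * ipH B (wDn B 2 u) w + ipH B (wDn B 2 v) w.
Proof.
move=> Vu Vv Hw; have [_ h] := inHk_lin a (inV_Hk Vu) (inV_Hk Vv).
have Hu := inV_inH Vu (leqnn 2); have Hv := inV_inH Vv (leqnn 2).
have Huv := inV_inH (inV_lin a Vu Vv) (leqnn 2).
exact: etrans (ipH_ae Huv (inH_lin a Hu Hv) Hw (h 2%N isT)) (ipH_lin a Hu Hv Hw).
Qed.

Lemma jumpD_lin i a u v : (1 <= i <= m)%N -> inV B u -> inV B v ->
  jump (wDn B 1 (a *: u + v)) (x i) = a * jump (wDn B 1 u) (x i) + jump (wDn B 1 v) (x i).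
Proof.
move=> im Vu Vv; have [_ h] := inHk_lin a (inV_Hk Vu) (inV_Hk Vv).
have Hu := inV_inH Vu (isT : (1 <= 2)%N); have Hv := inV_inH Vv (isT : (1 <= 2)%N).
apply: etrans (jump_aeH im (h 1%N isT)) _.
exact: jump_lin im Hu Hv (inV_wD Vu (isT : (1 < 2)%N)) (inV_wD Vv (isT : (1 < 2)%N)).
Qed.

Let lin_combine a (p q r s : R) : a * p + q + (a * r + s) = a * (p + r) + (q + s).
Proof. by ring. Qed.

Lemma bend_semi (k : nat -> R) : (forall i, (1 <= i <= m)%N -> 0 <= k i) ->
  semi_inner (inV B) (bend k).
Proof.
move=> k0; split; first exact: inV_subspace.
- move=> u v; apply: (congr2 +%R); first exact: ipH_sym.
  by apply: eq_bigr => i _; exact: congr1 (mulrC _ _).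
- move=> a u v w Vu Vv Vw.
  have e1 := ipD_lin a Vu Vv (inV_inH Vw (leqnn 2)).
  have e2 : \sum_(1 <= i < m.+1) k i * (jump (wDn B 1 (a *: u + v)) (x i) * jump (wDn B 1 w) (x i)) =
      a * (\sum_(1 <= i < m.+1) k i * (jump (wDn B 1 u) (x i) * jump (wDn B 1 w) (x i))) +
      \sum_(1 <= i < m.+1) k i * (jump (wDn B 1 v) (x i) * jump (wDn B 1 w) (x i)).
    rewrite mulr_sumr -big_split/=; apply: eq_big_nat => i im.
    apply: etrans (congr1 (fun z : R => k i * (z * _)) (jumpD_lin a im Vu Vv)) _.
    move: (jump _ _) (jump _ _) (jump _ _) => j1 j2 j3; ring.
  exact: etrans (congr2 +%R e1 e2) (lin_combine _ _ _ _ _).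
- move=> u; apply: addr_ge0; first exact: ipH_ge0.
  rewrite big_nat_cond; apply: sumr_ge0 => i /andP[im _].
  by apply: mulr_ge0; [exact: k0|rewrite -expr2 sqr_ge0].
Qed.

Lemma ipV_bend u v : ipV B u v = bend (fun=> 1) u v.
Proof.
apply: (congr2 +%R) => //; apply: eq_bigr => i _; exact: esym (mul1r _).
Qed.

Lemma ipV_semi : semi_inner (inV B) (ipV B).
Proof.
rewrite (_ : ipV B = bend (fun=> 1)); first exact: bend_semi.
by apply/funext => u; apply/funext => v; exact: ipV_bend.
Qed.

Lemma opA_semi : semi_inner (inV B) (opA B : fct R -> fct R -> R).
Proof.
apply: bend_semi => i /flex_gt0 h; by rewrite invr_ge0 ltW.
Qed.

End Broken.

(** * Quadratic functionals *)

Section Quadratic.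
Context {R : realType} (E : lmodType R) (P : set E) (b : E -> E -> R).
Hypothesis (Pb : semi_inner P b).

Let P0 : P 0. Proof. by case: Pb => -[]. Qed.
Let Plin a u v : P u -> P v -> P (a *: u + v). Proof. by case: Pb => -[_ h] _ _ _; exact: h. Qed.
Let sym u v : b u v = b v u. Proof. by case: Pb. Qed.
Let lin a u v w : P u -> P v -> P w -> b (a *: u + v) w = a * b u w + b v w.
Proof. by case: Pb => _ _ h _; exact: h. Qed.
Let pos u : 0 <= b u u. Proof. by case: Pb. Qed.

Lemma subspaceZ a u : P u -> P (a *: u).
Proof. by move=> Pu; rewrite -[_ *: _]addr0; exact: Plin. Qed.

Lemma subspaceB u v : P u -> P v -> P (u - v).
Proof. by move=> Pu Pv; rewrite addrC -scaleN1r; exact: Plin. Qed.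

Lemma semi_linr a u v w : P u -> P v -> P w -> b w (a *: u + v) = a * b w u + b w v.
Proof. by move=> Pu Pv Pw; rewrite sym lin// !(sym w). Qed.

Lemma semi0l w : P w -> b 0 w = 0.
Proof.
by move=> Pw; have := lin 1 P0 P0 Pw; rewrite scaler0 addr0 mul1r => /eqP;
    rewrite -subr_eq0 opprD addrA subrr sub0r oppr_eq0 => /eqP.
Qed.

Lemma semiZl a u w : P u -> P w -> b (a *: u) w = a * b u w.
Proof. by move=> Pu Pw; have := lin a Pu P0 Pw; rewrite addr0 semi0l// addr0. Qed.

Lemma semiZr a u w : P u -> P w -> b u (a *: w) = a * b u w.
Proof. by move=> Pu Pw; rewrite sym semiZl// sym. Qed.

Lemma semiBl u v w : P u -> P v -> P w -> b (u - v) w = b u w - b v w.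
Proof. by move=> Pu Pv Pw; rewrite addrC -scaleN1r lin// mulN1r addrC. Qed.

Lemma semiBr u v w : P u -> P v -> P w -> b w (u - v) = b w u - b w v.
Proof. by move=> Pu Pv Pw; rewrite sym semiBl// !(sym w). Qed.

Definition quad u : R := 2^-1 * b u u.

Lemma quad_expand u w : P u -> P w -> quad w = quad u + b u (w - u) + quad (w - u).
Proof.
move=> Pu Pw; have Pwu := subspaceB Pw Pu.
rewrite /quad !semiBr// !semiBl// (sym w u); by field.
Qed.

Lemma quad_convex u w (a : R) : P u -> P w -> 0 <= a <= 1 ->
  quad (a *: u + (1 - a) *: w) <= a * quad u + (1 - a) * quad w.
Proof.
move=> Pu Pw /andP[a0 a1]; have Pw' := subspaceZ (1 - a) Pw.
rewrite /quad (semi_expand Pb)// !semiZr// !semiZl//.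
have := pos (u - w); rewrite semiBr// ?semiBl//; last exact: subspaceB.
rewrite (sym w u); have : 0 <= a * (1 - a) by rewrite mulr_ge0// subr_ge0.
move: (b u u) (b u w) (b w w) => p q r h1 h2.
have := mulr_ge0 h1 h2; nra.
Qed.

(** Along u + a v the subgradient inequality reads a d <= a^2 b(v, v) / 2 with
    d = F v - b(u, v), for all real a; this forces d = 0. *)
Lemma quad_subgradient (F : E -> R) u : P u ->
  (forall a v w, P v -> P w -> F (a *: v + w) = a * F v + F w) ->
  (forall w, P w -> quad u + F (w - u) <= quad w) <-> (forall v, P v -> F v = b u v).
Proof.
move=> Pu Flin; split=> [h v Pv|h w Pw]; last first.
  rewrite (quad_expand Pu Pw) h; last exact: subspaceB.
  by rewrite lerDl /quad mulr_ge0 ?pos// invr_ge0.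
have F0 : F 0 = 0.
  by have := Flin 1 0 0 P0 P0; rewrite scaler0 addr0 mul1r => /eqP;
    rewrite -subr_eq0 opprD addrA subrr sub0r oppr_eq0 => /eqP.
have FZ a : F (a *: v) = a * F v by have := Flin a v 0 Pv P0; rewrite addr0 F0 addr0.
pose d := F v - b u v; have K0 := pos v.
have hd a : a * d <= 2^-1 * a ^+ 2 * b v v.
  have := h (a *: v + u) (Plin a Pv Pu); rewrite addrK FZ /quad (semi_expand Pb)// (sym v u) /d.
  move: (F v) (b v v) (b u v) (b u u) => *; nra.
suff : d = 0 by move/eqP; rewrite subr_eq0 => /eqP.
(* the 1 keeps the denominator positive when b v v = 0 *)
have := hd (d / (b v v + 1)).
have K1 : 0 < b v v + 1 by lra.
rewrite -(ler_pM2r (exprn_gt0 2 K1)).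
have -> : d / (b v v + 1) * d * (b v v + 1) ^+ 2 = d ^+ 2 * (b v v + 1) by field; lra.
have -> : 2^-1 * (d / (b v v + 1)) ^+ 2 * b v v * (b v v + 1) ^+ 2 = d ^+ 2 * (2^-1 * b v v) by field; lra.
move=> h1; apply/eqP; rewrite -sqrf_eq0 eq_le sqr_ge0 andbT.
have := sqr_ge0 d; move: (d ^+ 2) (b v v) K0 h1 => z K; nra.
Qed.

End Quadratic.

(** * The bending energy and the operator A *)

Section PartA.
Context {R : realType} (B : cracked_beam R).
Notation m := (ncracks B).
Notation x := (pos B).
Notation theta := (flex B).
Implicit Types (u v w f g h : fct R) (F G : functional R).

Lemma bend_le (k k' : nat -> R) c u : 1 <= c -> (forall i, (1 <= i <= m)%N -> k i <= c * k' i) ->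
  bend B k u u <= c * bend B k' u u.
Proof.
move=> c1 kk; rewrite /bend mulrDr; apply: lerD.
  by rewrite ler_peMl// ipH_ge0.
rewrite mulr_sumr big_nat_cond [leRHS]big_nat_cond; apply: ler_sum => i /andP[im _].
by rewrite [leRHS]mulrA; apply: ler_wpM2r; [rewrite -expr2 sqr_ge0|exact: kk].
Qed.

Lemma stiffness_bounds : exists2 c : R, 1 <= c &
  forall i, (1 <= i <= m)%N -> (theta i)^-1 <= c * 1 /\ 1 <= c * (theta i)^-1.
Proof.
have H n : exists2 c : R, 1 <= c & forall i, (1 <= i <= n)%N ->
    (theta i)^-1 <= c /\ theta i <= c.
  elim: n => [|n [c c1 hc]]; first by exists 1 => // -[].
  exists (c + `|(theta n.+1)^-1| + `|theta n.+1|).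
    by rewrite (le_trans c1)// -addrA lerDl addr_ge0.
  move=> i /andP[i1]; rewrite leq_eqVlt => /predU1P[->|]; last first.
    rewrite ltnS => in1; have [|h1 h2] := hc i; first by rewrite i1.
    have := normr_ge0 (theta n.+1); have := normr_ge0 (theta n.+1)^-1; lra.
  have := ler_norm (theta n.+1); have := ler_norm (theta n.+1)^-1.
  have := normr_ge0 (theta n.+1); have := normr_ge0 (theta n.+1)^-1; lra.
have := H m.
move=> [c c1 hc]; exists c => // i im; have t0 := flex_gt0 im.
have [h1 h2] := hc i im.
by rewrite mulr1; split => //; rewrite ler_pdivlMr// mul1r.
Qed.

Lemma normV_sqr u : normV B u ^+ 2 = ipV B u u.
Proof. exact: semi_norm_sqr (ipV_semi B) u. Qed.

Lemma normV_ge0 u : 0 <= normV B u. Proof. exact: sqrtr_ge0. Qed.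

Lemma opA_sandwich : exists2 c : R, 1 <= c & forall u,
  opA B u u <= c * normV B u ^+ 2 /\ normV B u ^+ 2 <= c * opA B u u.
Proof.
have [c c1 hc] := stiffness_bounds; exists c => // u; rewrite normV_sqr ipV_bend.
by split; apply: bend_le => // i /hc[].
Qed.

Lemma opA_bounded : exists2 c : R, 0 < c & forall u v, inV B u -> inV B v ->
  `|opA B u v : R| <= c * normV B u * normV B v.
Proof.
have [c c1 hc] := opA_sandwich; exists c; first lra.
move=> u v Vu Vv; apply: le_trans (semi_CS (opA_semi B) Vu Vv) _.
have c0 : 0 <= c by lra.
have H w : Num.sqrt (opA B w w) <= Num.sqrt c * normV B w.
  have [h _] := hc w.
  apply: le_trans (ler_wsqrtr h) _; rewrite sqrtrM// sqrtr_sqr ger0_norm ?normV_ge0//.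
apply: le_trans (ler_pM (sqrtr_ge0 _) (sqrtr_ge0 _) (H u) (H v)) _.
by rewrite mulrACA -expr2 sqr_sqrtr// mulrA.
Qed.

Lemma Ub_opA u : Ub B u = 2^-1 * (opA B u u : R).
Proof.
apply: (congr1 (fun z : R => 2^-1 * z)); apply: (congr2 +%R).
  exact: semi_norm_sqr (ipH_semi B) _.
by apply: eq_bigr => i _; apply: (congr1 (fun z : R => _ * z)); rewrite real_normK ?num_real.
Qed.

Lemma Ub_quad : Ub B = quad (opA B : fct R -> fct R -> R).
Proof. by apply/funext => u; exact: Ub_opA. Qed.

Lemma convex_Ub : convexV B (Ub B).
Proof.
rewrite Ub_quad => u w a Vu Vw a01.
have h := quad_convex (opA_semi B) Vu Vw a01; exact: h.
Qed.

Lemma opA_linear_right u (a : R) v w : inV B u -> inV B v -> inV B w ->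
  opA B u (a *: v + w) = a * (opA B u v : R) + opA B u w :> R.
Proof. by move=> Vu Vv Vw; exact: (semi_linr (opA_semi B) a Vv Vw Vu). Qed.

Lemma opA_inVd u : inV B u -> inVd B (opA B u).
Proof.
move=> Vu; split; first by move=> a v w Vv Vw; exact: opA_linear_right.
have [c c0 hc] := opA_bounded; exists (c * normV B u) => v Vv; exact: hc.
Qed.

Let lsc_arith1 (e z : R) : 0 < e -> 0 < z + 1 -> z * (e / (z + 1)) < e.
Proof. by move=> e0 z0; rewrite mulrA ltr_pdivrMr// mulrC; nra. Qed.

Let lsc_arith2 (p q r e z z' : R) : - z <= q -> 0 <= r -> z <= z' -> z' < e ->
  p - e < p + q + r.
Proof. lra. Qed.

(** By [quad_expand], Ub w - Ub u is at least the pairing of A u with w - u, which is small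
    when w - u is small in V. *)
Lemma lsc_Ub : lscV B (Ub B).
Proof.
move=> u e Vu e0; have [c c0 hc] := opA_bounded.
have n0 := normV_ge0 u.
have K0 : 0 < c * normV B u + 1 by have := mulr_ge0 (ltW c0) n0; lra.
exists (e / (c * normV B u + 1)); first exact: divr_gt0.
move=> w Vw hw; have Vwu := subspaceB (opA_semi B) Vw Vu.
rewrite Ub_quad (quad_expand (opA_semi B) Vu Vw).
have U0 : 0 <= quad (opA B : fct R -> fct R -> R) (w - u).
  by rewrite mulr_ge0 ?invr_ge0//; case: (opA_semi B) => _ _ _; exact.
have := hc u (w - u) Vu Vwu; rewrite ler_norml => /andP[h _].
have h3 : c * normV B u * normV B (w - u) <= c * normV B u * (e / (c * normV B u + 1)).
  by apply: ler_wpM2l (ltW hw); rewrite mulr_ge0// ltW.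
exact: lsc_arith2 h U0 h3 (lsc_arith1 e0 K0).
Qed.

Lemma bending_energy_properties :
  [/\ convexV B (Ub B),
      lscV B (Ub B),
      (forall u, inV B u -> inVd B (opA B u)) /\
      (forall (a : R) u w, inV B u -> inV B w ->
         eqVd B (opA B (a *: u + w)) (a *: opA B u + opA B w)),
      (forall u v, inV B u -> inV B v -> opA B u v = opA B v u) /\
      (exists2 c : R, 0 < c &
         forall u, inV B u -> c * normV B u ^+ 2 <= opA B u u) &
      forall u, inV B u ->
        Ub B u = 2^-1 * (opA B u u : R) /\
        subdiff B (Ub B) u = [set F | inVd B F /\ eqVd B F (opA B u)]].
Proof.
split.
- exact: convex_Ub.
- exact: lsc_Ub.
- split; first exact: opA_inVd.
  by move=> a u w Vu Vw v Vv; case: (opA_semi B) => _ _ h _; exact: h.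
- split; first by move=> u v _ _; case: (opA_semi B) => _ h _ _; exact: h.
  have [c c1 hc] := opA_sandwich; exists c^-1; first by rewrite invr_gt0; lra.
  by move=> u Vu; have [_ h] := hc u; rewrite mulrC ler_pdivrMr 1?mulrC//; lra.
- move=> u Vu; split; first exact: Ub_opA.
  rewrite Ub_quad; apply/seteqP; split=> F [VF hF]; split; try exact: VF.
    exact/(quad_subgradient (opA_semi B) Vu VF.1).
  exact: (quad_subgradient (opA_semi B) Vu VF.1).2 hF.
Qed.

End PartA.

(** * The Poincare inequality on V *)

Section Poincare.
Context {R : realType} (B : cracked_beam R).
Notation mu := (@lebesgue_measure R).
Notation m := (ncracks B).
Notation x := (pos B).
Implicit Types (u v w f g h : R -> R) (a b c d r s t D M : R).

Lemma Rintegral_cst_oo a b c : a <= b -> \int[mu]_(s in `]a, b[) c = c * (b - a).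
Proof.
move=> ab; rewrite Rintegral_cst// /= lebesgue_measure_itv/= lte_fin.
case: ltP => [_|ba]; first by rewrite -EFinB.
have -> : b = a by apply/eqP; rewrite eq_le ba ab.
by rewrite subrr.
Qed.

Lemma norm_int_le a b f M : a <= b -> int_on a b f ->
  (forall s, a < s < b -> `|f s| <= M) -> `|\int[mu]_(s in `]a, b[) f s| <= M * (b - a).
Proof.
move=> ab fi fM; apply: (le_trans (le_normr_Rintegral _ fi)) => //.
rewrite -Rintegral_cst_oo//; apply: le_Rintegral => //; first exact: integrable_norm.
exact: int_on_cst.
Qed.

Lemma AC_bound a b g h d D M : AC a b g h d ->
  (forall s, a < s <= b -> `|d + prim a h s - D| <= M) ->
  forall s, a < s <= b -> `|prim a g s - D * (s - a)| <= M * (s - a).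
Proof.
move=> [ig ih ge] hM s /andP[ss sb].
have ig' := int_on_shorten sb ig; have ih' := int_on_shorten sb ih.
have ip : int_on a s (prim a h).
  by have := prim_int ih' (int_on_cst a s 1); under eq_fun do rewrite mulr1.
have i1 := int_onD (int_on_cst a s d) ip.
have E : prim a g s = \int[mu]_(r in `]a, s[) (d + prim a h r).
  apply: ae_Rintegral; [exact: int_on_mfun ig'|exact: int_on_mfun i1|].
  apply: filterS ge => r gr; rewrite in_itv/= => /andP[ar rs]; apply: gr.
  by rewrite in_itv/= ar (lt_le_trans rs sb).
rewrite E -(Rintegral_cst_oo D (ltW ss)) -RintegralB//; last exact: int_on_cst.
apply: norm_int_le; [exact: ltW|exact: int_onB i1 (int_on_cst _ _ _)|].
by move=> r /andP[ar rs]; apply: hM; rewrite ar (le_trans (ltW rs) sb).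
Qed.

(** Integrate |h| <= t + h^2 / t. *)
Lemma L1_le_L2 a b h t : a <= b -> 0 < t -> L2 a b h ->
  \int[mu]_(s in `]a, b[) (h s * h s) <= t ^+ 2 ->
  \int[mu]_(s in `]a, b[) `|h s| <= t * (b - a + 1).
Proof.
move=> ab t0 h2 ht.
have i2 := L2M h2 h2; have i1 := L2_int h2.
apply: (@le_trans _ _ (\int[mu]_(s in `]a, b[) (t + t^-1 * (h s * h s)))).
  apply: le_Rintegral => //.
  - exact: integrable_norm.
  - by apply: int_onD; [exact: int_on_cst|exact: int_onZ].
  - move=> s _; rewrite -(ler_pM2l t0) mulrDr mulrA divff ?gt_eqF// mul1r.
    have := sqr_ge0 (`|h s| - t); rewrite sqrrB (real_normK (num_real _)).
    have := normr_ge0 (h s); move: (`|h s|) => z; rewrite -expr2 => z0.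
    have := mulr_ge0 z0 (ltW t0); nra.
rewrite RintegralD//; [|exact: int_on_cst|exact: int_onZ].
rewrite Rintegral_cst_oo// RintegralZl// [leRHS]mulrDr mulr1 lerD2l.
by rewrite ler_pdivrMl// -expr2.
Qed.

(** The value of u at the i-th node; it is single valued on V. *)
Let trace0 (u : R -> R) i : R := if i is _.+1 then left_val u (x i) else 0.

Lemma pos_ge0 i : (i <= m.+1)%N -> 0 <= x i.
Proof. by move=> im; rewrite -(pos0 B) pos_le. Qed.

Lemma pos_le_pi i : (i <= m.+1)%N -> x i <= pi.
Proof. by move=> im; rewrite -(pos_end B) pos_le. Qed.

Lemma inV_trace (u : fct R) i : inV B u -> (i <= m)%N -> right_val u (x i) = trace0 u i.
Proof.
move=> [_ u0 _ uj]; case: i => [_|i im] /=.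
  by rewrite pos0; exact: right_valE.
have [r [l [ur ul E]]] := uj i.+1 im.
by rewrite (right_valE ur) (left_valE ul); apply/eqP; rewrite -subr_eq0 -E.
Qed.

Lemma inV_trace_end (u : fct R) : inV B u -> trace0 u m.+1 = 0.
Proof. by move=> [_ _ upi _]; rewrite /trace0 pos_end; exact: left_valE. Qed.

Let kappa : R := pi + 1.

Let kappa0 : 0 < kappa. Proof. by rewrite /kappa addr_gt0 ?pi_gt0. Qed.

(** The bounds are proved for every t > 0 above the norm of u, as [L1_le_L2] divides by t
    and the norm may vanish. *)
Section Bounds.
Variables (u : fct R) (t : R).
Hypotheses (Vu : inV B u) (t0 : 0 < t) (ut : normV B u <= t).

Let ipV_le : ipV B u u <= t ^+ 2.
Proof.
by rewrite -normV_sqr lerXn2r// nnegrE ?normV_ge0// ltW.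
Qed.

Lemma interval_sqr_le (h : R -> R) i : (i <= m)%N ->
  \int[mu]_(s in `]x i, x i.+1[) (h s * h s) <= ipH B h h.
Proof.
move=> im; rewrite /ipH big_mkord.
rewrite (bigD1 (Ordinal (im : (i < m.+1)%N)))//= lerDl.
by apply: sumr_ge0 => j _; apply: Rintegral_ge0 => s _; rewrite -expr2 sqr_ge0.
Qed.

Lemma ipH_D2_le : ipH B (wDn B 2 u) (wDn B 2 u) <= t ^+ 2.
Proof.
apply: le_trans ipV_le; rewrite /ipV lerDl big_nat_cond.
by apply: sumr_ge0 => j _; rewrite -expr2 sqr_ge0.
Qed.

Lemma jump_le i : (1 <= i <= m)%N -> `|jump (wDn B 1 u) (x i)| <= t.
Proof.
move=> im; rewrite -ler_sqr ?nnegrE//; last exact: ltW.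
apply: le_trans ipV_le; rewrite real_normK ?num_real//.
apply: le_trans (_ : \sum_(1 <= j < m.+1) jump (wDn B 1 u) (x j) * jump (wDn B 1 u) (x j) <= _).
  rewrite (bigD1_seq i) ?mem_index_iota ?iota_uniq//= expr2 lerDl.
  by apply: sumr_ge0 => j _; rewrite -expr2 sqr_ge0.
by rewrite /ipV lerDr; exact: ipH_ge0.
Qed.

Let g := wDn B 1 u.
Let h := wDn B 2 u.

Let gAC i : (i <= m)%N -> AC (x i) (x i.+1) g h (right_val g (x i)).
Proof.
move=> im; have [] := is_wD_AC (inV_inH Vu (isT : (1 <= 2)%N)) (inV_wD Vu (isT : (1 < 2)%N)) im.
by move=> + _ _ _; exact.
Qed.

Let gleft i : (i <= m)%N -> left_val g (x i.+1) = right_val g (x i) + prim (x i) h (x i.+1).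
Proof.
move=> im; have [] := is_wD_AC (inV_inH Vu (isT : (1 <= 2)%N)) (inV_wD Vu (isT : (1 < 2)%N)) im.
by move=> _ _ _; exact.
Qed.

Let uAC i : (i <= m)%N -> AC (x i) (x i.+1) u g (trace0 u i).
Proof.
move=> im; have [] := is_wD_AC (inV_inH Vu (isT : (0 <= 2)%N)) (inV_wD Vu (isT : (0 < 2)%N)) im.
by rewrite -[wDn B 0 u]/u (inV_trace Vu im) => + _ _ _; exact.
Qed.

Let uleft i : (i <= m)%N -> trace0 u i.+1 = trace0 u i + prim (x i) g (x i.+1).
Proof.
move=> im; have [] := is_wD_AC (inV_inH Vu (isT : (0 <= 2)%N)) (inV_wD Vu (isT : (0 < 2)%N)) im.
by rewrite -[wDn B 0 u]/u (inV_trace Vu im) => _ _ _; exact.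
Qed.

Let prim_h_le i s : (i <= m)%N -> s <= x i.+1 -> `|prim (x i) h s| <= kappa * t.
Proof.
move=> im sx; have Hh := inV_inH Vu (leqnn 2).
apply: le_trans (prim_le_norm (inH_int Hh im) sx) _.
apply: le_trans (L1_le_L2 (ltW (pos_lt im)) t0 (Hh i im) _) _.
  exact: le_trans (interval_sqr_le h im) ipH_D2_le.
rewrite mulrC ler_pM2r// /kappa lerD2r lerBlDr.
have := pos_ge0 (leqW im); have := @pos_le_pi i.+1 im; lra.
Qed.

Let D := right_val g (x 0).
Let K := (m.+1)%:R * (kappa + 1).

(** Each interval changes u' by at most kappa t, each crack by at most t. *)
Let right_g_le i : (i <= m)%N -> `|right_val g (x i) - D| <= i%:R * ((kappa + 1) * t).
Proof.
elim: i => [_|i ih im]; first by rewrite subrr normr0 mul0r.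
have h1 := ih (ltnW im); have h2 := @jump_le i.+1 im; have h3 := prim_h_le (ltnW im) (lexx _).
move: h2; rewrite /jump (gleft (ltnW im)).
move: (right_val g _) (right_val g (x i)) h1 (prim _ _ _) h3 => p q h1 r h3 h2.
have -> : p - D = (q - D) + r + (p - (q + r)) by ring.
apply: le_trans (ler_normD _ _) _; apply: le_trans (lerD (ler_normD _ _) h2) _.
apply: le_trans (lerD (lerD h1 h3) (lexx _)) _.
rewrite -natr1; lra.
Qed.

Let g_le i s : (i <= m)%N -> x i < s <= x i.+1 ->
  `|right_val g (x i) + prim (x i) h s - D| <= K * t.
Proof.
move=> im /andP[_ sx]; have h1 := right_g_le im; have h2 := prim_h_le im sx.
rewrite addrAC (le_trans (ler_normD _ _))//.
apply: le_trans (lerD h1 h2) _.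
have h3 : i%:R * ((kappa + 1) * t) <= m%:R * ((kappa + 1) * t).
  by apply: ler_wpM2r; [have := mulr_gt0 (addr_gt0 kappa0 ltr01) t0; lra|rewrite ler_nat].
apply: le_trans (lerD h3 (lexx _)) _.
have -> : K * t = m%:R * ((kappa + 1) * t) + (kappa * t + t) by rewrite /K -natr1; ring.
by rewrite lerD2l lerDl ltW.
Qed.

Let prim_g_le i s : (i <= m)%N -> x i < s <= x i.+1 ->
  `|prim (x i) g s - D * (s - x i)| <= K * t * (s - x i).
Proof. by move=> im; apply: AC_bound (gAC im) _ _ => r; exact: g_le. Qed.

Let trace_le i : (i <= m.+1)%N -> `|trace0 u i - D * x i| <= K * t * x i.
Proof.
elim: i => [_|i ih im]; first by rewrite pos0 !mulr0 subr0 normr0.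
have h1 := ih (ltnW im); have := @prim_g_le i (x i.+1) im.
rewrite lexx andbT => /(_ (pos_lt im)) h2; rewrite uleft//.
move: (trace0 u i) (prim _ _ _) h1 h2 => p q h1 h2.
have -> : p + q - D * x i.+1 = (p - D * x i) + (q - D * (x i.+1 - x i)) by ring.
rewrite (le_trans (ler_normD _ _))//; apply: le_trans (lerD h1 h2) _.
by rewrite -mulrDr subrKC.
Qed.

(** As u vanishes at both ends of the beam, u' has mean zero; being within K t of D, it
    cannot have mean zero unless D is at most K t. *)
Let D_le : `|D| <= K * t.
Proof.
have := trace_le (leqnn m.+1); rewrite (inV_trace_end Vu) sub0r normrN pos_end normrM.
by rewrite (ger0_norm (pi_ge0 R)) ler_pM2r// pi_gt0.
Qed.

Let u_le i s : (i <= m)%N -> x i < s <= x i.+1 ->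
  `|trace0 u i + prim (x i) g s| <= 2 * K * t * pi.
Proof.
move=> im xs; have h1 := trace_le (leqW im); have h2 := prim_g_le im xs.
have s0 : 0 <= s by case/andP: xs => h3 _; have := pos_ge0 (leqW im); lra.
have spi : s <= pi by case/andP: xs => _ h3; have := @pos_le_pi i.+1 im; lra.
move: (trace0 u i) (prim _ _ _) h1 h2 => p q h1 h2.
have -> : p + q = (p - D * x i) + (q - D * (s - x i)) + D * s by ring.
have h3 : `|D * s| <= K * t * s by rewrite normrM (ger0_norm s0); apply: ler_wpM2r.
rewrite (le_trans (ler_normD _ _))//; apply: le_trans (lerD (ler_normD _ _) h3) _.
apply: le_trans (lerD (lerD h1 h2) (lexx _)) _.
rewrite -mulrDr subrKC.
have h4 : K * t * s <= K * t * pi by apply: ler_wpM2l => //; exact: le_trans D_le.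
lra.
Qed.

Lemma ipH_le_sqr : ipH B u u <= (2 * K * t * pi) ^+ 2 * pi.
Proof.
have Hu := inV_inH Vu (isT : (0 <= 2)%N).
apply: (@le_trans _ _ (\sum_(0 <= i < m.+1) (2 * K * t * pi) ^+ 2 * (x i.+1 - x i))); last first.
  rewrite -mulr_sumr telescope_sumr// pos_end pos0 subr0//.
rewrite /ipH !big_mkord; apply: ler_sum => -[i /=]; rewrite ltnS => im _.
have [iu ig ue] := uAC im.
have ip : int_on (x i) (x i.+1) (prim (x i) g).
  by have := prim_int ig (int_on_cst _ _ 1); under eq_fun do rewrite mulr1.
have i1 := int_onD (int_on_cst _ _ (trace0 u i)) ip.
have mf := int_on_mfun i1.
rewrite (@ae_Rintegral _ _ _ _ (fun s => (trace0 u i + prim (x i) g s) * (trace0 u i + prim (x i) g s))).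
- have M0 s : x i < s < x i.+1 ->
    `|(trace0 u i + prim (x i) g s) * (trace0 u i + prim (x i) g s)| <= (2 * K * t * pi) ^+ 2.
    move=> /andP[s1 s2]; rewrite normrM expr2.
    by apply: ler_pM; rewrite ?normr_ge0//; apply: u_le; rewrite // s1 ltW.
  apply: le_trans (ler_norm _) _; apply: norm_int_le => //; first exact/ltW/pos_lt.
  by apply: int_on_bounded M0; exact: measurable_funM.
- by apply: measurable_funM; exact: int_on_mfun iu.
- exact: measurable_funM.
- by apply: filterS ue => s us sx; rewrite us.
Qed.

End Bounds.

(** The norm of V controls u'' and the jumps of u', hence the oscillation of u', hence u'
    because it has mean zero, hence u. *)
Lemma poincare : exists2 C, 0 < C & forall u : fct R, inV B u -> normH B u <= C * normV B u.
Proof.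
pose K : R := (m.+1)%:R * (kappa + 1).
have pi0 := pi_gt0 R.
have K0 : 0 < K by rewrite mulr_gt0// addr_gt0.
pose C := 2 * K * pi * Num.sqrt pi.
have C0 : 0 < C by apply: mulr_gt0; [apply: mulr_gt0 => //; exact: mulr_gt0|rewrite sqrtr_gt0].
exists C => // u Vu; have N0 := normV_ge0 B u.
have H t : 0 < t -> normV B u <= t -> normH B u <= C * t.
  move=> t0 ut; have := ipH_le_sqr Vu t0 ut => h.
  apply: le_trans (ler_wsqrtr h) _.
  have p0 : 0 <= 2 * K * t * pi by rewrite mulr_ge0 ?(ltW pi0)// mulr_ge0 ?(ltW t0)// mulr_ge0 ?(ltW K0).
  rewrite sqrtrM ?sqr_ge0// sqrtr_sqr ger0_norm//.
  by rewrite -/K /C; lra.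
apply/ler_addgt0Pr => e e0.
have e1 : 0 < e / C by exact: divr_gt0.
have := H (normV B u + e / C) _ _; rewrite mulrDr (mulrC C (e / C)) divfK ?gt_eqF//.
apply; first lra.
by rewrite lerDl ltW.
Qed.

End Poincare.

(** * Paths in a space with a seminorm *)

Lemma L2_dominated (R : realType) (a b C : R) (u v : R -> R) :
  measurable_fun (`]a, b[ : set R) u -> L2 a b v ->
  (forall s, a < s < b -> `|u s| <= C * v s) -> L2 a b u.
Proof.
move=> mu' v2 uv; apply/L2P; split => //.
apply: (le_int_on _ _ (L2_sqr (L2Z C v2))); first exact: measurable_funX.
move=> s /uv h; have h0 : 0 <= C * v s by exact: le_trans h.
by rewrite normrX; apply: lerXn2r; rewrite ?nnegrE.
Qed.

Section Paths.
Context {R : realType} (E : lmodType R) (P : set E) (N : E -> R).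
Notation mu := (@lebesgue_measure R).
Hypothesis (Psub : subspace P).

Definition linear_on (q : E -> R) : Prop :=
  forall (a : R) u v, P u -> P v -> q (a *: u + v) = a * q u + q v.

Lemma linear_on0 q : linear_on q -> q 0 = 0.
Proof.
case: Psub => P0 _ hq; have := hq 1 0 0 P0 P0; rewrite scaler0 addr0 mul1r => /eqP.
by rewrite -subr_eq0 opprD addrA subrr sub0r oppr_eq0 => /eqP.
Qed.

Lemma linear_onB q u v : linear_on q -> P u -> P v -> q (u - v) = q u - q v.
Proof. by move=> hq Pu Pv; rewrite addrC -scaleN1r hq// mulN1r addrC. Qed.

Lemma subspace_sub u v : P u -> P v -> P (u - v).
Proof. by move=> Pu Pv; rewrite addrC -scaleN1r; exact: Psub.2. Qed.

Lemma subspace_sum n (a : 'I_n -> R) (c : 'I_n -> E) : (forall k, P (c k)) ->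
  P (\sum_(k < n) a k *: c k).
Proof.
move=> Pc; apply: big_ind => [|u v Pu Pv|k _].
- exact: Psub.1.
- by have := Psub.2 1 u v Pu Pv; rewrite scale1r.
- by have := Psub.2 (a k) (c k) 0 (Pc k) Psub.1; rewrite addr0.
Qed.

Lemma linear_on_sum q n (a : 'I_n -> R) (c : 'I_n -> E) : linear_on q -> (forall k, P (c k)) ->
  q (\sum_(k < n) a k *: c k) = \sum_(k < n) a k * q (c k).
Proof.
move=> hq Pc; elim: n a c Pc => [|n ih] a c Pc; first by rewrite !big_ord0 linear_on0.
rewrite !big_ord_recl hq ?ih//.
exact: subspace_sum.
Qed.

Lemma simple_path_in s t : simple_path P s -> P (s t).
Proof. by move=> [n [A [c [_ Pc ->]]]]; exact: subspace_sum. Qed.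

(** Along simple paths q is a simple function, and q (f t) is the limit of these. *)
Lemma linear_path_mfun T f q C : strongly_measurable P N T f -> linear_on q ->
  (forall e, P e -> `|q e| <= C * N e) -> measurable_fun `]0, T[ (fun t => q (f t)).
Proof.
move=> [s ss sf] hq qC.
apply: (@measurable_fun_cvg _ _ _ _ (fun n t => q (s n t))) => [n|t].
  have [k [A [c [mA Pc E']]]] := ss n.
  rewrite (_ : (fun t => _) = (fun t => \sum_(j < k) (\1_(A j) t : R) * q (c j))); last first.
    by apply/funext => t; rewrite E' linear_on_sum.
  by apply: measurable_sum => j; exact: measurable_funM.
rewrite /= in_itv/= => /sf[Pf Nf].
have h n : `|q (f t) - q (s n t)| <= C * N (f t - s n t).
  rewrite -linear_onB//; last exact: simple_path_in.
  by apply: qC; apply: subspace_sub => //; exact: simple_path_in.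
have hC : C * N (f t - s n t) @[n --> \oo] --> (0 : R).
  by rewrite -(mulr0 C); exact: cvgMl_tmp.
apply/subr_cvg0; apply/norm_cvg0P.
apply: (@squeeze_cvgr _ _ _ _ (fun=> 0) (fun n => C * N (f t - s n t))); last exact: hC.
  by near=> n; rewrite normr_ge0 distrC h.
exact: cvg_cst.
Unshelve. all: by end_near. Qed.

Lemma linear_path_L2 T f q C : L2path P N T f -> linear_on q ->
  (forall e, P e -> `|q e| <= C * N e) -> L2 0 T (fun t => q (f t)).
Proof.
move=> [sf f2] hq qC; apply: (@L2_dominated _ _ _ C _ (fun t => N (f t))) => //.
  exact: linear_path_mfun qC.
by move=> t tT; apply: qC; case: sf => s _ /(_ t tT)[].
Qed.

(** The range of a strongly measurable path is separable: a simple path takes finitely many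
    values, coded by the list of booleans telling which of its sets contain t. *)
Lemma strongly_measurable_separable T f : strongly_measurable P N T f ->
  exists d : nat -> seq bool -> E, (forall n l, P (d n l)) /\
    forall t, 0 < t < T -> forall e : R, 0 < e -> exists n l, N (f t - d n l) < e.
Proof.
move=> [s ss sf].
have H n : exists d : seq bool -> E, (forall l, P (d l)) /\ forall t, exists l, s n t = d l.
  have [k [A [c [_ Pc E']]]] := ss n.
  (* a list of booleans selects the values c j that are added up *)
  exists (fun l => \sum_(j < k) (nth false l j)%:R *: c j); split.
    by move=> l; exact: subspace_sum.
  move=> t; exists [seq (t \in A j) | j <- enum 'I_k]; rewrite E'.
  apply: eq_bigr => j _; congr (_ *: _).
  by rewrite (nth_map j) ?size_enum_ord// nth_ord_enum indicE.
have [d hd] := choice H; exists d; split; first by move=> n l; case: (hd n).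
move=> t tT e e0; have [_ Nf] := sf t tT.
have /cvgr_dist_lt /(_ e e0) [n _ /(_ n (leqnn n))] := Nf.
have [_ /(_ t)[l sE]] := hd n; rewrite /= sE sub0r normrN => h.
by exists n, l; exact: le_lt_trans (ler_norm _) h.
Qed.

End Paths.

Section BilinearPaths.
Context {R : realType} (E E' : lmodType R) (P : set E) (N : E -> R) (P' : set E') (N' : E' -> R).
Notation mu := (@lebesgue_measure R).
Hypotheses (Psub : subspace P) (Psub' : subspace P').

(** Only the first path is replaced by simple paths: for these the pairing is a finite sum
    of linear functionals of the second path. *)
Lemma bilinear_path_int T f g (b : E -> E' -> R) C : L2path P N T f -> L2path P' N' T g ->
  (forall e', P' e' -> linear_on P (b^~ e')) -> (forall e, P e -> linear_on P' (b e)) ->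
  (forall e e', P e -> P' e' -> `|b e e'| <= C * N e * N' e') ->
  int_on 0 T (fun t => b (f t) (g t)).
Proof.
move=> [sf f2] [sg g2] bl br bC.
have Pf t : 0 < t < T -> P (f t) by move=> tT; case: sf => s _ /(_ t tT)[].
have Pg t : 0 < t < T -> P' (g t) by move=> tT; case: sg => s _ /(_ t tT)[].
apply: (le_int_on _ _ (int_onZ C (L2M f2 g2))); last first.
  by move=> t tT; rewrite mulrA; apply: bC; [exact: Pf|exact: Pg].
have [s ss sf'] := sf.
apply: (@measurable_fun_cvg _ _ _ _ (fun n t => b (s n t) (g t))) => [n|t].
  have [k [A [c [mA Pc cE]]]] := ss n.
  apply: (@eq_measurable_fun _ _ _ _ _ (fun t => \sum_(j < k) (\1_(A j) t : R) * b (c j) (g t))).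
    move=> t; rewrite inE/= in_itv/= => tT.
    by rewrite cE (linear_on_sum Psub _ (bl _ (Pg t tT)) Pc).
  apply: measurable_sum => j; apply: measurable_funM => //.
  apply: (@linear_path_mfun _ _ _ _ Psub' _ _ _ (C * N (c j)) sg); first exact: br.
  by move=> e' Pe'; exact: bC.
rewrite /= in_itv/= => tT; have Pgt := Pg t tT; have [Pft Nf] := sf' t tT.
have Ps n : P (s n t) by exact: (simple_path_in Psub).
have h n : `|b (f t) (g t) - b (s n t) (g t)| <= (C * N' (g t)) * N (f t - s n t).
  rewrite -(linear_onB (bl _ Pgt))// mulrAC; apply: bC => //.
  exact: (subspace_sub Psub).
have hC : (C * N' (g t)) * N (f t - s n t) @[n --> \oo] --> (0 : R).
  by rewrite -(mulr0 (C * N' (g t))); exact: cvgMl_tmp.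
apply/subr_cvg0; apply/norm_cvg0P.
apply: (@squeeze_cvgr _ _ _ _ (fun=> 0) (fun n => (C * N' (g t)) * N (f t - s n t))); last exact: hC.
  by near=> n; rewrite normr_ge0 distrC h.
exact: cvg_cst.
Unshelve. all: by end_near. Qed.

End BilinearPaths.

(** * The dual of V *)

Section RealFacts.
Context {R : realType}.
Notation mu := (@lebesgue_measure R).

Lemma quadratic_quotient (a b : R) (e0 e1 e2 : R -> R) (F : R -> R -> R) (F0 : R -> R) :
  int_on a b e0 -> int_on a b e1 -> int_on a b e2 ->
  (forall t, a < t < b -> F0 t = e0 t) ->
  (forall al t, a < t < b -> F al t = e0 t + al * e1 t + al ^+ 2 * e2 t) ->
  (\int[mu]_(t in `]a, b[) F al t - \int[mu]_(t in `]a, b[) F0 t) / al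
    @[al --> 0^'+] --> \int[mu]_(t in `]a, b[) e1 t.
Proof.
move=> i0 i1 i2 hF0 hF.
have E0 : \int[mu]_(t in `]a, b[) F0 t = \int[mu]_(t in `]a, b[) e0 t.
  by apply: eq_Rintegral => t; rewrite inE/= in_itv/=; exact: hF0.
have E1 al : \int[mu]_(t in `]a, b[) F al t = \int[mu]_(t in `]a, b[) e0 t +
    al * \int[mu]_(t in `]a, b[) e1 t + al ^+ 2 * \int[mu]_(t in `]a, b[) e2 t.
  rewrite -!RintegralZl// -!RintegralD//.
  - by apply: eq_Rintegral => t; rewrite inE/= in_itv/=; exact: hF.
  - by apply: int_onD => //; exact: int_onZ.
  - exact: int_onZ.
  - exact: int_onZ.
move: (\int[mu]_(t in `]a, b[) e0 t) (\int[mu]_(t in `]a, b[) e1 t) (\int[mu]_(t in `]a, b[) e2 t) E0 E1.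
move=> I0 I1 I2 E0 E1.
apply: (@cvg_trans _ ((fun al : R => I1 + al * I2) @ 0^'+)).
  apply: near_eq_cvg; near=> al; rewrite E0 E1.
  have al0 : al != 0 by rewrite gt_eqF//; near: al; exact: nbhs_right_gt.
  by field.
have : I1 + al * I2 @[al --> 0^'+] --> I1 + 0 * I2.
  apply: cvgD; first exact: cvg_cst.
  by apply: cvgMr_tmp; apply: cvg_at_right_filter; exact: cvg_id.
by rewrite mul0r addr0.
Unshelve. all: by end_near. Qed.

Lemma test_int_restrict (a b c d : R) (f phi : R -> R) : a <= c -> d <= b -> test_fun c d phi ->
  \int[mu]_(t in `]a, b[) (f t * phi t) = \int[mu]_(t in `]c, d[) (f t * phi t).
Proof.
move=> ac db tphi; rewrite Rintegral_mkcond [RHS]Rintegral_mkcond.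
apply: eq_Rintegral => t _; rewrite !patchE.
have [tcd|tcd] := boolP (c < t < d); last by rewrite (test_out tphi tcd) mulr0 !if_same.
case/andP: tcd => ct td; rewrite !mem_set//= in_itv/=; first by rewrite ct.
by rewrite (le_lt_trans ac ct) (lt_le_trans td db).
Qed.

Lemma test_funS (a b c d : R) (phi : R -> R) : a <= c -> d <= b -> test_fun c d phi -> test_fun a b phi.
Proof.
move=> ac db [sp [c' [d' [cc dd p0]]]]; split => //; exists c', d'; split => //.
  exact: le_lt_trans ac cc.
exact: lt_le_trans dd db.
Qed.

End RealFacts.

Section Dual.
Context {R : realType} (B : cracked_beam R).
Notation mu := (@lebesgue_measure R).
Implicit Types (u v w f g : fct R) (F G : functional R).

Lemma inVd_subspace : subspace (inVd B).
Proof.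
split.
  by split=> [a u v _ _|]; [rewrite mulr0 addr0|exists 0 => v _; rewrite mul0r normr0].
move=> a F G [Fl [C FC]] [Gl [C' GC]]; split=> [c u v Vu Vv|].
  rewrite !fctE/= Fl// Gl// /GRing.scale/=; ring.
exists (`|a| * C + C') => v Vv; rewrite !fctE/=.
apply: le_trans (ler_normD _ _) _; rewrite mulrDl normrM -mulrA.
by apply: lerD; [apply: ler_wpM2l => //; exact: FC|exact: GC].
Qed.

Lemma normVd_ub F : inVd B F ->
  has_ubound [set `|F v : R| | v in [set v | inV B v /\ normV B v <= 1]].
Proof.
move=> [_ [C FC]]; exists `|C| => _ [v [Vv v1] <-].
apply: le_trans (FC v Vv) _; apply: (@le_trans _ _ (`|C| * normV B v)).
  by apply: ler_wpM2r; [exact: normV_ge0|exact: ler_norm].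
by rewrite ler_piMr.
Qed.

Lemma normV0 : normV B 0 = 0.
Proof.
rewrite /normV (_ : ipV B 0 0 = 0) ?sqrtr0//.
exact: (semi0l (ipV_semi B) (inV0 B)).
Qed.

Lemma normVZ (a : R) v : inV B v -> normV B (a *: v) = `|a| * normV B v.
Proof.
move=> Vv; have h := semiZl (ipV_semi B) a Vv (subspaceZ (ipV_semi B) a Vv).
have h' := semiZr (ipV_semi B) a Vv Vv.
have e : ipV B (a *: v) (a *: v) = a ^+ 2 * ipV B v v.
  by apply: etrans h _; apply: etrans (congr1 (fun z : R => a * z) h') _; rewrite mulrA expr2.
by apply: etrans (congr1 Num.sqrt e) _; rewrite sqrtrM ?sqr_ge0// sqrtr_sqr.
Qed.

(** When the norm of v is zero, v need not be the zero function, and the bound in [inVd] is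
    used instead of scaling. *)
Lemma normVd_bound F v : inVd B F -> inV B v -> `|F v : R| <= normVd B F * normV B v.
Proof.
move=> VF Vv; have [Fl [C FC]] := VF; have [n0|n0] := eqVneq (normV B v) 0.
  by have := FC v Vv; rewrite n0 !mulr0.
have np : 0 < normV B v by rewrite lt_neqAle eq_sym n0 normV_ge0.
rewrite -ler_pdivrMr//.
have Vw : inV B ((normV B v)^-1 *: v) by exact: (subspaceZ (ipV_semi B)).
have -> : `|F v : R| / normV B v = `|F ((normV B v)^-1 *: v) : R|.
  have := Fl (normV B v)^-1 v 0 Vv (inV0 B); rewrite addr0 => ->.
  have -> : F 0 = 0 :> R by exact: (linear_on0 (inV_subspace B) Fl).
  by rewrite addr0 normrM mulrC normfV (ger0_norm (ltW np)).
apply: sup_upper_bound; last first.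
  exists ((normV B v)^-1 *: v) => //; split => //.
  by rewrite normVZ// normfV (ger0_norm (ltW np)) mulVf.
split; last exact: normVd_ub.
exists `|F 0 : R|, 0 => //; split; first exact: inV0.
by rewrite normV0 ler01.
Qed.

Let half_lt (s z : R) : s - s / 2 < z -> s <= 2 * z.
Proof. lra. Qed.

Lemma almost_norming F : inVd B F -> exists v, [/\ inV B v, normV B v <= 1 &
  forall w, inV B w -> normV B w <= 1 -> `|F w : R| <= 2 * `|F v : R|].
Proof.
move=> VF; set S := [set `|F v : R| | v in [set v | inV B v /\ normV B v <= 1]].
have hS : has_sup S.
  split; last exact: normVd_ub.
  exists `|F 0 : R|, 0 => //; split; first exact: inV0.
  by rewrite normV0 ler01.
have Sle w : inV B w -> normV B w <= 1 -> `|F w : R| <= sup S.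
  by move=> Vw w1; apply: sup_upper_bound => //; exists w.
have [s0|s0] := leP (sup S) 0.
  exists 0; split; [exact: inV0|by rewrite normV0 ler01|move=> w Vw w1].
  by rewrite (le_trans (Sle w Vw w1))// (le_trans s0)// mulr_ge0.
have [_ [v [Vv v1] <-] hv] := @sup_adherent _ S (sup S / 2) (divr_gt0 s0 (ltr0Sn R 1)) hS.
exists v; split => // w Vw w1; apply: le_trans (Sle w Vw w1) _.
exact: half_lt hv.
Qed.

Let mul_le1 (c n : R) : 0 < c -> n <= 1 -> c * n <= c.
Proof. by move=> c0 n1; rewrite ler_piMr// ltW. Qed.

Let vanish_arith (p q r s e : R) : 0 < e -> p <= q + r -> q <= e / 4 -> r <= 2 * s -> s <= e / 4 -> p <= e.
Proof. lra. Qed.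

(** The null set in the last hypothesis depends on v. It is enough to use the countably
    many v_i that almost attain the norms of the functionals D i: off a single null set G t
    vanishes at all v_i, and if D i is close to G t then D i (v_i) is small, so that D i has
    small norm and so has G t. *)
Lemma weakly_null_path (a b : R) (I : countType) (D : I -> functional R) (G : R -> functional R) :
  (forall i, inVd B (D i)) ->
  (forall t, a < t < b -> inVd B (G t)) ->
  (forall t, a < t < b -> forall e : R, 0 < e -> exists i, forall v, inV B v ->
     `|(G t v : R) - D i v| <= e * normV B v) ->
  (forall v, inV B v -> {ae mu, forall t, t \in `]a, b[ -> G t v = 0 :> R}) ->
  {ae mu, forall t, t \in `]a, b[ -> eqVd B (G t) 0}.
Proof.
move=> VD VG GD G0.
have [v hv] := choice (fun i => almost_norming (VD i)).
have : {ae mu, forall t, forall n : nat, if unpickle n is Some i then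
     t \in `]a, b[ -> G t (v i) = 0 :> R else True}.
  apply: ae_foralln => n; case: (unpickle n) => [i|]; last exact: aeW.
  by apply: G0; case: (hv i).
apply: filterS => t ht tab w Vw.
have {}ht i : G t (v i) = 0 :> R by have := ht (pickle i); rewrite pickleK; exact.
rewrite in_itv/= in tab.
have H w' : inV B w' -> normV B w' <= 1 -> G t w' = 0 :> R.
  move=> Vw' w1; apply/eqP; rewrite -normr_le0; apply/ler_addgt0Pr => e e0; rewrite add0r.
  have e4 : 0 < e / 4 by rewrite divr_gt0.
  have [i hi] := GD t tab (e / 4) e4; have [Vv v1 vn] := hv i.
  have h1 := hi w' Vw'; have h2 := hi (v i) Vv; have h3 := vn w' Vw' w1.
  have h1' := le_trans h1 (mul_le1 e4 w1).
  have h2' : `|D i (v i) : R| <= e / 4.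
    rewrite -normrN -(sub0r (D i (v i) : R)) -[X in X - _](ht i).
    exact: le_trans h2 (mul_le1 e4 v1).
  have : `|G t w' : R| <= `|(G t w' : R) - D i w'| + `|D i w' : R|.
    by rewrite -[X in `|X| <= _](subrK (D i w' : R)) ler_normD.
  by move=> h4; exact: vanish_arith e0 h4 h1' h3 h2'.
have n0 := normV_ge0 B w; have [Gl _] := VG t tab.
have n1 : 0 < normV B w + 1 by rewrite ltr_wpDl.
have := H ((normV B w + 1)^-1 *: w) (subspaceZ (ipV_semi B) _ Vw).
rewrite normVZ// normfV (ger0_norm (ltW n1)) mulrC ler_pdivrMr// mul1r.
move=> /(_ _)/wrap[|]; first by rewrite lerDl.
have := Gl (normV B w + 1)^-1 w 0 Vw (inV0 B); rewrite addr0 => ->.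
have -> : G t 0 = 0 :> R by exact: (linear_on0 (inV_subspace B) Gl).
by rewrite addr0 => /eqP; rewrite mulf_eq0 invr_eq0 gt_eqF//= => /eqP.
Qed.

End Dual.

(** * The equation of motion *)

Section QuadraticLine.
Context {R : realType} (E : lmodType R) (P : set E) (b : E -> E -> R).
Hypothesis (Pb : semi_inner P b).

Lemma quad_line f v (al c : R) : P f -> P v ->
  quad b (f + al *: (c *: v)) = quad b f + al * (c * b f v) + al ^+ 2 * (c ^+ 2 * quad b v).
Proof.
move=> Pf Pv; rewrite scalerA addrC /quad (semi_expand Pb)//.
have -> : b v f = b f v by case: Pb.
by field.
Qed.

Lemma semi_liner f w v (al c : R) : P f -> P w -> P v ->
  b w (f + al *: (c *: v)) = b w f + al * (c * b w v).
Proof. by move=> Pf Pw Pv; rewrite scalerA addrC (semi_linr Pb)// addrC mulrA. Qed.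

End QuadraticLine.

Section PartB.
Context {R : realType} (B : cracked_beam R).
Notation mu := (@lebesgue_measure R).
Implicit Types (u v w f g : fct R) (F G : functional R).

Lemma ipH_linear_on v : inH B v -> linear_on (inH B) (fun f => ipH B f v).
Proof. by move=> Hv a f g Hf Hg; exact: ipH_lin. Qed.

Lemma ipH_bound f v : inH B f -> inH B v -> `|ipH B f v| <= normH B v * normH B f.
Proof. by move=> Hf Hv; rewrite mulrC; exact: (semi_CS (ipH_semi B) Hf Hv). Qed.

Lemma inV_H v : inV B v -> inH B v.
Proof. by move=> Vv; exact: (inV_inH (j := 0) Vv). Qed.

Lemma opA_linear_on v : inV B v -> linear_on (inV B) (fun u => opA B u v : R).
Proof. by move=> Vv a u w Vu Vw; case: (opA_semi B) => _ _ h _; exact: h. Qed.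

(** This embedding of H into V' is continuous by the Poincare inequality. *)
Lemma emb_inVd f : inH B f -> inVd B (emb B f).
Proof.
move=> Hf; split; first by move=> a u v Vu Vv; exact: (semi_linr (ipH_semi B) a (inV_H Vu) (inV_H Vv) Hf).
have [C C0 hC] := poincare B; exists (C * normH B f) => v Vv.
apply: le_trans (ipH_bound Hf (inV_H Vv)) _; rewrite mulrC mulrAC [leRHS]mulrC [leRHS]mulrC.
rewrite mulrC; apply: ler_wpM2r; [exact: sqrtr_ge0|exact: hC].
Qed.

Section Evolution.
Variables (T cd : R) (p y dy : R -> fct R) (ddy : R -> functional R) (t1 t2 : R).
Hypotheses (hp : L2path (inH B) (normH B) T p) (hW : inW B T y dy ddy).
Hypotheses (t10 : 0 <= t1) (t12 : t1 < t2) (t2T : t2 <= T).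

Let hy : L2path (inV B) (normV B) T y. Proof. by case: hW. Qed.
Let hdy : L2path (inH B) (normH B) T dy. Proof. by case: hW. Qed.
Let hddy : L2path (inVd B) (normVd B) T ddy. Proof. by case: hW. Qed.

Let yV t : 0 < t < T -> inV B (y t).
Proof. by move=> tT; case: hy => -[s _ /(_ t tT)[]]. Qed.
Let dyH t : 0 < t < T -> inH B (dy t).
Proof. by move=> tT; case: hdy => -[s _ /(_ t tT)[]]. Qed.
Let pH t : 0 < t < T -> inH B (p t).
Proof. by move=> tT; case: hp => -[s _ /(_ t tT)[]]. Qed.
Let ddyV t : 0 < t < T -> inVd B (ddy t).
Proof. by move=> tT; case: hddy => -[s _ /(_ t tT)[]]. Qed.

Let sub t : t1 < t < t2 -> 0 < t < T.
Proof. by move=> /andP[a b]; rewrite (le_lt_trans t10 a) (lt_le_trans b t2T). Qed.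

Let restrict (f : R -> R) : int_on 0 T f -> int_on t1 t2 f.
Proof. exact: int_onS. Qed.

Let H_sub : subspace (inH B). Proof. by case: (ipH_semi B). Qed.

Lemma int_opA v : inV B v -> int_on t1 t2 (fun t => opA B (y t) v : R).
Proof.
move=> Vv; have [c c0 hc] := opA_bounded B; apply: restrict; apply: L2_int.
apply: (linear_path_L2 (inV_subspace B) hy (opA_linear_on Vv) (C := c * normV B v)) => u Vu.
by rewrite mulrAC; exact: hc.
Qed.

Lemma int_dy v : inH B v -> int_on t1 t2 (fun t => ipH B (dy t) v).
Proof.
move=> Hv; apply: restrict; apply: L2_int.
apply: (linear_path_L2 H_sub hdy (ipH_linear_on Hv) (C := normH B v)) => u Hu; exact: ipH_bound.
Qed.

Lemma int_p v : inH B v -> int_on t1 t2 (fun t => ipH B (p t) v).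
Proof.
move=> Hv; apply: restrict; apply: L2_int.
apply: (linear_path_L2 H_sub hp (ipH_linear_on Hv) (C := normH B v)) => u Hu; exact: ipH_bound.
Qed.

Lemma int_ddy v : inV B v -> int_on t1 t2 (fun t => ddy t v : R).
Proof.
move=> Vv; apply: restrict; apply: L2_int.
apply: (linear_path_L2 (inVd_subspace B) hddy (q := fun F => F v : R) (C := normV B v)).
  by move=> a F G _ _.
by move=> F VF; rewrite mulrC; exact: normVd_bound.
Qed.

Lemma int_kin : int_on t1 t2 (fun t => quad (ipH B : fct R -> fct R -> R) (dy t)).
Proof.
apply: restrict; case: hdy => _ /L2_sqr/(int_onZ 2^-1).
apply: eq_integrable => // t _; apply: (congr1 EFin); apply: (congr1 (fun z : R => 2^-1 * z)).
exact: semi_norm_sqr (ipH_semi B) _.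
Qed.

Lemma int_Ub : int_on t1 t2 (fun t => quad (opA B : fct R -> fct R -> R) (y t)).
Proof.
have [c c0 hc] := opA_bounded B; apply: restrict; apply: int_onZ.
apply: (bilinear_path_int (inV_subspace B) (inV_subspace B) hy hy
  (b := (opA B : fct R -> fct R -> R)) (C := c)).
- by move=> v; exact: opA_linear_on.
- by move=> u Vu a v w Vv Vw; exact: opA_linear_right.
- exact: hc.
Qed.

(** The load is paired with y in H while y is only measurable into V; the Poincare
    inequality bounds the pairing. *)
Lemma int_work : int_on t1 t2 (fun t => ipH B (p t) (y t)).
Proof.
have [C C0 hC] := poincare B; apply: restrict.
apply: (bilinear_path_int H_sub (inV_subspace B) hp hy (b := (ipH B : fct R -> fct R -> R)) (C := C)).
- by move=> v Vv; exact: ipH_linear_on (inV_H Vv).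
- move=> f Hf a v w Vv Vw; exact: (semi_linr (ipH_semi B) a (inV_H Vv) (inV_H Vw) Hf).
- move=> f v Hf Vv; apply: le_trans (ipH_bound Hf (inV_H Vv)) _.
  by rewrite mulrAC; apply: ler_wpM2r; [exact: sqrtr_ge0|exact: hC].
Qed.

Let expand_arith (k q w k1 q1 w1 k2 q2 al c0 c1 : R) :
  (k + al * (c1 * k1) + al ^+ 2 * (c1 ^+ 2 * k2)) -
  (q + al * (c0 * q1) + al ^+ 2 * (c0 ^+ 2 * q2)) + (w + al * (c0 * w1)) =
  (k - q + w) + al * (c1 * k1 - c0 * q1 + c0 * w1) + al ^+ 2 * (c1 ^+ 2 * k2 - c0 ^+ 2 * q2).
Proof. by ring. Qed.

(** The action at y + alpha zeta v is a polynomial of degree 2 in alpha with integrable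
    coefficients; this is its coefficient of degree 1. *)
Lemma action_derivative (zeta : R -> R) v : smooth zeta -> inV B v ->
  (action_cons B t1 t2 p (fun t => y t + al *: (zeta t *: v))
       (fun t => dy t + al *: (derive1 zeta t *: v)) - action_cons B t1 t2 p y dy) / al
    @[al --> 0^'+] -->
  \int[mu]_(t in `]t1, t2[) (derive1 zeta t * ipH B (dy t) v - zeta t * (opA B (y t) v : R)
     + zeta t * ipH B (p t) v).
Proof.
move=> sz Vv; have Hv := inV_H Vv.
have cz := smooth_continuous sz; have cz' := smooth_continuous (smooth_derive sz).
have mulC (f : R -> R) (g : R -> R) : continuous g -> int_on t1 t2 f ->
    int_on t1 t2 (fun t => g t * f t).
  by move=> cg fi; have := int_on_test fi cg; under eq_fun do rewrite mulrC.
have kinE f : 2^-1 * normH B f ^+ 2 = quad (ipH B : fct R -> fct R -> R) f.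
  by apply: (congr1 (fun z : R => 2^-1 * z)); exact: semi_norm_sqr (ipH_semi B) _.
apply: (@quadratic_quotient _ t1 t2
  (fun t => quad (ipH B : fct R -> fct R -> R) (dy t)
      - quad (opA B : fct R -> fct R -> R) (y t) + ipH B (p t) (y t))
  _ (fun t => derive1 zeta t ^+ 2 * quad (ipH B : fct R -> fct R -> R) v
      - zeta t ^+ 2 * quad (opA B : fct R -> fct R -> R) v)).
- exact: int_onD (int_onB int_kin int_Ub) int_work.
- apply: int_onD; last exact: mulC cz (int_p Hv).
  apply: int_onB; [exact: mulC cz' (int_dy Hv)|exact: mulC cz (int_opA Vv)].
- have sq (g : R -> R) (c : R) : continuous g -> int_on t1 t2 (fun t => g t ^+ 2 * c).
    move=> cg; have := mulC _ _ cg (mulC _ _ cg (int_on_cst t1 t2 c)).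
    by under eq_fun do rewrite mulrA -expr2.
  apply: int_onB; exact: sq.
- move=> t tt; apply: (congr2 (fun z1 z2 : R => z1 - z2 + _)); first exact: kinE.
  exact: Ub_opA.
- move=> al t tt; have tT := sub tt.
  have e1 := quad_line (ipH_semi B) al (derive1 zeta t) (dyH tT) Hv.
  have e2 := quad_line (opA_semi B) al (zeta t) (yV tT) Vv.
  have e3 := semi_liner (ipH_semi B) al (zeta t) (inV_H (yV tT)) (pH tT) Hv.
  apply: etrans (expand_arith _ _ _ _ _ _ _ _ _ _ _).
  apply: (congr2 +%R); last exact: e3.
  apply: (congr2 (fun z1 z2 : R => z1 - z2)).
    exact: etrans (kinE _) e1.
  exact: etrans (Ub_opA B _) e2.
Qed.

Let weak_arith0 (d a z z' q : R) : 0 = z' - a + q + - cd * z -> z' = - d -> d + a + cd * z - q = 0.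
Proof. by move=> h1 h2; rewrite h2 in h1; lra. Qed.

Let weak_arith (D A Y Q phi phi' : R -> R) :
  int_on t1 t2 (fun t => D t * phi t) -> int_on t1 t2 (fun t => A t * phi t) ->
  int_on t1 t2 (fun t => Y t * phi t) -> int_on t1 t2 (fun t => Y t * phi' t) ->
  int_on t1 t2 (fun t => Q t * phi t) ->
  0 = \int[mu]_(t in `]t1, t2[) (phi' t * Y t - phi t * A t + phi t * Q t)
      + - cd * (\int[mu]_(t in `]t1, t2[) (Y t * phi t)) ->
  (\int[mu]_(t in `]t1, t2[) (Y t * phi' t)) = - (\int[mu]_(t in `]t1, t2[) (D t * phi t)) ->
  \int[mu]_(t in `]t1, t2[) ((D t + A t + cd * Y t - Q t) * phi t) = 0.
Proof.
move=> iD iA iY iY' iQ.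
have -> : \int[mu]_(t in `]t1, t2[) (phi' t * Y t - phi t * A t + phi t * Q t) =
    \int[mu]_(t in `]t1, t2[) (Y t * phi' t) - \int[mu]_(t in `]t1, t2[) (A t * phi t)
      + \int[mu]_(t in `]t1, t2[) (Q t * phi t).
  rewrite -RintegralB// -RintegralD//; last exact: int_onB.
  by apply: eq_Rintegral => t _; ring.
have -> : \int[mu]_(t in `]t1, t2[) ((D t + A t + cd * Y t - Q t) * phi t) =
    \int[mu]_(t in `]t1, t2[) (D t * phi t) + \int[mu]_(t in `]t1, t2[) (A t * phi t)
      + cd * \int[mu]_(t in `]t1, t2[) (Y t * phi t) - \int[mu]_(t in `]t1, t2[) (Q t * phi t).
  have iY2 := int_onZ cd iY; have iDA := int_onD iD iA.
  rewrite -RintegralZl// -RintegralD// -RintegralD// -RintegralB//; last exact: int_onD.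
  by apply: eq_Rintegral => t _; ring.
exact: weak_arith0.
Qed.

(** With test functions of ]t1, t2[ as zeta, the term in zeta' becomes the pairing with ddy
    by the definition of the time derivative, and the fundamental lemma applies. *)
Lemma stationary_weak v : stationary B t1 t2 cd p y dy -> inV B v ->
  {ae mu, forall t, t \in `]t1, t2[ ->
    (ddy t + opA B (y t) + cd *: emb B (dy t) - emb B (p t)) v = 0 :> R}.
Proof.
move=> st Vv; have Hv := inV_H Vv.
pose h t : R := (ddy t v : R) + (opA B (y t) v : R) + cd * ipH B (dy t) v - ipH B (p t) v.
have ih : int_on t1 t2 h.
  apply: int_onB (int_p Hv); apply: int_onD; last exact: int_onZ (int_dy Hv).
  exact: int_onD (int_ddy Vv) (int_opA Vv).
have h0 phi : test_fun t1 t2 phi -> \int[mu]_(t in `]t1, t2[) (h t * phi t) = 0.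
  move=> tphi; have cphi := test_continuous tphi; have sphi := test_smooth tphi.
  have cphi' := smooth_continuous (smooth_derive sphi).
  have z1 : phi t1 = 0 by apply: (test_out tphi); rewrite ltxx.
  have z2 : phi t2 = 0 by apply: (test_out tphi); rewrite ltxx andbF.
  have [c hc hd] := st phi v sphi z1 z2 Vv.
  have cE := cvg_unique (@Rhausdorff R) hc (action_derivative sphi Vv).
  move: hd; rewrite cE /damping_variation => hd.
  have [_ _ _ _ td] := hW.
  have := td phi (test_funS t10 t2T tphi) v Vv.
  rewrite (test_int_restrict _ t10 t2T (test_derive tphi)) (test_int_restrict _ t10 t2T tphi).
  move=> hdd.
  exact: (weak_arith (int_on_test (int_ddy Vv) cphi) (int_on_test (int_opA Vv) cphi)
    (int_on_test (int_dy Hv) cphi) (int_on_test (int_dy Hv) cphi') (int_on_test (int_p Hv) cphi) hd hdd).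
by have := fundamental_lemma ih h0; apply: filterS => t.
Qed.

(** The thresholds for r1, ..., r4 share e equally between the four paths, whose errors are
    weighted by the norms of the maps of V', V and H into V'. *)
Let eps_arith (e n a1 a2 a3 a4 c1 c2 c3 r1 r2 r3 r4 : R) : 0 < c1 -> 0 <= c2 -> 0 < c3 -> 0 <= n ->
  `|a1| <= r1 * n -> `|a2| <= c1 * r2 * n -> `|a3| <= c3 * r3 * n -> `|a4| <= c3 * r4 * n ->
  r1 < e / 4 -> r2 < e / 4 / c1 -> r3 < e / 4 / c3 / (c2 + 1) -> r4 < e / 4 / c3 ->
  0 <= r3 -> `|a1 + a2 + c2 * a3 - a4| <= e * n.
Proof.
move=> c10 c20 c30 n0 h1 h2 h3 h4 k1 k2 k3 k4 r30.
have b1 : `|a1| <= e / 4 * n by apply: le_trans h1 _; apply: ler_wpM2r => //; exact: ltW.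
have b2 : `|a2| <= e / 4 * n.
  apply: le_trans h2 _; apply: ler_wpM2r => //.
  by rewrite ltr_pdivlMr// in k2; rewrite mulrC ltW.
have b4 : `|a4| <= e / 4 * n.
  apply: le_trans h4 _; apply: ler_wpM2r => //.
  by rewrite ltr_pdivlMr// in k4; rewrite mulrC ltW.
have b3 : `|c2 * a3| <= e / 4 * n.
  rewrite normrM (ger0_norm c20); apply: le_trans (ler_wpM2l c20 h3) _.
  rewrite mulrA; apply: ler_wpM2r => //.
  have c21 : 0 < c2 + 1 by rewrite ltr_wpDl.
  rewrite ltr_pdivlMr// ltr_pdivlMr// in k3.
  by apply: le_trans (ltW k3); have := mulr_ge0 (ltW c30) r30; nra.
apply: le_trans (ler_normB _ _) _; apply: le_trans (lerD (ler_normD _ _) (lexx _)) _.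
apply: le_trans (lerD (lerD (ler_normD _ _) (lexx _)) (lexx _)) _; lra.
Qed.

Let sum4_arith (d d' a a' i i' q q' c : R) :
  d + a + c * i - q - (d' + a' + c * i' - q') = (d - d') + (a - a') + c * (i - i') - (q - q').
Proof. ring. Qed.

(** The residual of the equation of motion is approximated by functionals built in the same
    way from countable dense parts of the ranges of the four paths. *)
Lemma motion_of_stationary : 0 <= cd -> stationary B t1 t2 cd p y dy ->
  {ae mu, forall t, t \in `[t1, t2] -> motion_eq B cd p y dy ddy t}.
Proof.
move=> cd0 st.
pose G t : functional R := ddy t + opA B (y t) + cd *: emb B (dy t) - emb B (p t).
have VG t : t1 < t < t2 -> inVd B (G t).
  move=> /sub tT; apply: (subspace_sub (inVd_subspace B)); last exact: emb_inVd (pH tT).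
  rewrite addrC; apply: (inVd_subspace B).2; first exact: emb_inVd (dyH tT).
  rewrite -[ddy t]scale1r; apply: (inVd_subspace B).2; [exact: ddyV|exact: opA_inVd (yV tT)].
have [d1 [Vd1 sd1]] := strongly_measurable_separable (inVd_subspace B) hddy.1.
have [d2 [Vd2 sd2]] := strongly_measurable_separable (inV_subspace B) hy.1.
have [d3 [Vd3 sd3]] := strongly_measurable_separable H_sub hdy.1.
have [d4 [Vd4 sd4]] := strongly_measurable_separable H_sub hp.1.
pose J := (nat * seq bool)%type.
pose D (i : J * J * J * J) : functional R := let: (i1, i2, i3, i4) := i in
  d1 i1.1 i1.2 + opA B (d2 i2.1 i2.2) + cd *: emb B (d3 i3.1 i3.2) - emb B (d4 i4.1 i4.2).
have VD i : inVd B (D i).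
  case: i => [[[i1 i2] i3] i4].
  apply: (subspace_sub (inVd_subspace B)); last exact: emb_inVd.
  rewrite addrC; apply: (inVd_subspace B).2; first exact: emb_inVd.
  by rewrite -[d1 _ _]scale1r; apply: (inVd_subspace B).2 => //; exact: opA_inVd.
have [c1 c10 hc1] := opA_bounded B; have [c3 c30 hc3] := poincare B.
have GD t : t1 < t < t2 -> forall e : R, 0 < e -> exists i, forall v, inV B v ->
    `|(G t v : R) - D i v| <= e * normV B v.
  move=> /sub tT e e0; have e4 : 0 < e / 4 by rewrite divr_gt0.
  have cd1 : 0 < cd + 1 by rewrite ltr_wpDl.
  have [n1 [l1 h1]] := sd1 t tT _ e4.
  have [n2 [l2 h2]] := sd2 t tT _ (divr_gt0 e4 c10).
  have [n3 [l3 h3]] := sd3 t tT _ (divr_gt0 (divr_gt0 e4 c30) cd1).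
  have [n4 [l4 h4]] := sd4 t tT _ (divr_gt0 e4 c30).
  exists ((n1, l1), (n2, l2), (n3, l3), (n4, l4)) => v Vv; have Hv := inV_H Vv.
  have ipb f g : inH B f -> inH B g -> `|ipH B f v - ipH B g v| <= c3 * normH B (f - g) * normV B v.
    move=> Hf Hg.
    have -> : ipH B f v - ipH B g v = ipH B (f - g) v.
      by rewrite (semiBl (ipH_semi B) Hf Hg Hv).
    have Hfg := subspaceB (ipH_semi B) Hf Hg.
    apply: le_trans (ipH_bound Hfg Hv) _; rewrite mulrAC; apply: ler_wpM2r; first exact: sqrtr_ge0.
    exact: hc3.
  have b1 : `|(ddy t v : R) - d1 n1 l1 v| <= normVd B (ddy t - d1 n1 l1) * normV B v.
    have V1 := subspace_sub (inVd_subspace B) (ddyV tT) (Vd1 n1 l1).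
    exact: normVd_bound V1 Vv.
  have b2 : `|(opA B (y t) v : R) - opA B (d2 n2 l2) v| <= c1 * normV B (y t - d2 n2 l2) * normV B v.
    have V2 := subspaceB (opA_semi B) (yV tT) (Vd2 n2 l2).
    have e2 := semiBl (opA_semi B) (yV tT) (Vd2 n2 l2) Vv.
    have := hc1 _ _ V2 Vv; apply: le_trans; rewrite le_eqVlt; apply/orP; left; apply/eqP.
    exact: (congr1 Num.norm (esym e2)).
  have b3 := ipb _ _ (dyH tT) (Vd3 n3 l3); have b4 := ipb _ _ (pH tT) (Vd4 n4 l4).
  have := eps_arith c10 cd0 c30 (normV_ge0 B v) b1 b2 b3 b4 h1 h2 h3 h4 (sqrtr_ge0 _).
  apply: le_trans; rewrite le_eqVlt; apply/orP; left; apply/eqP.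
  exact: (congr1 Num.norm (sum4_arith _ _ _ _ _ _ _ _ _)).
have := weakly_null_path VD VG GD (fun v Vv => stationary_weak st Vv).
have n1 : {ae mu, forall t, t != t1}.
  exists [set t1]; split => //; first exact: lebesgue_measure_set1.
  by move=> t /= /negP; rewrite negbK => /eqP.
have n2 : {ae mu, forall t, t != t2}.
  exists [set t2]; split => //; first exact: lebesgue_measure_set1.
  by move=> t /= /negP; rewrite negbK => /eqP.
apply: filterS3 n1 n2 => t tt1 tt2 h; rewrite in_itv/= => /andP[a b] v Vv.
have := h _ v Vv; rewrite in_itv/= !lt_neqAle eq_sym tt1 tt2 a b => /(_ isT) /eqP.
by rewrite subr_eq0 => /eqP.
Qed.

End Evolution.
End PartB.

(** * Piecewise smooth test functions *)

Section Piecewise.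
Context {R : realType} (B : cracked_beam R).
Notation mu := (@lebesgue_measure R).
Notation m := (ncracks B).
Notation x := (pos B).
Notation theta := (flex B).
Implicit Types (u v w f g h : fct R) (q : nat -> R -> R).

(** The value at the nodes is 0; as elements of H these functions do not depend on it. *)
Definition piecewise q : fct R := fun s => \sum_(i < m.+1) (\1_(`]x i, x i.+1[%classic : set R) s * q i s).

Lemma piecewiseE q i s : (i <= m)%N -> x i < s < x i.+1 -> piecewise q s = q i s.
Proof.
move=> im /andP[s1 s2]; rewrite /piecewise (bigD1 (Ordinal (im : (i < m.+1)%N)))//= big1 ?addr0.
  by rewrite indicE mem_set ?mul1r//= in_itv/= s1.
move=> [j /= jm] /eqP/val_eqP/= ji; rewrite indicE memNset ?mul0r//= in_itv/= => /andP[s3 s4].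
rewrite ltnS in jm; case: (ltngtP j i) => [lt|gt|e]; last by rewrite e eqxx in ji.
  have := @pos_le _ B j.+1 i lt (leqW im); lra.
have := @pos_le _ B i.+1 j gt (leqW jm); lra.
Qed.

Lemma L2_eq (a b : R) (u v : R -> R) : (forall s, a < s < b -> u s = v s) -> L2 a b u -> L2 a b v.
Proof.
move=> uv; rewrite /L2 (_ : u \_ `]a, b[ = v \_ `]a, b[)//.
apply/funext => s; rewrite !patchE; case: ifP => //; rewrite inE/= in_itv/=; exact: uv.
Qed.

Lemma weak_deriv_eq_on (a b : R) (u v g h : R -> R) : (forall s, a < s < b -> u s = v s) ->
  (forall s, a < s < b -> g s = h s) -> weak_deriv a b u g -> weak_deriv a b v h.
Proof.
move=> uv gh ug phi tphi.
have -> : \int[mu]_(s in `]a, b[) (v s * derive1 phi s) = \int[mu]_(s in `]a, b[) (u s * derive1 phi s).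
  by apply: eq_Rintegral => s; rewrite inE/= in_itv/= => sab; rewrite uv.
have -> : \int[mu]_(s in `]a, b[) (h s * phi s) = \int[mu]_(s in `]a, b[) (g s * phi s).
  by apply: eq_Rintegral => s; rewrite inE/= in_itv/= => sab; rewrite gh.
exact: ug.
Qed.

Lemma ae_itv_eq (a b : R) (u v : R -> R) : (forall s, a < s < b -> u s = v s) ->
  {ae mu, forall s, s \in `]a, b[ -> u s = v s}.
Proof. by move=> uv; apply: aeW => s; rewrite in_itv/=; exact: uv. Qed.

Lemma piecewise_inH q : (forall i, (i <= m)%N -> L2 (x i) (x i.+1) (q i)) -> inH B (piecewise q).
Proof.
by move=> hq i im; apply: L2_eq (hq i im) => s sx; rewrite (piecewiseE q im sx).
Qed.

Lemma piecewise_is_wD q q' : (forall i, (i <= m)%N -> L2 (x i) (x i.+1) (q' i)) ->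
  (forall i, (i <= m)%N -> weak_deriv (x i) (x i.+1) (q i) (q' i)) ->
  is_wD B (piecewise q) (piecewise q').
Proof.
move=> hq hqq; split; first exact: piecewise_inH.
move=> i im; apply: weak_deriv_eq_on (hqq i im) => s sx; first by rewrite (piecewiseE q im sx).
by rewrite (piecewiseE q' im sx).
Qed.

Section SmoothPieces.
Variable (q : nat -> R -> R).
Hypothesis (sq : forall i, smooth (q i)).

Let q1 i := derive1 (q i).
Let q2 i := derive1 (q1 i).
Let sq1 i : smooth (q1 i). Proof. exact: smooth_derive. Qed.
Let sq2 i : smooth (q2 i). Proof. exact: smooth_derive. Qed.

Let smooth_L2 (r : R -> R) (a b : R) : smooth r -> L2 a b r.
Proof. by move=> /smooth_continuous; exact: L2_continuous. Qed.

Let smooth_wd (r : R -> R) (a b : R) : smooth r -> weak_deriv a b r (derive1 r).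
Proof. by move=> sr; exact: AC_weak_deriv (AC_smooth a b sr). Qed.

Lemma piecewise_wDn : inHk B 2 (piecewise q) /\
  aeH B (wDn B 1 (piecewise q)) (piecewise q1) /\
  aeH B (wDn B 2 (piecewise q)) (piecewise q2).
Proof.
have [|j|H h] := @inHk_chain _ B 2 (piecewise q)
  (fun j => if j is j'.+1 then (if j' is _.+1 then piecewise q2 else piecewise q1) else piecewise q) _ erefl.
- by apply: piecewise_inH => i _; exact: smooth_L2.
- case: j => [_|[_|//]]; apply: piecewise_is_wD => i _; try exact: smooth_L2; exact: smooth_wd.
- by split; [exact: H|split; [exact: (h 1%N isT)|exact: (h 2%N isT)]].
Qed.

Lemma piecewise_right_val i : (i <= m)%N -> is_right_val (piecewise q) (x i) (q i (x i)).
Proof.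
move=> im; apply: (@right_val_eq _ (q i) _ _ (x i.+1)); first exact: pos_lt.
  by apply: ae_itv_eq => s sx; rewrite (piecewiseE q im sx).
by apply: cvg_right_val; apply: cvg_at_right_filter; exact: smooth_continuous.
Qed.

Lemma piecewise_left_val i : (i <= m)%N -> is_left_val (piecewise q) (x i.+1) (q i (x i.+1)).
Proof.
move=> im; apply: (@left_val_eq _ (q i) _ _ (x i)); first exact: pos_lt.
  by apply: ae_itv_eq => s sx; rewrite (piecewiseE q im sx).
by apply: cvg_left_val; apply: cvg_at_left_filter; exact: smooth_continuous.
Qed.

End SmoothPieces.

(** The conditions under which the smooth pieces q i make up an element of V: the slopes at
    the nodes are free. *)
Definition compatible q : Prop :=
  [/\ forall i, smooth (q i), q 0%N (x 0%N) = 0, q m (x m.+1) = 0 &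
      forall i, (i < m)%N -> q i.+1 (x i.+1) = q i (x i.+1)].

Lemma piecewise_inV q : compatible q -> inV B (piecewise q).
Proof.
move=> [sq q0 qpi qj]; split.
- by case: (piecewise_wDn sq).
- by have := piecewise_right_val sq (leq0n m); rewrite q0 pos0.
- by have := piecewise_left_val sq (leqnn m); rewrite qpi pos_end.
- case=> [//|i] /= im; exists (q i.+1 (x i.+1)), (q i (x i.+1)); split.
  + exact: piecewise_right_val.
  + exact: (piecewise_left_val sq (ltnW im : (i <= m)%N)).
  + by rewrite qj// subrr.
Qed.

Lemma piecewise_jump q i : (forall i, smooth (q i)) -> (i < m)%N ->
  jump (wDn B 1 (piecewise q)) (x i.+1) = derive1 (q i.+1) (x i.+1) - derive1 (q i) (x i.+1).
Proof.
move=> sq im; have [_ [e1 _]] := piecewise_wDn sq.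
have sq1 j : smooth (derive1 (q j)) by exact: smooth_derive.
apply: etrans (@jump_aeH _ B _ _ i.+1 im e1) _.
by rewrite /jump (right_valE (piecewise_right_val sq1 im)) (left_valE (piecewise_left_val sq1 (ltnW im))).
Qed.

Lemma ipH_piecewise w q : inH B w -> (forall i, smooth (q i)) ->
  ipH B w (piecewise q) = \sum_(0 <= i < m.+1) \int[mu]_(s in `]x i, x i.+1[) (w s * q i s).
Proof.
move=> Hw sq; apply: eq_big_nat => i /=; rewrite ltnS => im.
apply: eq_Rintegral => s; rewrite inE/= in_itv/= => sx; exact: congr1 (piecewiseE q im sx).
Qed.

(** The contribution of the i-th interval to the weak equation A u = f tested with r, where
    w stands for u'' and E i for the moment exerted by the i-th crack. *)
Definition residual w f (E : nat -> R) i (r : R -> R) : R :=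
  \int[mu]_(s in `]x i, x i.+1[) (w s * derive1 (derive1 r) s)
  - \int[mu]_(s in `]x i, x i.+1[) (f s * r s)
  + E i * derive1 r (x i) - E i.+1 * derive1 r (x i.+1).

(** The ends of the beam are hinged and exert no moment, whence the value 0 there. *)
Definition moment u i : R := if (1 <= i <= m)%N then (theta i)^-1 * jump (wDn B 1 u) (x i) else 0.

Let shift_sum (a b : nat -> R) : a 0%N = 0 -> b m = 0 ->
  \sum_(0 <= i < m.+1) (a i - b i) = \sum_(0 <= i < m) (a i.+1 - b i).
Proof.
move=> a0 bm; rewrite sumrB big_nat_recl//= a0 add0r.
rewrite [X in _ - X](_ : _ = \sum_(0 <= i < m) b i); first by rewrite sumrB.
by rewrite big_nat_recr//= bm addr0.
Qed.

Let moment_arith (t j d d' : R) : t * (j * (d - d')) = t * j * d - t * j * d'.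
Proof. ring. Qed.

Let residual_split (a f e e' : nat -> R) :
  \sum_(0 <= i < m.+1) (a i - f i + e i - e' i) =
  \sum_(0 <= i < m.+1) a i + \sum_(0 <= i < m.+1) (e i - e' i) - \sum_(0 <= i < m.+1) f i.
Proof. by rewrite -big_split/= -sumrB; apply: eq_bigr => i _; ring. Qed.

(** The crack terms E_i (q_i' - q_(i-1)') are regrouped by intervals, which is possible
    because the moments at both ends of the beam are zero. *)
Lemma residual_sum0 u f q : inV B u -> represents_opA B f u -> compatible q ->
  \sum_(0 <= i < m.+1) residual (wDn B 2 u) f (moment u) i (q i) = 0.
Proof.
move=> Vu [Hf uf] cq; have Vq := piecewise_inV cq; have [sq _ _ _] := cq.
have sq2 i : smooth (derive1 (derive1 (q i))) by do 2 apply: smooth_derive; exact: sq.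
have [_ [_ e2]] := piecewise_wDn sq.
have Hu := inV_inH Vu (leqnn 2); have Hq := inV_inH Vq (leqnn 2).
have Hq2 : inH B (piecewise (fun i => derive1 (derive1 (q i)))).
  by apply: piecewise_inH => i _; exact: L2_continuous (smooth_continuous (sq2 i)).
have a1 : ipH B (wDn B 2 u) (wDn B 2 (piecewise q)) =
    \sum_(0 <= i < m.+1) \int[mu]_(s in `]x i, x i.+1[) (wDn B 2 u s * derive1 (derive1 (q i)) s).
  by apply: etrans (ipH_ae2 Hu Hu Hq Hq2 (@aeH_refl _ _ _) e2) _; exact: ipH_piecewise.
have a2 := ipH_piecewise Hf sq.
have a3 : \sum_(1 <= i < m.+1) (theta i)^-1 * (jump (wDn B 1 u) (x i) * jump (wDn B 1 (piecewise q)) (x i)) =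
    \sum_(0 <= i < m.+1) (moment u i * derive1 (q i) (x i) - moment u i.+1 * derive1 (q i) (x i.+1)).
  rewrite (@shift_sum (fun i => moment u i * _) (fun i => moment u i.+1 * _)); last 2 first.
  - by rewrite /moment mul0r.
  - by rewrite /moment ltnn andbF mul0r.
  rewrite big_add1/=; apply: eq_big_nat => i /= im.
  apply: etrans (congr1 (fun z : R => (theta i.+1)^-1 * (_ * z)) (piecewise_jump sq im)) _.
  rewrite /moment/= im; exact: moment_arith.
have e := uf _ Vq; rewrite /opA /emb in e.
have e' := etrans (esym (congr2 +%R a1 a3)) (etrans e a2).
apply: etrans (residual_split _ _ _ _) _; apply/eqP; rewrite subr_eq0; apply/eqP; exact: e'.
Qed.

End Piecewise.

(** * Joint conditions on the domain of A *)

Section Shapes.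
Context {R : realType}.
Implicit Types (u v : R -> R) (a b c d s : R).

Definition affine c d : R -> R := fun s => c * s + d.

Lemma smooth_affine_fun c d : smooth (affine c d).
Proof. exact: (@smooth_affine _ id c d (@smooth_id R)). Qed.

Lemma derive1_affine c d s : derive1 (affine c d) s = c.
Proof.
have h := @is_deriveD R R^o R^o (c *: id) (cst d) s 1 _ _
  (@is_deriveZ R R^o R^o id c s 1 _ (is_derive_id s 1)) (is_derive_cst d s 1).
by rewrite derive1E; have := @derive_val _ _ _ _ _ _ _ h; rewrite addr0 /GRing.scale/= mulr1.
Qed.

Lemma derive1_mul u v s : smooth u -> smooth v ->
  derive1 (u \* v) s = u s * derive1 v s + v s * derive1 u s.
Proof. by move=> su sv; rewrite !derive1E deriveM//; exact: smooth_derivable. Qed.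

(** A cubic polynomial that vanishes with its derivative at b, and vanishes at a with a
    nonzero slope. *)
Definition slope_left a b : R -> R := affine 1 (- a) \* (affine (-1) b \* affine (-1) b).
(** The mirror image of [slope_left]. *)
Definition slope_right a b : R -> R := affine (-1) b \* (affine 1 (- a) \* affine 1 (- a)).

Lemma smooth_slope_left a b : smooth (slope_left a b).
Proof. by apply: smoothM; [|apply: smoothM]; exact: smooth_affine_fun. Qed.

Lemma smooth_slope_right a b : smooth (slope_right a b).
Proof. by apply: smoothM; [|apply: smoothM]; exact: smooth_affine_fun. Qed.

Lemma slope_leftE a b : [/\ slope_left a b a = 0, slope_left a b b = 0,
  derive1 (slope_left a b) a = (b - a) ^+ 2 & derive1 (slope_left a b) b = 0].
Proof.
have s1 := @smooth_affine_fun 1 (- a); have s2 := @smooth_affine_fun (-1) b.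
have s3 := smoothM s2 s2.
rewrite !(derive1_mul _ s1 s3) !(derive1_mul _ s2 s2) !derive1_affine /slope_left /affine/=.
by split; ring.
Qed.

Lemma slope_rightE a b : [/\ slope_right a b a = 0, slope_right a b b = 0,
  derive1 (slope_right a b) a = 0 & derive1 (slope_right a b) b = - (b - a) ^+ 2].
Proof.
have s1 := @smooth_affine_fun 1 (- a); have s2 := @smooth_affine_fun (-1) b.
have s3 := smoothM s1 s1.
rewrite !(derive1_mul _ s2 s3) !(derive1_mul _ s1 s1) !derive1_affine /slope_right /affine/=.
by split; ring.
Qed.

End Shapes.

Section Joints.
Context {R : realType} (B : cracked_beam R).
Notation mu := (@lebesgue_measure R).
Notation m := (ncracks B).
Notation x := (pos B).
Variables (w f : fct R) (E : nat -> R).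
Hypotheses (Hw : inH B w) (Hf : inH B f).
Hypothesis (sum0 : forall q, compatible B q ->
  \sum_(0 <= i < m.+1) residual B w f E i (q i) = 0).

Let derive1_zero : derive1 (cst 0 : R -> R) = cst 0.
Proof. by apply/funext => s; rewrite derive1_cst. Qed.

Lemma residual0 i : residual B w f E i (cst 0) = 0.
Proof.
rewrite /residual !derive1_zero /= !mulr0 addr0 subr0.
have I0 (g : R -> R) (A : set R) : measurable A -> \int[mu]_(s in A) (g s * 0) = 0.
  by move=> mA; under eq_Rintegral do rewrite mulr0; rewrite Rintegral_cst// mul0r.
by rewrite !I0// subrr.
Qed.

Let sum_single (g : nat -> R) j : (j <= m)%N -> (forall i, i != j -> g i = 0) ->
  \sum_(0 <= i < m.+1) g i = g j.
Proof.
move=> jm g0; rewrite big_mkord (bigD1 (Ordinal (jm : (j < m.+1)%N)))//= big1 ?addr0//.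
by move=> i ij; exact: g0.
Qed.

Let sum_pair (g : nat -> R) j : (j < m)%N -> (forall i, i != j -> i != j.+1 -> g i = 0) ->
  \sum_(0 <= i < m.+1) g i = g j + g j.+1.
Proof.
move=> jm g0; rewrite big_mkord (bigD1 (Ordinal (ltnW jm : (j < m.+1)%N)))//=.
rewrite (bigD1 (Ordinal (jm : (j.+1 < m.+1)%N)))/=; last by rewrite -val_eqE/= gtn_eqF.
by rewrite big1 ?addr0// => i /andP[i1 i2]; exact: g0.
Qed.

(** Two neighbouring pieces with a common value at the crack between them, and zero pieces
    elsewhere, are compatible. *)
Lemma residual_pair j (r1 r2 : R -> R) : (j < m)%N -> smooth r1 -> smooth r2 ->
  r1 (x j) = 0 -> r1 (x j.+1) = r2 (x j.+1) -> r2 (x j.+2) = 0 ->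
  residual B w f E j r1 + residual B w f E j.+1 r2 = 0.
Proof.
move=> jm s1 s2 e1 e12 e2.
pose q i := if i == j then r1 else if i == j.+1 then r2 else cst 0.
have cq : compatible B q.
  split.
  - move=> i; rewrite /q; case: ifP => _; first exact: s1.
    by case: ifP => _; [exact: s2|exact: smooth_cst].
  - by rewrite /q; case: j e1 {jm e12 e2 q} => [//|j] e1.
  - rewrite /q gtn_eqF//; case: ifP => // /eqP e; by rewrite e e2.
  - move=> i im; rewrite /q eqSS; case: (eqVneq i j) => [->|ij].
      by rewrite eqn_leq ltnn /= e12.
    case: (eqVneq i.+1 j) => [e|ij'].
      by rewrite -e in e1 *; rewrite e1 (ltn_eqF (ltnW (ltnSn _))).
    by case: (eqVneq i j.+1) => [->|//]; rewrite e2.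
have h := sum0 cq; rewrite (sum_pair (j := j) jm) in h; last first.
  by move=> i /negbTE i1 /negbTE i2; rewrite /q i1 i2; exact: residual0.
by move: h; rewrite /q !eqxx gtn_eqF.
Qed.

Lemma residual_single j (r : R -> R) : (j <= m)%N -> smooth r ->
  r (x j) = 0 -> r (x j.+1) = 0 -> residual B w f E j r = 0.
Proof.
move=> jm s1 e1 e2.
pose q i := if i == j then r else cst 0.
have cq : compatible B q.
  split.
  - by move=> i; rewrite /q; case: ifP => _; [exact: s1|exact: smooth_cst].
  - by rewrite /q; case: ifP => // /eqP ->.
  - by rewrite /q; case: ifP => // /eqP ->.
  - move=> i im; rewrite /q; case: (eqVneq i.+1 j) => [e|_]; case: (eqVneq i j) => [e'|_] //=.
      by rewrite e e1.
    by rewrite e' e2.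
have h := sum0 cq; rewrite (sum_single (j := j) jm) in h; last first.
  by move=> i /negbTE i1; rewrite /q i1; exact: residual0.
by move: h; rewrite /q eqxx.
Qed.

(** A test function of one interval has no boundary terms, so that f is the second weak
    derivative of w there; the derivatives of first order are then glued. *)
Lemma strong_derivatives : exists z : fct R, is_wD B w z /\ is_wD B z f.
Proof.
have H j : exists k, (j <= m)%N -> weak_deriv (x j) (x j.+1) w (fun s => k + prim (x j) f s).
  have [jm|] := leqP j m; last by exists 0.
  have [|k hk] := @weak_deriv2_AC _ (x j) (x j.+1) w f (pos_lt jm) (inH_int Hw jm) (inH_int Hf jm).
    move=> phi tphi; have := @residual_single j phi jm (test_smooth tphi).
    have td := test_derive tphi.
    have o1 : ~~ (x j < x j < x j.+1) by rewrite ltxx.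
    have o2 : ~~ (x j < x j.+1 < x j.+1) by rewrite ltxx andbF.
    rewrite (test_out tphi o1) (test_out tphi o2) => /(_ erefl erefl).
    rewrite /residual (test_out td o1) (test_out td o2) !mulr0 addr0 subr0 => /eqP.
    by rewrite subr_eq0 => /eqP.
  by exists k.
have [k hk] := choice H.
have zAC j : (j <= m)%N -> AC (x j) (x j.+1) (fun s => k j + prim (x j) f s) f (k j).
  move=> jm; have fi := inH_int Hf jm; split => //.
  - apply: int_onD; first exact: int_on_cst.
    by have := prim_int fi (int_on_cst _ _ 1); under eq_fun do rewrite mulr1.
  - exact: aeW.
have zL2 j : (j <= m)%N -> L2 (x j) (x j.+1) (fun s => k j + prim (x j) f s).
  move=> jm; have fi := inH_int Hf jm.
  apply: (@L2_bounded _ _ _ _ (`|k j| + \int[mu]_(s in `]x j, x j.+1[) `|f s|)).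
    by have [h _ _] := zAC j jm; exact: int_on_mfun h.
  move=> s /andP[_ sx]; apply: le_trans (ler_normD _ _) _; rewrite lerD2l.
  exact: prim_le_norm fi (ltW sx).
pose z := piecewise B (fun j s => k j + prim (x j) f s).
have Hz : inH B z by exact: piecewise_inH.
exists z; split; split => // j jm.
- by apply: weak_deriv_eq_on (hk j jm) => s sx //; rewrite /z (piecewiseE _ jm sx).
- by apply: weak_deriv_eq_on (AC_weak_deriv (zAC j jm)) => s sx //; rewrite /z (piecewiseE _ jm sx).
Qed.

Variable (z : fct R).
Hypotheses (wz : is_wD B w z) (zf : is_wD B z f).

Let Hz : inH B z. Proof. by case: wz. Qed.

Let residual_arith (iw iz if' lw rw lz rz ea eb dra drb ra rb : R) :
  iw + iz = lw * drb - rw * dra -> iz + if' = lz * rb - rz * ra ->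
  iw - if' + ea * dra - eb * drb = (lw - eb) * drb - (rw - ea) * dra - lz * rb + rz * ra.
Proof. by move=> h1 h2; have := congr2 +%R h1 (congr1 -%R h2); lra. Qed.

Let shear_arith (e e' e'' d1 d2 d3 d4 k rz lz rz0 lz2 : R) :
  (e' - e') * d1 - (e - e) * d2 - lz * k + rz0 * 0 +
  ((e'' - e'') * d3 - (e' - e') * d4 - lz2 * 0 + rz * k) = 0 -> k * (rz - lz) = 0.
Proof. by move=> h; rewrite -[RHS]h; ring. Qed.

(** Integrating by parts twice leaves the boundary terms alone. *)
Lemma residual_ibp j r : (j <= m)%N -> smooth r -> residual B w f E j r =
  (left_val w (x j.+1) - E j.+1) * derive1 r (x j.+1)
  - (right_val w (x j) - E j) * derive1 r (x j)
  - left_val z (x j.+1) * r (x j.+1) + right_val z (x j) * r (x j).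
Proof.
move=> jm sr; have xl := ltW (pos_lt jm).
have [wA _ _ wl] := is_wD_AC Hw wz jm; have [zA _ _ zl] := is_wD_AC Hz zf jm.
have sr' := smooth_derive sr.
have i1 := AC_ibp wA (AC_smooth _ _ sr'); have i2 := AC_ibp zA (AC_smooth _ _ sr).
have e1 : prim (x j) (derive1 (derive1 r)) (x j.+1) = derive1 r (x j.+1) - derive1 r (x j).
  exact: smooth_FTC.
have e2 : prim (x j) (derive1 r) (x j.+1) = r (x j.+1) - r (x j) by exact: smooth_FTC.
rewrite e1 -wl subrKC in i1; rewrite e2 -zl subrKC in i2.
exact: residual_arith i1 i2.
Qed.

(** [slope_left] and [slope_right] isolate one boundary term each. *)
Lemma moment_traces j : (j <= m)%N -> right_val w (x j) = E j /\ left_val w (x j.+1) = E j.+1.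
Proof.
move=> jm; have h0 : x j.+1 - x j != 0 by rewrite subr_eq0 gt_eqF// pos_lt.
split.
- have [a1 a2 a3 a4] := slope_leftE (x j) (x j.+1).
  have := residual_single jm (@smooth_slope_left _ (x j) (x j.+1)) a1 a2.
  rewrite (residual_ibp jm (@smooth_slope_left _ (x j) (x j.+1))) a1 a2 a3 a4 !mulr0 subr0 addr0 sub0r.
  move=> /eqP; rewrite oppr_eq0 mulf_eq0 expf_eq0/= (negbTE h0) orbF subr_eq0 => /eqP; exact.
- have [a1 a2 a3 a4] := slope_rightE (x j) (x j.+1).
  have := residual_single jm (@smooth_slope_right _ (x j) (x j.+1)) a1 a2.
  rewrite (residual_ibp jm (@smooth_slope_right _ (x j) (x j.+1))) a1 a2 a3 a4 !mulr0 !subr0 addr0.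
  move=> /eqP; rewrite mulf_eq0 oppr_eq0 expf_eq0/= (negbTE h0) orbF subr_eq0 => /eqP; exact.
Qed.

(** The slopes of the test function no longer matter once [moment_traces] is known, so that
    the hat function supported by the two intervals around the crack isolates the jump of z. *)
Lemma shear_continuous j : (j < m)%N -> right_val z (x j.+1) = left_val z (x j.+1).
Proof.
move=> jm; have jm' := ltnW jm.
pose h1 := x j.+1 - x j; pose h2 := x j.+2 - x j.+1.
have h10 : h1 != 0 by rewrite subr_eq0 gt_eqF// pos_lt.
have h20 : h2 != 0 by rewrite subr_eq0 gt_eqF// pos_lt.
have s1 := @smooth_affine_fun _ h2 (- (h2 * x j)).
have s2 := @smooth_affine_fun _ (- h1) (h1 * x j.+2).
have c1 : affine h2 (- (h2 * x j)) (x j) = 0 by rewrite /affine subrr.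
have c3 : affine (- h1) (h1 * x j.+2) (x j.+2) = 0 by rewrite /affine mulNr addNr.
have v1 : affine h2 (- (h2 * x j)) (x j.+1) = h1 * h2 by rewrite /affine /h1 /h2; ring.
have v2 : affine (- h1) (h1 * x j.+2) (x j.+1) = h1 * h2 by rewrite /affine /h1 /h2; ring.
have := residual_pair jm s1 s2 c1 (etrans v1 (esym v2)) c3.
rewrite (residual_ibp jm' s1) (residual_ibp jm s2) c1 c3 v1 v2.
have [-> ->] := moment_traces jm'; have [-> ->] := moment_traces jm.
move=> /shear_arith /eqP.
by rewrite !mulf_eq0 (negbTE h10) (negbTE h20)/= subr_eq0 => /eqP.
Qed.

End Joints.

(** * Regularity on the domain of A and the classical equation *)

Section PartC.
Context {R : realType} (B : cracked_beam R).
Notation mu := (@lebesgue_measure R).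
Notation m := (ncracks B).
Notation x := (pos B).
Notation theta := (flex B).
Implicit Types (u v w f g h : fct R).

(** The chain u, u', u'', z, f, where z is given by [strong_derivatives]. *)
Lemma domain_H4 u f : inV B u -> represents_opA B f u ->
  inHk B 4 u /\ aeH B (wDn B 4 u) f.
Proof.
move=> Vu fu; have [Hf _] := fu.
have Hw := inV_inH Vu (leqnn 2).
have [z [wz zf]] := strong_derivatives Hw Hf (fun q cq => residual_sum0 Vu fu cq).
have Hu : inH B u := inV_H Vu.
pose g (j : nat) : fct R := match j with
  0 => u | 1 => wDn B 1 u | 2 => wDn B 2 u | 3 => z | _ => f end%N.
have [|j|H h] := @inHk_chain _ B 4 u g Hu.
- by [].
- case: j => [_|[_|[_|[_|//]]]].
  + exact: (inV_wD (j := 0) Vu).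
  + exact: (inV_wD (j := 1) Vu).
  + exact: wz.
  + exact: zf.
- by split; [exact: H|exact: (h 4%N (leqnn 4))].
Qed.

Lemma domain_traces u f : inV B u -> represents_opA B f u ->
  (forall j, (j <= m)%N -> is_right_val (wDn B 2 u) (x j) (moment B u j) /\
                           is_left_val (wDn B 2 u) (x j.+1) (moment B u j.+1)) /\
  (forall j, (j < m)%N -> is_jump (wDn B 3 u) (x j.+1) 0).
Proof.
move=> Vu fu; have [Hf _] := fu; have [H4 h4] := domain_H4 Vu fu.
have H2 := inHk_inH H4 (isT : (2 <= 4)%N); have H3 := inHk_inH H4 (isT : (3 <= 4)%N).
have D2 := inHk_wD H4 (isT : (2 < 4)%N); have D3 := inHk_wD H4 (isT : (3 < 4)%N).
have D3f : is_wD B (wDn B 3 u) f := is_wD_ae H3 H3 Hf (@aeH_refl _ _ _) h4 D3.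
have sum0 q (cq : compatible B q) := residual_sum0 Vu fu cq.
split=> j jm.
- have [e1 e2] := moment_traces H2 sum0 D2 D3f jm.
  by have [_ r l _] := is_wD_AC H2 D2 jm; rewrite e1 in r; rewrite e2 in l.
- have e := shear_continuous H2 sum0 D2 D3f jm.
  have [_ r _ _] := is_wD_AC H3 D3 jm; have [_ _ l _] := is_wD_AC H3 D3 (ltnW jm).
  exists (right_val (wDn B 3 u) (x j.+1)), (left_val (wDn B 3 u) (x j.+1)).
  split; [exact: r|exact: l|by rewrite e subrr].
Qed.

Lemma domain_regularity u : inDA B u ->
     [/\ is_right_val u 0 0 /\ is_left_val u pi 0,
         is_right_val (wDn B 2 u) 0 0 /\ is_left_val (wDn B 2 u) pi 0,
         (forall i, (1 <= i <= m)%N ->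
            [/\ is_jump u (x i) 0,
                is_jump (wDn B 2 u) (x i) 0,
                is_jump (wDn B 3 u) (x i) 0 &
                exists2 r : R, is_right_val (wDn B 2 u) (x i) r &
                  is_jump (wDn B 1 u) (x i) (theta i * r)]),
         inHk B 4 u &
         forall f, represents_opA B f u ->
           forall i, (i <= m)%N ->
             \forall s \ae mu, s \in `]x i, x i.+1[ -> f s = wDn B 4 u s].
Proof.
move=> [Vu [f fu]]; have [t2 t3] := domain_traces Vu fu; have [_ u0 upi uj] := Vu.
split.
- by split; [exact: u0|exact: upi].
- have [r _] := t2 0%N (leq0n m); have [_ l] := t2 m (leqnn m).
  rewrite pos0 in r; rewrite pos_end in l; split; first exact: r.
  by move: l; rewrite /moment ltnn andbF.
- case=> [//|i] im; have [r _] := t2 i.+1 im; have [_ l] := t2 i (ltnW im).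
  split; [exact: uj| |exact: t3|].
    exists (moment B u i.+1), (moment B u i.+1).
    by split; [exact: r|exact: l|rewrite subrr].
  exists (moment B u i.+1); first exact: r.
  have H1 := inV_inH Vu (isT : (1 <= 2)%N); have D1 := inV_wD Vu (isT : (1 < 2)%N).
  have [_ r1 _ _] := is_wD_AC H1 D1 (im : (i.+1 <= m)%N).
  have [_ _ l1 _] := is_wD_AC H1 D1 (ltnW im : (i <= m)%N).
  exists (right_val (wDn B 1 u) (x i.+1)), (left_val (wDn B 1 u) (x i.+1)).
  split; [exact: r1|exact: l1|].
  have t0 := flex_gt0 im.
  rewrite /moment im mulrA divff ?gt_eqF// mul1r; exact: erefl.
- by have [] := domain_H4 Vu fu.
- by move=> g gu; have [_ h] := domain_H4 Vu gu; exact: aeH_sym h.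
Qed.

Let solve_arith (d i4 c a q : R) : d + i4 + c * a = q -> d = q - i4 - c * a.
Proof. by move=> <-; ring. Qed.

Let cancel_arith (a b c k : R) : a - b - k * c + b + k * c = a.
Proof. by ring. Qed.

(** Both equations determine the functional ddy t, as an element of H, by the same formula
    once A (y t) is identified with the fourth derivative of y t. *)
Lemma beam_eq_iff (cd : R) (p y dy : R -> fct R) (ddy : R -> functional R) t :
  inH B (p t) -> inH B (dy t) -> inDA B (y t) ->
  (motion_eq B cd p y dy ddy t <-> beam_eq B cd p y dy ddy t).
Proof.
move=> Hp Hdy [Vy [f fy]]; have [Hf fyE] := fy; have [_ h4] := domain_H4 Vy fy.
have lin2 (v : fct R) : inH B v ->
    ipH B (p t - f - cd *: dy t) v = ipH B (p t) v - ipH B f v - cd * ipH B (dy t) v.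
  move=> Hv; have S := ipH_semi B.
  have Hc := subspaceZ S cd Hdy; have Hpf := subspaceB S Hp Hf.
  apply: etrans (semiBl S Hpf Hc Hv) _.
  by apply: (congr2 (fun z z' : R => z - z')); [exact: (semiBl S Hp Hf Hv)|exact: (semiZl S cd Hdy Hv)].
split.
- move=> me; exists (p t - f - cd *: dy t); split.
  + have S := ipH_semi B; apply: (subspaceB S); last exact: (subspaceZ S).
    exact: (subspaceB S).
  + move=> v Vv; have Hv := inV_H Vv.
    have e1 := me v Vv; have e2 := fyE v Vv.
    apply: etrans _ (esym (lin2 v Hv)).
    apply: solve_arith.
    by apply: etrans e1; apply: (congr1 (fun z : R => _ + z + _)); exact: esym e2.
  + move=> i im; have := h4 i im; apply: filterS => s hs sx.
    apply: etrans (congr1 (fun z : R => (p t - f - cd *: dy t) s + z + cd * dy t s) (hs sx)) _.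
    exact: cancel_arith.
- move=> [a [Ha dda ae]] v Vv; have Hv := inV_H Vv.
  have e2 := fyE v Vv.
  have e3 := lin2 v Hv.
  have e4 : ipH B a v = ipH B (p t - f - cd *: dy t) v.
    apply: ipH_ae => //.
      have S := ipH_semi B; apply: (subspaceB S); last exact: (subspaceZ S).
      exact: (subspaceB S).
    move=> i im; apply: filterS2 (ae i im) (h4 i im) => s hs hs4 sx.
    exact: solve_arith (etrans (esym (congr1 (fun z : R => a s + z + cd * dy t s) (hs4 sx))) (hs sx)).
  have e5 := dda v Vv.
  have e6 : ddy t v = ipH B (p t) v - ipH B f v - cd * ipH B (dy t) v :> R.
    exact: etrans e5 (etrans e4 e3).
  apply: etrans (congr2 (fun z z' : R => z + z' + cd * ipH B (dy t) v) e6 e2) _.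
  by rewrite /emb; ring.
Qed.

End PartC.

Theorem mainTheorem2 (R : realType) (B : cracked_beam R) (T cd : R)
    (p : R -> fct R) (hT : 0 < T) (hcd : 0 <= cd)
    (hp : L2path (inH B) (normH B) T p) :
  (* (a) *)
  [/\ convexV B (Ub B),
      lscV B (Ub B),
      (forall u, inV B u -> inVd B (opA B u)) /\
      (forall (a : R) u w, inV B u -> inV B w ->
         eqVd B (opA B (a *: u + w)) (a *: opA B u + opA B w)),
      (forall u v, inV B u -> inV B v -> opA B u v = opA B v u) /\
      (exists2 c : R, 0 < c &
         forall u, inV B u -> c * normV B u ^+ 2 <= opA B u u) &
      forall u, inV B u ->
        Ub B u = 2^-1 * (opA B u u : R) /\
        subdiff B (Ub B) u = [set F | inVd B F /\ eqVd B F (opA B u)]] /\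
  (* (b) *)
  (forall y dy ddy, inW B T y dy ddy ->
     forall t1 t2 : R, 0 <= t1 -> t1 < t2 -> t2 <= T ->
       stationary B t1 t2 cd p y dy ->
       \forall t \ae (@lebesgue_measure R),
         t \in `[t1, t2] -> motion_eq B cd p y dy ddy t) /\
  (* (c) *)
  (forall u, inDA B u ->
     [/\ is_right_val u 0 0 /\ is_left_val u pi 0,
         is_right_val (wDn B 2 u) 0 0 /\ is_left_val (wDn B 2 u) pi 0,
         (forall i, (1 <= i <= ncracks B)%N ->
            [/\ is_jump u (pos B i) 0,
                is_jump (wDn B 2 u) (pos B i) 0,
                is_jump (wDn B 3 u) (pos B i) 0 &
                exists2 r : R, is_right_val (wDn B 2 u) (pos B i) r &
                  is_jump (wDn B 1 u) (pos B i) (flex B i * r)]),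
         inHk B 4 u &
         forall f, represents_opA B f u ->
           forall i, (i <= ncracks B)%N ->
             \forall s \ae (@lebesgue_measure R),
               s \in `]pos B i, pos B i.+1[ -> f s = wDn B 4 u s]) /\
  (forall y dy ddy, inW B T y dy ddy ->
     \forall t \ae (@lebesgue_measure R), t \in `[0, T] ->
       inV B (y t) /\
       (inDA B (y t) ->
          (motion_eq B cd p y dy ddy t <-> beam_eq B cd p y dy ddy t))).
Proof.
split; first exact: bending_energy_properties.
split.
  move=> y dy ddy hW t1 t2 t10 t12 t2T st.
  exact: motion_of_stationary hp hW t10 t2T hcd st.
split; first exact: domain_regularity.
move=> y dy ddy hW.
have n1 : {ae @lebesgue_measure R, forall t, t != 0}.
  exists [set 0]; split => //; first exact: lebesgue_measure_set1.
  by move=> t /= /negP; rewrite negbK => /eqP.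
have n2 : {ae @lebesgue_measure R, forall t, t != T}.
  exists [set T]; split => //; first exact: lebesgue_measure_set1.
  by move=> t /= /negP; rewrite negbK => /eqP.
apply: filterS2 n1 n2 => t t0 tT; rewrite in_itv/= => /andP[a b].
have tt : 0 < t < T by rewrite !lt_neqAle eq_sym t0 tT a b.
case: hW => -[[s _ /(_ t tt)[Vy _]] _] [[s' _ /(_ t tt)[Hdy _]] _] _ _ _.
case: hp => -[s'' _ /(_ t tt)[Hp _]] _.
by split; [exact: Vy|exact: beam_eq_iff].
Qed.
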